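(* Let $\Omega\subset\mathbb{R}^2$ be any quadrilateral and let $\Omega_0$ be a square with the same area as $\Omega$. Then there exist $\alpha_2\le\alpha_1<0$ (depending on $\Omega$) such that for all $\alpha\in(-\infty,\alpha_2]\cup[\alpha_1,0)$ we have $\lambda_1(\Omega,\alpha)\le\lambda_1(\Omega_0,\alpha)$.
   Context: For a bounded polygonal domain $\Omega\subset\mathbb{R}^2$ and $\alpha\in\mathbb{R}$, $\lambda_1(\Omega,\alpha)$ denotes the first eigenvalue of the Robin problem $-\Delta u=\lambda u$ in $\Omega$, $\frac{\partial u}{\partial\nu}+\alpha u=0$ on $\partial\Omega$ ($\nu$ the outward unit normal), given by $$\lambda_1(\Omega,\alpha)=\min_{u\in H^1(\Omega),\,u\ne0}\frac{\int_\Omega|\nabla u|^2\,dx+\alpha\int_{\partial\Omega}|u|^2\,d\sigma}{\int_\Omega|u|^2\,dx},$$ with the boundary integral understood in the sense of traces. A quadrilateral is the (open) interior region of a simple four-sided polygon, not necessarily convex. *)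

(* Defs.v *)
From HB Require Import structures.
From mathcomp Require Import all_boot all_order all_algebra.
From mathcomp Require Import all_classical all_reals all_analysis.
Set Implicit Arguments.
Unset Strict Implicit.
Unset Printing Implicit Defensive.
Import Order.TTheory GRing.Theory Num.Theory.
Import numFieldNormedType.Exports.
Local Open Scope classical_set_scope.
Local Open Scope ring_scope.

Notation area := (lebesgue_measure \x lebesgue_measure)%E.

Section Plane.
Context {R : realType}.

Definition dot (a b : R * R) : R := a.1 * b.1 + a.2 * b.2.

Definition det2 (a b : R * R) : R := a.1 * b.2 - a.2 * b.1.

(* The library norm `|a| on a product is the sup norm. *)
Definition enorm (a : R * R) : R := Num.sqrt (dot a a).

(* A closed polygonal line is given by its cyclic family of vertices;
   [ordS] is the successor modulo [n]. *)
Definition side n (p : 'I_n -> R * R) (i : 'I_n) : R * R := p (ordS i) - p i.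

Definition side_pt n (p : 'I_n -> R * R) (i : 'I_n) (s : R) : R * R :=
  ((p i).1 + s * (side p i).1, (p i).2 + s * (side p i).2).

Definition polygonal_line n (p : 'I_n -> R * R) : set (R * R) :=
  [set x | exists i s, 0 <= s <= 1 /\ x = side_pt p i s].

(* Simplicity: the closed line is run through injectively.  Consecutive sides
   are not collinear, so that there are really [n] sides. *)
Definition simple_polygon n (p : 'I_n -> R * R) : Prop :=
  (forall (i j : 'I_n) (s t : R), 0 <= s < 1 -> 0 <= t < 1 ->
     side_pt p i s = side_pt p j t -> i = j /\ s = t) /\
  (forall i : 'I_n, det2 (side p i) (side p (ordS i)) != 0).

(* Points off the line whose connected component in the complement of the line
   is bounded. *)
Definition interior_region n (p : 'I_n -> R * R) : set (R * R) :=
  [set x | ~ polygonal_line p x /\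
     bounded_set (connected_component (~` polygonal_line p) x)].

Definition quadrilateral (p : 'I_4 -> R * R) : Prop := simple_polygon p.

Definition square (p : 'I_4 -> R * R) : Prop :=
  quadrilateral p /\
  forall i : 'I_4, enorm (side p i) = enorm (side p (ordS i)) /\
                   dot (side p i) (side p (ordS i)) = 0.

(* Integral over the boundary with respect to arc length. *)
Definition boundary_integral n (p : 'I_n -> R * R) (f : R * R -> R) : \bar R :=
  (\sum_(i < n) (enorm (side p i))%:E *
     \int[@lebesgue_measure R]_(s in `[(0 : R)%R, 1%R]) (f (side_pt p i s))%:E)%E.

Definition L2 (D : set (R * R)) (f : R * R -> R) : Prop :=
  measurable_fun D f /\
  area.-integrable D (fun x => (f x ^+ 2)%:E).

Definition L2_boundary n (p : 'I_n -> R * R) (f : R * R -> R) : Prop :=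
  forall i : 'I_n,
    measurable_fun `[(0 : R), 1] (f \o side_pt p i) /\
    (@lebesgue_measure R).-integrable `[(0 : R), 1]
      (fun s : R => (f (side_pt p i s) ^+ 2)%:E).

Definition grad (f : R * R -> R) (x : R * R) : R * R :=
  ('D_((1, 0) : R * R) f x, 'D_((0, 1) : R * R) f x).

Fixpoint classC (k : nat) (f : R * R -> R) : Prop :=
  if k is k'.+1 then
    [/\ continuous f,
        forall x, derivable f x ((1, 0) : R * R) /\
                  derivable f x ((0, 1) : R * R),
        classC k' (fun x => (grad f x).1) &
        classC k' (fun x => (grad f x).2)]
  else continuous f.

Definition test_function (D : set (R * R)) (phi : R * R -> R) : Prop :=
  (forall k, classC k phi) /\
  let supp := closure [set x | phi x != 0] in compact supp /\ supp `<=` D.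

Definition weak_gradient (D : set (R * R)) (u : R * R -> R)
    (g : R * R -> R * R) : Prop :=
  forall phi, test_function D phi ->
    (\int[area]_(x in D) (u x * (grad phi x).1) =
       - (\int[area]_(x in D) ((g x).1 * phi x)))%R /\
    (\int[area]_(x in D) (u x * (grad phi x).2) =
       - (\int[area]_(x in D) ((g x).2 * phi x)))%R.

(* [u] is in H^1(D), with weak gradient [g]. *)
Definition H1 (D : set (R * R)) (u : R * R -> R) (g : R * R -> R * R) : Prop :=
  [/\ L2 D u, L2 D (fun x => (g x).1), L2 D (fun x => (g x).2) &
      weak_gradient D u g].

(* [t] is the trace of [u] (of weak gradient [g]): the image of [u] under the
   continuous extension to H^1 of the restriction to the boundary of functions
   that are C^1 up to the boundary.  The integrals are extended-real valued. *)
Definition trace_of n (p : 'I_n -> R * R) (u : R * R -> R)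
    (g : R * R -> R * R) (t : R * R -> R) : Prop :=
  L2_boundary p t /\
  exists phi : nat -> R * R -> R,
  [/\ forall k, classC 1 (phi k),
      (fun k => \int[area]_(x in interior_region p)
                  ((phi k x - u x) ^+ 2)%:E)%E @ \oo --> 0%E,
      (fun k => \int[area]_(x in interior_region p)
                  (dot (grad (phi k) x - g x) (grad (phi k) x - g x))%:E)%E
        @ \oo --> 0%E &
      (fun k => boundary_integral p (fun x => (phi k x - t x) ^+ 2))
        @ \oo --> 0%E].

Definition rayleigh n (p : 'I_n -> R * R) (alpha : R) (u : R * R -> R)
    (g : R * R -> R * R) (t : R * R -> R) : R :=
  ((\int[area]_(x in interior_region p) dot (g x) (g x))
    + alpha * fine (boundary_integral p (fun x => t x ^+ 2)))
  / (\int[area]_(x in interior_region p) (u x ^+ 2)).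

(* The minimum over nonzero u in H^1 of the Rayleigh quotient, written as an
   infimum in \bar R so that it needs no existence proof. *)
Definition lambda1 n (p : 'I_n -> R * R) (alpha : R) : \bar R :=
  ereal_inf [set q | exists (u : R * R -> R) (g : R * R -> R * R)
                            (t : R * R -> R),
    [/\ H1 (interior_region p) u g, trace_of p u g t,
        ~ {ae area, forall x, interior_region p x -> u x = 0} &
        q = (rayleigh p alpha u g t)%:E]].

End Plane.

(* Main.v *)
Require Import Defs.
From mathcomp Require Import all_boot all_order all_algebra.
From mathcomp Require Import all_classical all_reals all_analysis.
From mathcomp Require Import measurable_realfun ring lra.
Import Order.TTheory GRing.Theory Num.Theory.
Import numFieldNormedType.Exports.
Set Implicit Arguments.
Unset Strict Implicit.
Unset Printing Implicit Defensive.
Local Open Scope classical_set_scope.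
Local Open Scope ring_scope.

(** Write [alpha = - beta] with [beta > 0], and let [l] be the side of the square
    with the area of [p].

    On the square the problem separates. The one-dimensional Robin inequality
    [segment_robin], integrated over the chords parallel to the sides and then
    extended to the whole Sobolev space by the approximations that define traces,
    shows that the first eigenvalue is at least [- 2 * k ^+ 2] as soon as
    [beta <= k * tanh (k * l / 2)] ([lambda1_square_ge]). Hence it is about
    [- 4 * beta / l] for small [beta], and [- 2 * beta ^+ 2] up to an
    exponentially small relative error for large [beta]. On the quadrilateral only
    upper bounds are needed, and they come from smooth trial functions
    ([lambda1_le_trial]); the comparison then amounts to finding a suitable [k]
    ([dominates]).

    For small [beta] the constant trial function gives minus [beta] times the
    perimeter over the area. Among quadrilaterals of given area only the square
    has the least perimeter ([isoperimetric_convex], [isoperimetric_reflex],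
    and an elementary computation for rectangles), so that every other
    quadrilateral wins at first order.

    For large [beta] a corner of acute angle [omega] is decisive. The function
    [expR (- beta * dot w x)] is the ground state of the infinite sector, of
    eigenvalue [- beta ^+ 2 / sin (omega / 2) ^+ 2], strictly below
    [- 2 * beta ^+ 2], and truncating the sector costs exponentially small terms
    ([steep_corner]). The signs of the turns of a simple quadrilateral leave two
    cases ([turns_sign]). A convex quadrilateral has an acute angle unless it is
    a rectangle ([acute_or_right]). A quadrilateral with a reflex angle lies in
    the triangle of the three other vertices, which has an angle of at most 60
    degrees; there the two sides may run inside the sector, but such an angle is
    sharp enough to afford the loss ([steep_narrow]).

    On a rectangle the product of two hyperbolic cosines gives [- 2 * beta ^+ 2]
    minus a term of order [beta * expR (- beta * l1)], where [l1] is the shorter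
    side. Unless the rectangle is a square, [l1 < l], and this beats the error
    term of the square, of order [beta ^+ 2 * expR (- beta * l)]
    ([dominates_rectangle]). On a square the same trial function, with a
    frequency [k] that solves [k * tanh (k * l / 2) = beta], attains the lower
    bound for every [beta] ([dominates_square]).

    The interior of the polygonal line is only ever located by half-planes: a
    point of the region lies strictly on the side of any line on which all
    vertices are ([interior_halfplane]). This bounds the area from above and
    places the region in sectors; only for parallelograms is the region
    determined exactly ([interior_parallelogram]). *)

(** * Continuity, affine substitutions and integrals over the plane *)

Section Continuity.
Context {R : realType} {T : topologicalType}.
Implicit Types f g : T -> R.

Lemma continuous_pair f g : continuous f -> continuous g ->
  continuous (fun t => (f t, g t)).
Proof. by move=> cf cg t; exact: (cvg_pair (cf t) (cg t)). Qed.

Lemma continuousDfun f g : continuous f -> continuous g ->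
  continuous (fun t => f t + g t).
Proof. by move=> cf cg t; exact: (cvgD (cf t) (cg t)). Qed.

Lemma continuousMfun f g : continuous f -> continuous g ->
  continuous (fun t => f t * g t).
Proof. by move=> cf cg t; exact: (cvgM (cf t) (cg t)). Qed.

Lemma continuousNfun f : continuous f -> continuous (fun t => - f t).
Proof. by move=> cf t; exact: (cvgN (cf t)). Qed.

Lemma continuousXfun f k : continuous f -> continuous (fun t => f t ^+ k).
Proof.
move=> cf; elim: k => [|k IH]; first exact: cst_continuous.
under eq_fun do rewrite exprS.
exact: continuousMfun.
Qed.

Lemma continuous_composition (U V : topologicalType) (f : T -> U) (g : U -> V) :
  continuous f -> continuous g -> continuous (fun t => g (f t)).
Proof. by move=> cf cg t; exact: (continuous_comp (cf t) (cg _)). Qed.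

End Continuity.

Lemma continuous_fst (R : realType) : continuous (fst : R * R -> R).
Proof. by move=> t; exact: cvg_fst. Qed.

Lemma continuous_snd (R : realType) : continuous (snd : R * R -> R).
Proof. by move=> t; exact: cvg_snd. Qed.

Section AffineSubstitution.
Context {R : realType}.
Local Notation mu := (@lebesgue_measure R).

Lemma continuous_affine (a b : R) : continuous (fun x : R => a * x + b).
Proof.
move=> x; apply: cvgD; last exact: cvg_cst.
by apply: cvgM; [exact: cvg_cst | exact: cvg_id].
Qed.

Lemma measurable_affine (a b : R) :
  measurable_fun [set: measurableTypeR R]
    ((fun x => a * x + b) : measurableTypeR R -> measurableTypeR R).
Proof.
by apply: (@continuous_measurable_fun R (fun x => a * x + b)); exact: continuous_affine.
Qed.

(** The image measure agrees with a multiple of the Lebesgue measure on the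
    half-open intervals, which determine it. *)
Lemma lebesgue_measure_affine (a b : R) (A : set R) : a != 0 ->
  measurable A ->
  (mu A = `|a|%:E * mu ((fun x => (a * x + b)%R) @^-1` A))%E.
Proof.
move=> a0 mA.
pose k : {nonneg R} := NngNum (normr_ge0 a).
pose m2 := mscale k (measure_function_pushforward__canonical__measure_function_Measure mu (measurable_affine a b)).
rewrite (@lebesgue_measure_unique R m2)//.
move=> _ [[u v]] _ <-.
change (mu `]u, v]%classic = `|a|%:E * mu ((fun x : R => (a * x + b)%R) @^-1` `]u, v]%classic))%E.
have [ap|an|/eqP] := ltgtP a 0; last by rewrite (negbTE a0).
- have -> : (fun x : R => a * x + b) @^-1` `]u, v] = `[(v - b) / a, (u - b) / a[%classic.
    apply/seteqP; split => x /=; rewrite !in_itv/= => /andP[h1 h2]; apply/andP; split.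
    + by rewrite ler_ndivrMr// lerBrDr mulrC.
    + by rewrite ltr_ndivlMr// ltrBlDr mulrC.
    + by move: h2; rewrite ltr_ndivlMr// ltrBlDr mulrC.
    + by move: h1; rewrite ler_ndivrMr// lerBrDr mulrC.
  rewrite !lebesgue_measure_itv/= !lte_fin ltr_ndivrMr// mulrVK ?unitfE// ltrD2r.
  case: ifPn => // uv; last by rewrite mule0.
  rewrite -!EFinD -EFinM ltr0_norm//; congr EFin; field.
  exact: a0.
- have -> : (fun x : R => a * x + b) @^-1` `]u, v] = `](u - b) / a, (v - b) / a]%classic.
    apply/seteqP; split => x /=; rewrite !in_itv/= => /andP[h1 h2]; apply/andP; split.
    + by rewrite ltr_pdivrMr// ltrBlDr mulrC.
    + by rewrite ler_pdivlMr// lerBrDr mulrC.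
    + by move: h1; rewrite ltr_pdivrMr// ltrBlDr mulrC.
    + by move: h2; rewrite ler_pdivlMr// lerBrDr mulrC.
  rewrite !lebesgue_measure_itv/= !lte_fin ltr_pdivrMr// mulrVK ?unitfE// ltrD2r.
  case: ifPn => // uv; last by rewrite mule0.
  rewrite -!EFinD -EFinM gtr0_norm//; congr EFin; field.
  exact: a0.
Qed.

Lemma ge0_integral_affine (a b : R) (f : R -> \bar R) : a != 0 ->
  measurable_fun setT f -> (forall x, 0 <= f x)%E ->
  (\int[mu]_x f x = `|a|%:E * \int[mu]_x f (a * x + b)%R)%E.
Proof.
move=> a0 mf f0.
pose k : {nonneg R} := NngNum (normr_ge0 a).
pose m1 := (measure_function_pushforward__canonical__measure_function_Measure mu (measurable_affine a b)).
transitivity (\int[mscale k m1]_x f x)%E.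
  apply: eq_measure_integral => A mA _.
  exact: (lebesgue_measure_affine b a0).
rewrite ge0_integral_mscale//; congr (_ * _)%E.
rewrite (ge0_integral_pushforward (measurable_affine a b) mu)//.
Qed.

Lemma derive_continuous (f df : R -> R) :
  (forall x : R, is_derive x 1 f (df x)) -> continuous f.
Proof.
by move=> dF x; apply: differentiable_continuous; apply/derivable1_diffP; case: (dF x).
Qed.

Lemma FTC2_everywhere (F f : R -> R) (a b : R) : a <= b ->
  (forall x : R, is_derive x 1 F (f x)) -> continuous f ->
  (\int[mu]_(x in `[a, b]) (f x)%:E = (F b - F a)%:E)%E.
Proof.
rewrite le_eqVlt => /orP[/eqP <-|ab] dF cf.
  by rewrite set_itv1 integral_set1 subrr.
have cF := derive_continuous dF.
rewrite (@continuous_FTC2 R f F)//.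
- exact: continuous_subspaceT.
- split => [x _||]; first by case: (dF x).
  + exact/cvg_at_right_filter/cF.
  + exact/cvg_at_left_filter/cF.
- by move=> x _; rewrite derive1E; apply: derive_val.
Qed.

End AffineSubstitution.

Section PlaneMeasure.
Context {R : realType}.
Local Notation mu := (@lebesgue_measure R).
Implicit Types (f : R * R -> \bar R).

Lemma det2C (v w : R * R) : det2 w v = - det2 v w.
Proof. by rewrite /det2; ring. Qed.

Lemma integral_area12 f : measurable_fun setT f -> (forall x, 0 <= f x)%E ->
  (\int[area]_z f z = \int[mu]_x \int[mu]_y f (x, y))%E.
Proof. by move=> mf f0; exact: (@fubini_tonelli1 _ _ _ _ R mu mu f). Qed.

Lemma integral_area21 f : measurable_fun setT f -> (forall x, 0 <= f x)%E ->
  (\int[area]_z f z = \int[mu]_y \int[mu]_x f (x, y))%E.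
Proof. by move=> mf f0; exact: (@fubini_tonelli2 _ _ _ _ R mu mu f). Qed.

Definition frame (c v w z : R * R) : R * R :=
  (c.1 + z.1 * v.1 + z.2 * w.1, c.2 + z.1 * v.2 + z.2 * w.2).

Lemma measurable_frame c v w : measurable_fun [set: R * R] (frame c v w).
Proof.
apply: measurable_fun_pair => /=.
  apply: measurable_funD.
    by apply: measurable_funD => //; apply: measurable_funM.
  by apply: measurable_funM.
apply: measurable_funD.
  by apply: measurable_funD => //; apply: measurable_funM.
by apply: measurable_funM.
Qed.

Lemma measurable_comp_frame c v w f : measurable_fun setT f ->
  measurable_fun setT (f \o frame c v w).
Proof. by move=> mf; apply: measurableT_comp => //; exact: measurable_frame. Qed.

Lemma measurable_section2 f y : measurable_fun setT f ->
  measurable_fun setT (fun x : R => f (x, y)).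
Proof. by move=> mf; apply: (measurableT_comp mf). Qed.

Lemma measurable_section1 f x : measurable_fun setT f ->
  measurable_fun setT (fun y : R => f (x, y)).
Proof. by move=> mf; apply: (measurableT_comp mf). Qed.

Lemma measurable_integral2 f : measurable_fun setT f ->
  (forall x, 0 <= f x)%E ->
  measurable_fun setT (fun y : R => \int[mu]_x f (x, y))%E.
Proof. by move=> mf f0; exact: measurable_fun_fubini_tonelli_G. Qed.

Lemma measurable_integral1 f : measurable_fun setT f ->
  (forall x, 0 <= f x)%E ->
  measurable_fun setT (fun x : R => \int[mu]_y f (x, y))%E.
Proof. by move=> mf f0; exact: measurable_fun_fubini_tonelli_F. Qed.

Let frame_shear (c v w : R * R) f : v.1 != 0 -> det2 v w != 0 ->
  measurable_fun setT f -> (forall x, 0 <= f x)%E ->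
  (\int[area]_x f x = `|det2 v w|%:E * \int[area]_z f (frame c v w z))%E.
Proof.
move=> v0 d0 mf f0; set d := det2 v w.
have dv : d / v.1 != 0 by rewrite mulf_neq0// invr_eq0.
pose h z := (z.1, z.2 * (d / v.1) + (c.2 + v.2 / v.1 * (z.1 - c.1))).
have mh : measurable_fun [set: R * R] h.
  apply: measurable_fun_pair => //=; apply: measurable_funD.
    exact: measurable_funM.
  apply: measurable_funD => //; apply: measurable_funM => //.
  exact: measurable_funB.
have mH : measurable_fun setT (f \o h) by exact: measurableT_comp.
have H0 z : (0 <= (f \o h) z)%E by exact: f0.
rewrite [X in (_ = _ * X)%E]integral_area21//; last exact: measurable_comp_frame.
have inner r : (\int[mu]_s f (frame c v w (s, r)) =
    `|v.1|^-1%:E * \int[mu]_x (f \o h) (x, r))%E.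
  rewrite [in RHS](@ge0_integral_affine R v.1 (c.1 + r * w.1))//; last first.
    exact: measurable_section2.
  rewrite muleA -EFinM mulVf ?normr_eq0// mul1e; apply: eq_integral => s _.
  congr f; rewrite /frame /h /=; congr pair; first by ring.
  by rewrite /d /det2; field.
have -> : (\int[mu]_r \int[mu]_s f (frame c v w (s, r)) =
    \int[mu]_r (`|v.1|^-1%:E * \int[mu]_x (f \o h) (x, r)))%E.
  by apply: eq_integral => r _; exact: inner.
rewrite ge0_integralZl//; last 2 first.
  - exact: measurable_integral2.
  - by move=> y _; exact: integral_ge0.
rewrite -(integral_area21 mH)// muleA -EFinM integral_area12// integral_area12//.
rewrite -ge0_integralZl//; last 2 first.
  - exact: measurable_integral1.
  - by move=> y _; exact: integral_ge0.
apply: eq_integral => x _.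
rewrite (@ge0_integral_affine R (d / v.1) (c.2 + v.2 / v.1 * (x - c.1)))//; last first.
  exact: measurable_section1.
rewrite normrM normfV; congr (_ * _)%E; apply: eq_integral => y _.
by rewrite /h/= [y * _]mulrC.
Qed.

(** Change of variables for an affine frame: a product of two shears when
    [v.1] is nonzero, each of them settled by Tonelli's theorem and an affine
    substitution on lines; otherwise the two vectors are swapped first. *)
Lemma ge0_integral_frame c v w f : det2 v w != 0 ->
  measurable_fun setT f -> (forall x, 0 <= f x)%E ->
  (\int[area]_x f x = `|det2 v w|%:E * \int[area]_z f (frame c v w z))%E.
Proof.
move=> d0 mf f0; have [v0|v0] := eqVneq v.1 0; last exact: frame_shear.
have w0 : w.1 != 0.
  by apply: contraNneq d0 => w0; rewrite /det2 v0 w0 mul0r mulr0 subr0.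
have d0' : det2 w v != 0 by rewrite det2C oppr_eq0.
rewrite (frame_shear c w0 d0')//; congr (_ * _)%E.
  by rewrite det2C normrN.
rewrite integral_area21//; last exact: measurable_comp_frame.
rewrite [RHS]integral_area12; [|exact: measurable_comp_frame|by move=> ?; exact: f0].
apply: eq_integral => x _; apply: eq_integral => y _.
by rewrite /frame/=; congr (f (_, _)); ring.
Qed.

End PlaneMeasure.

Section Measurability.
Context {R : realType}.
Local Notation mu := (@lebesgue_measure R).

(** The plane is second countable: an open set is the union of the rational
    boxes that it contains. *)
Lemma open_measurable_plane (A : set (R * R)) : open A -> measurable A.
Proof.
move=> oA.
pose box (q : (rat * rat) * (rat * rat)) : set (R * R) :=
  [set x : R | x \in `]ratr q.1.1, ratr q.1.2[] `*`
  [set x : R | x \in `]ratr q.2.1, ratr q.2.2[].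
have -> : A = \bigcup_q (if `[< box q `<=` A >] then box q else set0).
  apply/seteqP; split => [x Ax|x [q _]]; last by case: asboolP => // + bx; apply.
  have /nbhs_ballP[e /= e0 eA] : nbhs x A by exact: open_nbhs_nbhs.
  have approx (y : R) : exists q : rat * rat, (y \in `](ratr q.1 : R), (ratr q.2 : R)[) /\
      forall z : R, (z \in `](ratr q.1 : R), (ratr q.2 : R)[) -> ball y e z.
    have /rat_in_itvoo[q1] : y - e < y by rewrite ltrBlDr ltrDl.
    have /rat_in_itvoo[q2] : y < y + e by rewrite ltrDl.
    rewrite !in_itv/= => /andP[h1 h2] /andP[h3 h4].
    exists (q1, q2); split; rewrite /= ?in_itv/= ?h4 ?h1// => z.
    rewrite in_itv/= => /andP[h5 h6]; rewrite -ball_normE/= ltr_norml; lra.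
  have [q1 [h1 h1']] := approx x.1; have [q2 [h2 h2']] := approx x.2.
  exists (q1, q2) => //=; rewrite asboolT; first by split.
  by move=> z [/= z1 z2]; apply: eA; split; [exact: h1'|exact: h2'].
apply: countable_bigcupT_measurable => // q; case: asboolP => // _.
by apply: measurableX; exact: measurable_itv.
Qed.

Lemma continuous_measurable_plane (f : R * R -> R) :
  continuous f -> measurable_fun setT f.
Proof.
move=> /continuousP cf; apply: (measurability _ (RGenOpens.measurableE R)).
move=> _ [_ [a [b ->] <-]]; rewrite setTI.
apply: open_measurable_plane; apply: cf; exact: interval_open.
Qed.

End Measurability.

(** * The interior of a polygonal line *)

Section InteriorRegion.
Context {R : realType} {n : nat}.
Variable p : 'I_n -> R * R.
Local Notation L := (polygonal_line p).
Local Notation D := (interior_region p).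

Definition ray_pt (x d : R * R) (t : R) : R * R := (x.1 + t * d.1, x.2 + t * d.2).

Lemma continuous_ray_pt x d : continuous (ray_pt x d).
Proof.
by apply: continuous_pair; apply: continuousDfun; try exact: cst_continuous;
  apply: continuousMfun; try exact: cst_continuous; move=> ?; exact: cvg_id.
Qed.

Lemma side_ptE i : side_pt p i = ray_pt (p i) (side p i).
Proof. by []. Qed.

Lemma connected_ray_pt x d (I : interval R) : connected (ray_pt x d @` [set` I]).
Proof.
apply: connected_continuous_connected.
  by apply/connected_intervalP; exact: interval_is_interval.
by apply: continuous_subspaceT; exact: continuous_ray_pt.
Qed.

Lemma closed_polygonal_line : closed L.
Proof.
have -> : L = \bigcup_(i in [set: 'I_n]) (side_pt p i @` `[0, 1]).
  apply/seteqP; split => x.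
    by move=> [i [s [s01 ->]]]; exists i => //; exists s => //=; rewrite in_itv.
  by move=> [i _ [s /=]]; rewrite in_itv/= => s01 <-; exists i, s.
apply: closed_bigcup => //; first exact: finite_finset.
move=> i _; apply: compact_closed; first exact: norm_hausdorff.
apply: continuous_compact; last exact: segment_compact.
by apply: continuous_subspaceT; rewrite side_ptE; exact: continuous_ray_pt.
Qed.

Lemma open_interior_region : open D.
Proof.
rewrite openE => x [Lx bx].
have /nbhs_ballP[e /= e0 eL] : nbhs x (~` L).
  by apply: open_nbhs_nbhs; split => //; exact/closed_openC/closed_polygonal_line.
apply/nbhs_ballP; exists e => //= y xy; split; first exact: eL.
suff <- : connected_component (~` L) x = connected_component (~` L) y by [].
apply: same_connected_component; exists (ray_pt x (y - x) @` `[0, 1]).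
  split; last exact: connected_ray_pt.
  - by exists 0; rewrite /= ?in_itv/= ?lexx ?ler01// /ray_pt !mul0r !addr0 -surjective_pairing.
  - move=> z [t /=]; rewrite in_itv/= => /andP[t0 t1] <-; apply: eL.
    case: xy => h1 h2.
    rewrite -ball_normE/= in h1; rewrite -ball_normE/= in h2.
    split; rewrite -ball_normE/= opprD addrA subrr add0r normrN normrM ger0_norm//.
      by rewrite (le_lt_trans _ h1)// distrC ler_piMl.
    by rewrite (le_lt_trans _ h2)// distrC ler_piMl.
exists 1; rewrite /= ?in_itv/= ?lexx ?ler01// /ray_pt !mul1r.
by rewrite [RHS]surjective_pairing/= !subrKC.
Qed.

(** A ray that avoids the line is connected and unbounded, so that it makes the
    component of its origin unbounded. *)
Lemma ray_notin_interior x d : d != 0 -> (forall t, 0 <= t -> ~ L (ray_pt x d t)) ->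
  ~ D x.
Proof.
move=> d0 ray [Lx [M [_ Mb]]].
have sub : ray_pt x d @` `[0, +oo[ `<=` connected_component (~` L) x.
  apply: connected_component_max; last exact: connected_ray_pt.
    exists 0; rewrite /= ?in_itv/= ?lexx// /ray_pt !mul0r !addr0 -surjective_pairing//.
  by move=> z [t /=]; rewrite in_itv/= andbT => t0 <-; exact: ray.
have bd t : 0 <= t -> `|ray_pt x d t| <= `|M| + 1.
  move=> t0; apply: (Mb (`|M| + 1)); first by rewrite (le_lt_trans (ler_norm M))// ltrDl.
  by apply: sub; exists t => //=; rewrite in_itv/= t0.
have dn : 0 < `|d| by rewrite normr_gt0.
pose t := (`|M| + 1 + `|x| + 1) / `|d|.
have t0 : 0 <= t by rewrite divr_ge0// !addr_ge0.
have E : t *: d = ray_pt x d t - x.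
  by rewrite [RHS]surjective_pairing /ray_pt/= ![_ + t * _]addrC !addrK.
have : `|t *: d| <= `|M| + 1 + `|x|.
  by rewrite E (le_trans (ler_normB _ _))// lerD2r bd.
rewrite normrZ (ger0_norm t0) /t divfK ?gt_eqF//.
by apply/negP; rewrite -ltNge ltrDl.
Qed.

(** Beyond a line that has the polygonal line on one side, the normal of that
    line escapes to infinity. *)
Lemma interior_halfplane (a x : R * R) (c : R) : a != 0 ->
  (forall i, c <= dot a (p i)) -> D x -> c < dot a x.
Proof.
move=> a0 ca Dx; rewrite ltNge; apply/negP => xc.
have aa : 0 < dot a a.
  have : 0 <= dot a a by rewrite /dot addr_ge0// -expr2 sqr_ge0.
  rewrite le_eqVlt => /orP[/eqP/esym|//].
  rewrite /dot -!expr2 => /eqP; rewrite paddr_eq0 ?sqr_ge0// !sqrf_eq0 => /andP[/eqP a1 /eqP a2].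
  by move: a0; rewrite [a]surjective_pairing a1 a2 eqxx.
have cL y : L y -> c <= dot a y.
  move=> [i [s [/andP[s0 s1] ->]]].
  have h1 := ca i; have h2 := ca (ordS i).
  have -> : dot a (side_pt p i s) = (1 - s) * dot a (p i) + s * dot a (p (ordS i)).
    by rewrite /dot /side_pt /side/=; ring.
  have := mulr_ge0 s0 (_ : 0 <= dot a (p (ordS i)) - c); rewrite subr_ge0 => /(_ h2).
  have s1' : 0 <= 1 - s by rewrite subr_ge0.
  have := mulr_ge0 s1' (_ : 0 <= dot a (p i) - c); rewrite subr_ge0 => /(_ h1).
  by lra.
have [Lx _] := Dx.
apply: (@ray_notin_interior x (- a)) => //; first by rewrite oppr_eq0.
move=> t; rewrite le_eqVlt => /orP[/eqP <-|t0].
  by rewrite /ray_pt !mul0r !addr0 -surjective_pairing.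
move=> /cL; apply/negP; rewrite -ltNge.
have -> : dot a (ray_pt x (- a) t) = dot a x - t * dot a a.
  by rewrite /dot /ray_pt/=; ring.
by have := mulr_gt0 t0 aa; lra.
Qed.

(** The four half-planes of a large box that contains the vertices. *)
Lemma interior_region_bounded : exists2 M : R, 0 < M &
  forall x, D x -> `|x.1| < M /\ `|x.2| < M.
Proof.
pose M := 1 + \sum_i (`|(p i).1| + `|(p i).2|).
have Mi i : `|(p i).1| <= M /\ `|(p i).2| <= M.
  have h : 0 <= \sum_(j | j != i) (`|(p j).1| + `|(p j).2|).
    by apply: sumr_ge0 => j _; rewrite addr_ge0.
  rewrite /M (bigD1 i)//=.
  by have := normr_ge0 (p i).1; have := normr_ge0 (p i).2; split; lra.
exists M.
  by rewrite /M ltr_pwDl// sumr_ge0// => i _; rewrite addr_ge0.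
move=> x Dx.
have e1 : (1, 0) != 0 :> R * R by apply/eqP => -[/eqP]; rewrite oner_eq0.
have e2 : (0, 1) != 0 :> R * R by apply/eqP => -[/eqP]; rewrite oner_eq0.
have e1' : - (1, 0) != 0 :> R * R by rewrite oppr_eq0.
have e2' : - (0, 1) != 0 :> R * R by rewrite oppr_eq0.
have := @interior_halfplane _ x (- M) e1 _ Dx.
have := @interior_halfplane _ x (- M) e2 _ Dx.
have := @interior_halfplane _ x (- M) e1' _ Dx.
have := @interior_halfplane _ x (- M) e2' _ Dx.
rewrite /dot/= !(mul1r, mul0r, add0r, addr0, oppr0, mulN1r) !ltrN2.
move=> h1 h2 h3 h4; rewrite !ltr_norml.
split; apply/andP; split; [apply: h4|apply: h2|apply: h3|apply: h1] => i;
  have [] := Mi i; rewrite !ler_norml ?(mul1r, mul0r, add0r, addr0, oppr0, mulN1r); lra.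
Qed.

(** Such a set is both open and closed in the complement of the line, so that
    it contains the component of each of its points. *)
Lemma sub_interior_region (O : set (R * R)) : open O -> bounded_set O ->
  O `&` L = set0 -> closed (O `|` L) -> O `<=` D.
Proof.
move=> oO bO OL cOL x Ox.
have Lx : ~ L x by move=> Lx; have : set0 x by rewrite -OL.
split => //; set C := connected_component (~` L) x.
suff CO : C `<=` O by case: bO => M [Mr bM]; exists M; split => // z zM y /CO; exact: bM.
have E : C `&` O = C.
  apply: (component_connected (A := ~` L) (x := x)).
  - by exists x; split => //; apply: connected_component_refl.
  - by exists O.
  - exists (O `|` L) => //; apply/seteqP; split => y [Cy]; first by split => //; left.
    by case=> // Ly; have := connected_component_sub Cy.
by move=> y Cy; have := Cy; rewrite -/C -E => -[].
Qed.

End InteriorRegion.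

(** * Turns of a simple quadrilateral *)

Section FourIndices.

Lemma ordS4 (i : 'I_4) : ordS (ordS (ordS (ordS i))) = i.
Proof. by apply: val_inj; case: i => -[|[|[|[|//]]]]. Qed.

Lemma ord4P (i j : 'I_4) :
  [\/ j = i, j = ordS i, j = ordS (ordS i) | j = ordS (ordS (ordS i))].
Proof.
case: i => -[|[|[|[|//]]]] hi; case: j => -[|[|[|[|//]]]] hj;
  do [by apply: Or41; apply: val_inj | by apply: Or42; apply: val_inj |
      by apply: Or43; apply: val_inj | by apply: Or44; apply: val_inj].
Qed.

Lemma big_ord4 (T : Type) (idx : T) (op : Monoid.com_law idx) (i : 'I_4) (F : 'I_4 -> T) :
  \big[op/idx]_(j < 4) F j =
  op (F i) (op (F (ordS i)) (op (F (ordS (ordS i))) (F (ordS (ordS (ordS i)))))).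
Proof.
rewrite (bigD1 i)//= (bigD1 (ordS i))/=; last first.
  by case: i => -[|[|[|[|//]]]].
rewrite (bigD1 (ordS (ordS i)))/=; last first.
  by case: i => -[|[|[|[|//]]]].
rewrite (bigD1 (ordS (ordS (ordS i))))/=; last first.
  by case: i => -[|[|[|[|//]]]].
rewrite big1 ?Monoid.mulm1// => j.
by case: (ord4P i j) => ->; rewrite eqxx ?andbF.
Qed.

Lemma ordSS_neq (i : 'I_4) : i <> ordS (ordS i).
Proof. by case: i => -[|[|[|[|//]]]] hi /(congr1 val). Qed.

End FourIndices.

Section Turns.
Context {R : realType}.
Variable p : 'I_4 -> R * R.

Definition turn (i : 'I_4) : R := det2 (side p i) (side p (ordS i)).

(** Either diagonal cuts the polygon into two triangles: both sums are twice
    its signed area. *)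
Lemma turn_alternate i :
  turn i + turn (ordS (ordS i)) =
  turn (ordS i) + turn (ordS (ordS (ordS i))).
Proof. by rewrite /turn /side /det2 !ordS4 /=; ring. Qed.

(** Two consecutive turns one way followed by two turns the other way make the
    first and third sides cross; Cramer's rule gives the crossing point. *)
Lemma simple_turns i (s : R) : simple_polygon p ->
  ~ [/\ 0 < s * turn i, 0 < s * turn (ordS i),
        s * turn (ordS (ordS i)) < 0 & s * turn (ordS (ordS (ordS i))) < 0].
Proof.
move=> [simp _] [h0 h1 h2 h3].
have alt := turn_alternate i.
have E0 : det2 (side p i) (side p (ordS (ordS i))) =
  turn (ordS (ordS (ordS i))) - turn i.
  by rewrite /turn /side /det2 !ordS4 /=; ring.
move: h0 h1 h2 h3 alt E0.
set d0 := turn i; set d1 := turn (ordS i).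
set d2 := turn (ordS (ordS i)); set d3 := turn (ordS (ordS (ordS i))).
move=> h0 h1 h2 h3 alt E0.
have s0 : s != 0 by apply: contraTneq h0 => ->; rewrite mul0r ltxx.
have n21 : s * (d2 - d1) < 0 by rewrite mulrBr; lra.
have n03 : 0 < s * (d0 - d3) by rewrite mulrBr; lra.
have d21 : d2 - d1 != 0 by apply: contraTneq n21 => ->; rewrite mulr0 ltxx.
have d03 : d0 - d3 != 0 by apply: contraTneq n03 => ->; rewrite mulr0 ltxx.
have ha : d2 / (d2 - d1) = (s * d2) / (s * (d2 - d1)) by rewrite -mulf_div divff// mul1r.
have hb : d0 / (d0 - d3) = (s * d0) / (s * (d0 - d3)) by rewrite -mulf_div divff// mul1r.
have a01 : 0 <= d2 / (d2 - d1) < 1.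
  rewrite ha ltr_ndivrMr// mul1r ler_ndivlMr// mul0r; apply/andP; split; first exact: ltW.
  by rewrite mulrBr; lra.
have b01 : 0 <= d0 / (d0 - d3) < 1.
  rewrite hb ltr_pdivrMr// mul1r ler_pdivlMr// mul0r; apply/andP; split; first exact: ltW.
  by rewrite [X in _ < X]mulrBr ltrDl oppr_gt0.
have d21E : d2 - d1 = d3 - d0 by lra.
case: (simp i (ordS (ordS i)) _ _ a01 b01); last by move=> /ordSS_neq.
have cramer (x y u w : R) : (d2 - d1) * (x - y) + d2 * u + d0 * w = 0 ->
    x + d2 / (d2 - d1) * u = y + d0 / (d0 - d3) * w.
  have -> : d0 - d3 = - (d2 - d1) by lra.
  move: (d2 - d1) d21 => D D0 E.
  apply/eqP; rewrite -subr_eq0 -(mulrI_eq0 _ (lregP D0)); apply/eqP.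
  rewrite -[RHS]E; field; exact: D0.
by rewrite /side_pt; congr pair; apply: cramer;
  rewrite d21E /d0 /d2 /d3 /turn /det2 /side !ordS4 /=; ring.
Qed.

(** [turn_alternate] excludes alternating signs and [simple_turns] excludes two
    turns one way followed by two the other way; every other pattern of signs
    has at most one exception. *)
Lemma turns_sign : simple_polygon p ->
  (exists2 s : R, s = 1 \/ s = -1 & forall j, 0 < s * turn j) \/
  (exists2 s : R, s = 1 \/ s = -1 & exists i, [/\ 0 < s * turn i,
     0 < s * turn (ordS i), 0 < s * turn (ordS (ordS i)) &
     s * turn (ordS (ordS (ordS i))) < 0]).
Proof.
move=> simp; have [_ nz] := simp.
have cn j : turn j != 0 by exact: nz.
pose i := (ord0 : 'I_4).
have alt := turn_alternate i.
have cr j s := @simple_turns j s simp.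
have S4 := ordS4 i.
have c0 := cr i; have c1 := cr (ordS i); have c2 := cr (ordS (ordS i)).
have c3 := cr (ordS (ordS (ordS i))).
rewrite !S4 in c1 c2 c3.
have all4 s : [/\ 0 < s * turn i, 0 < s * turn (ordS i),
    0 < s * turn (ordS (ordS i)) & 0 < s * turn (ordS (ordS (ordS i)))] ->
    forall j, 0 < s * turn j.
  by move=> [? ? ? ?] j; case: (ord4P i j) => ->.
have r0 s : [/\ 0 < s * turn i, 0 < s * turn (ordS i),
    0 < s * turn (ordS (ordS i)) & s * turn (ordS (ordS (ordS i))) < 0] ->
   exists i, [/\ 0 < s * turn i,
     0 < s * turn (ordS i), 0 < s * turn (ordS (ordS i)) &
     s * turn (ordS (ordS (ordS i))) < 0] by move=> h; exists i.
have r1 s : [/\ 0 < s * turn (ordS i), 0 < s * turn (ordS (ordS i)),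
    0 < s * turn (ordS (ordS (ordS i))) & s * turn i < 0] ->
   exists i, [/\ 0 < s * turn i,
     0 < s * turn (ordS i), 0 < s * turn (ordS (ordS i)) &
     s * turn (ordS (ordS (ordS i))) < 0].
  by move=> h; exists (ordS i); rewrite !S4.
have r2 s : [/\ 0 < s * turn (ordS (ordS i)), 0 < s * turn (ordS (ordS (ordS i))),
    0 < s * turn i & s * turn (ordS i) < 0] ->
   exists i, [/\ 0 < s * turn i,
     0 < s * turn (ordS i), 0 < s * turn (ordS (ordS i)) &
     s * turn (ordS (ordS (ordS i))) < 0].
  by move=> h; exists (ordS (ordS i)); rewrite !S4.
have r3 s : [/\ 0 < s * turn (ordS (ordS (ordS i))), 0 < s * turn i,
    0 < s * turn (ordS i) & s * turn (ordS (ordS i)) < 0] ->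
   exists i, [/\ 0 < s * turn i,
     0 < s * turn (ordS i), 0 < s * turn (ordS (ordS i)) &
     s * turn (ordS (ordS (ordS i))) < 0].
  by move=> h; exists (ordS (ordS (ordS i))); rewrite !S4.
move: (cn i) (cn (ordS i)) (cn (ordS (ordS i))) (cn (ordS (ordS (ordS i)))).
move: alt (all4 1) (all4 (-1)) (r0 1) (r0 (-1)) (r1 1) (r1 (-1)) (r2 1) (r2 (-1)) (r3 1) (r3 (-1))
  (c0 1) (c0 (-1)) (c1 1) (c1 (-1)) (c2 1) (c2 (-1)) (c3 1) (c3 (-1)).
clear; rewrite !mul1r !mulN1r !oppr_gt0 !oppr_lt0.
set d0 := turn i; set d1 := turn (ordS i).
set d2 := turn (ordS (ordS i)); set d3 := turn (ordS (ordS (ordS i))).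
move=> alt ap an r0p r0n r1p r1n r2p r2n r3p r3n c0p c0n c1p c1n c2p c2n c3p c3n.
have sg : (1 : R) = 1 \/ (1 : R) = -1 by left.
have sgn : (-1 : R) = 1 \/ (-1 : R) = -1 by right.
rewrite !neq_lt => /orP[] h0 /orP[] h1 /orP[] h2 /orP[] h3;
  try (exfalso; lra);
  try (exfalso; by [apply: c0p|apply: c0n|apply: c1p|apply: c1n|apply: c2p|apply: c2n|apply: c3p|apply: c3n]);
  try (left; by [exists 1; [exact: sg|exact: ap]|exists (-1); [exact: sgn|exact: an]]).
all: right; try (exists 1; [exact: sg|]; by [exact: r0p|exact: r1p|exact: r2p|exact: r3p]).
all: exists (-1); [exact: sgn|]; by [exact: r0n|exact: r1n|exact: r2n|exact: r3n].
Qed.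

End Turns.

Section TurningQuadrilateral.
Context {R : realType}.
Variable p : 'I_4 -> R * R.
Local Notation D := (interior_region p).

(** [interior_halfplane] with the normal obtained from [a] by a quarter turn; the
    sign [s] allows both orientations. *)
Lemma interior_left_of (s : R) (a c x : R * R) : s * a.1 != 0 \/ s * a.2 != 0 ->
  (forall j, 0 <= s * det2 a (p j - c)) -> D x -> 0 < s * det2 a (x - c).
Proof.
move=> a0 pos Dx.
have E y : s * det2 a (y - c) = dot (- (s * a.2), s * a.1) y - dot (- (s * a.2), s * a.1) c.
  by rewrite /det2 /dot /=; ring.
rewrite E subr_gt0; apply: (interior_halfplane _ _ Dx) => [|i].
  by apply: contraPneq a0 => -[/eqP]; rewrite oppr_eq0 => /eqP -> ->; rewrite eqxx; case.
by rewrite -subr_ge0 -E.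
Qed.

(** All vertices lie on one side of the line of each side. *)
Lemma convex_interior (s : R) : (forall j, 0 < s * turn p j) ->
  forall x, D x -> forall j, 0 < s * det2 (side p j) (x - p j).
Proof.
move=> pos x Dx j; apply: interior_left_of => // [|k].
  have [h1|] := eqVneq (s * (side p j).1) 0; last by left.
  have [h2|] := eqVneq (s * (side p j).2) 0; last by right.
  by have := pos j; rewrite /turn /det2 mulrBr !mulrA h1 h2 !mul0r subrr ltxx.
have h0 : s * det2 (side p j) (p j - p j) = 0 by rewrite /det2 /side /=; ring.
case: (ord4P j k) => ->.
- by rewrite h0.
- suff -> : s * det2 (side p j) (p (ordS j) - p j) = 0 by [].
  by rewrite /det2 /side /=; ring.
- suff -> : s * det2 (side p j) (p (ordS (ordS j)) - p j) = s * turn p j by exact: ltW.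
  by rewrite /turn /det2 /side /=; ring.
- suff -> : s * det2 (side p j) (p (ordS (ordS (ordS j))) - p j) =
    s * turn p (ordS (ordS (ordS j))) by exact: ltW.
  by rewrite /turn /det2 /side ordS4 /=; ring.
Qed.

(** The triangle of the vertices other than [p i] also contains [p i], hence
    the whole polygonal line. *)
Lemma reflex_interior (s : R) i :
  [/\ 0 < s * turn p i, 0 < s * turn p (ordS i), 0 < s * turn p (ordS (ordS i)) &
      s * turn p (ordS (ordS (ordS i))) < 0] ->
  forall x, D x ->
  [/\ 0 < s * det2 (side p (ordS i)) (x - p (ordS i)),
      0 < s * det2 (side p (ordS (ordS i))) (x - p (ordS (ordS i))) &
      0 < s * det2 (p (ordS i) - p (ordS (ordS (ordS i)))) (x - p (ordS i))].
Proof.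
move=> [h0 h1 h2 h3] x Dx.
have nz (a b : R * R) : 0 < s * det2 a b -> s * a.1 != 0 \/ s * a.2 != 0.
  move=> ab; have [e1|] := eqVneq (s * a.1) 0; last by left.
  have [e2|] := eqVneq (s * a.2) 0; last by right.
  by move: ab; rewrite /det2 mulrBr !mulrA e1 e2 !mul0r subrr ltxx.
move: h0 h1 h2 h3; rewrite /turn ordS4 => h0 h1 h2 h3.
split; apply: interior_left_of Dx.
- exact: nz h1.
- move=> k; case: (ord4P i k) => ->; move: h0 h1; rewrite /det2 /side /=; lra.
- exact: nz h2.
- move=> k; case: (ord4P i k) => ->; move: h1 h2; rewrite /det2 /side !ordS4/=; lra.
- by apply: (@nz _ (p (ordS (ordS i)) - p (ordS (ordS (ordS i))))); move: h1; rewrite /det2 /side/=; lra.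
- move=> k; case: (ord4P i k) => ->; move: h1 h3; rewrite /det2 /side/= ?ordS4/=; lra.
Qed.

End TurningQuadrilateral.

Section FrameArea.
Context {R : realType}.
Local Notation mu := (@lebesgue_measure R).

Lemma area_frame (c v w : R * R) (D : set (R * R)) : det2 v w != 0 ->
  measurable D -> (area D = `|det2 v w|%:E * area (frame c v w @^-1` D))%E.
Proof.
move=> d0 mD.
have mD' : measurable (frame c v w @^-1` D).
  by rewrite -[X in measurable X]setTI; apply: measurable_frame.
have := @ge0_integral_frame R c v w (fun x => (\1_D x)%:E) d0.
rewrite integral_indic// setIT => -> //; first last.
  by apply/measurable_EFinP; exact: measurable_indic.
have -> : (fun z => (\1_D (frame c v w z) : R)%:E) = (fun z => (\1_(frame c v w @^-1` D) z)%:E).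
  by [].
by rewrite integral_indic// setIT.
Qed.

Lemma area_unit_square : area (`]0, 1[ `*` `]0, 1[ : set (R * R)) = 1%E.
Proof.
rewrite product_measure1E//=; try exact: measurable_itv.
by rewrite !lebesgue_measure_itv/= !lte_fin ltr01 -EFinD subr0 mule1.
Qed.

Definition unit_triangle : set (R * R) :=
  [set z | [/\ 0 <= z.1, 0 <= z.2 & z.1 + z.2 <= 1]].

Lemma measurable_unit_triangle : measurable unit_triangle.
Proof.
have cs : continuous (fun z : R * R => z.1 + z.2).
  by apply: continuousDfun; [exact: continuous_fst|exact: continuous_snd].
have -> : unit_triangle = fst @^-1` `[0, +oo[ `&` snd @^-1` `[0, +oo[ `&`
   (fun z : R * R => z.1 + z.2) @^-1` `]-oo, 1].
  apply/seteqP; split => z /=; rewrite !in_itv/= !andbT.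
    by case=> -> -> ->.
  by case=> -[h1 h2] h3; split.
apply: measurableI; first apply: measurableI; rewrite -[X in measurable X]setTI.
- by apply: (@measurable_fst _ _ R R) => //; exact: measurable_itv.
- by apply: (@measurable_snd _ _ R R) => //; exact: measurable_itv.
- by apply: (continuous_measurable_plane cs) => //; exact: measurable_itv.
Qed.

Lemma area_unit_triangle : (area unit_triangle <= (2^-1)%:E)%E.
Proof.
have mT := measurable_unit_triangle.
rewrite -[X in (area X <= _)%E]setIT -integral_indic// integral_area12//; last first.
  by apply/measurable_EFinP; exact: measurable_indic.
have FTC : (\int[mu]_(x in `[0%R, 1%R]) (1 - x)%:E = (2^-1)%:E)%E.
  have dF (x : R) : is_derive x 1 (fun x => x - x ^+ 2 / 2) (1 - x).
    by apply: is_derive_eq; rewrite /GRing.scale/=; field.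
  have cf : continuous (fun x : R => 1 - x).
    by apply: continuousDfun; [exact: cst_continuous|move=> x; apply: cvgN; exact: cvg_id].
  by rewrite (FTC2_everywhere ler01 dF cf); congr EFin; field.
rewrite -FTC [leRHS]integral_mkcond.
apply: ge0_le_integral => //.
- by move=> x _; exact: integral_ge0.
- apply: (measurable_integral1 (f := fun z => (\1_unit_triangle z)%:E)) => //.
  by apply/measurable_EFinP; exact: measurable_indic.
- apply/(measurable_restrictT _ _).1 => //.
  apply/measurable_EFinP; apply: measurable_funS (continuous_measurable_fun _) => //.
  by apply: continuousDfun; [exact: cst_continuous|move=> x; apply: cvgN; exact: cvg_id].
move=> x _; rewrite /patch; case: ifPn => [|xN].
  rewrite inE/= in_itv/= => /andP[x0 x1].
  apply: (@le_trans _ _ (\int[mu]_y (\1_(`[0, 1 - x]) y)%:E)%E).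
    apply: ge0_le_integral => //.
    - apply: (measurable_section1 (f := fun z => (\1_unit_triangle z)%:E) x).
      by apply/measurable_EFinP; exact: measurable_indic.
    - by apply/measurable_EFinP; exact: measurable_indic.
    - move=> y _; rewrite lee_fin !indicE.
      have [/set_mem[/= _ y0 xy]|_] := boolP ((x, y) \in unit_triangle); last by [].
      by rewrite mem_set//= in_itv/= y0; lra.
  rewrite integral_indic//= setIT lebesgue_measure_itv/= lte_fin.
  by case: ifPn => _; rewrite ?lee_fin; lra.
rewrite integral0_eq ?lexx// => y _; rewrite indicE memNset// => -[/= h1 h2 h3].
by move/negP: xN; apply; rewrite inE/= in_itv/= h1; lra.
Qed.

(** In the frame of two of its sides the triangle becomes [unit_triangle]. *)
Lemma area_le_triangle (s : R) (c v w : R * R) (D : set (R * R)) :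
  s = 1 \/ s = -1 -> 0 < s * det2 w v -> measurable D ->
  (forall x, D x -> [/\ 0 <= s * det2 w (x - c), 0 <= s * det2 (x - c) v &
                        s * det2 (w - v) (x - c - v) <= 0]) ->
  (area D <= (s * det2 w v / 2)%:E)%E.
Proof.
move=> s1 pos mD hD.
have -> : s * det2 w v = `|det2 v w|.
  rewrite -[LHS]gtr0_norm// normrM [det2 v w]det2C normrN.
  by case: s1 => ->; rewrite ?normrN normr1 mul1r.
have d0 : det2 v w != 0.
  by apply: contraTneq pos => e; rewrite det2C e oppr0 mulr0 ltxx.
rewrite (area_frame c d0 mD) EFinM lee_wpmul2l//.
apply: le_trans area_unit_triangle; apply: le_measure => //; rewrite ?inE.
- by rewrite -[X in measurable X]setTI; apply: measurable_frame.
- exact: measurable_unit_triangle.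
move=> z /hD[].
have -> : s * det2 w (frame c v w z - c) = z.1 * (s * det2 w v).
  by rewrite /det2 /frame/=; ring.
have -> : s * det2 (frame c v w z - c) v = z.2 * (s * det2 w v).
  by rewrite /det2 /frame/=; ring.
have -> : s * det2 (w - v) (frame c v w z - c - v) = (z.1 + z.2 - 1) * (s * det2 w v).
  by rewrite /det2 /frame/=; ring.
rewrite pmulr_lge0// pmulr_lge0// pmulr_lle0// => h1 h2 h3; split => //.
by rewrite -subr_le0.
Qed.

End FrameArea.

(** * The isoperimetric inequality *)

Section Isoperimetry.
Context {R : realType}.
Implicit Types a b : R * R.

Lemma dot_ge0 a : 0 <= dot a a.
Proof. by rewrite /dot addr_ge0// -expr2 sqr_ge0. Qed.

Lemma enorm_ge0 a : 0 <= enorm a.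
Proof. exact: sqrtr_ge0. Qed.

Lemma enorm_sqr a : enorm a ^+ 2 = dot a a.
Proof. by rewrite sqr_sqrtr// dot_ge0. Qed.

Lemma lagrange a b : det2 a b ^+ 2 + dot a b ^+ 2 = (enorm a * enorm b) ^+ 2.
Proof. by rewrite exprMn !enorm_sqr /det2 /dot; ring. Qed.

Lemma enorm_gt0 a b : det2 a b != 0 -> 0 < enorm a.
Proof.
move=> d; rewrite lt_neqAle enorm_ge0 andbT eq_sym; apply: contraNneq d => a0.
have := lagrange a b; rewrite a0 mul0r expr0n/= => /eqP.
by rewrite paddr_eq0 ?sqr_ge0// sqrf_eq0 => /andP[].
Qed.

Lemma enormN a : enorm (- a) = enorm a.
Proof. by rewrite /enorm; congr Num.sqrt; rewrite /dot/=; ring. Qed.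

Lemma det2_le (s : R) a b : s = 1 \/ s = -1 -> s * det2 a b <= enorm a * enorm b.
Proof.
move=> s1; have := lagrange a b.
have := sqr_ge0 (dot a b); have := mulr_ge0 (enorm_ge0 a) (enorm_ge0 b).
by case: s1 => ->; nra.
Qed.

Lemma det2_lt (s : R) a b : s = 1 \/ s = -1 -> dot a b != 0 ->
  s * det2 a b < enorm a * enorm b.
Proof.
move=> s1 d; have := lagrange a b.
have : 0 < dot a b ^+ 2 by rewrite exprn_even_gt0.
have := mulr_ge0 (enorm_ge0 a) (enorm_ge0 b).
by case: s1 => ->; nra.
Qed.

Lemma dot_le a b : dot a b <= enorm a * enorm b.
Proof.
have := lagrange a b.
have := sqr_ge0 (det2 a b); have := mulr_ge0 (enorm_ge0 a) (enorm_ge0 b).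
by nra.
Qed.

Lemma enormD a b : enorm (a + b) <= enorm a + enorm b.
Proof.
have := dot_le a b; have := enorm_ge0 a; have := enorm_ge0 b.
have := enorm_ge0 (a + b).
have : enorm (a + b) ^+ 2 = enorm a ^+ 2 + enorm b ^+ 2 + 2 * dot a b.
  by rewrite !enorm_sqr /dot/=; ring.
by nra.
Qed.

Lemma continuous_det2 a b : continuous (fun x : R * R => det2 a (x - b)).
Proof.
have -> : (fun x => det2 a (x - b)) = fun x : R * R => a.1 * x.2 + (- a.2 * x.1 - det2 a b).
  by apply/funext => x; rewrite /det2/=; ring.
apply: continuousDfun; first by apply: continuousMfun; [exact: cst_continuous|exact: continuous_snd].
apply: continuousDfun; last exact: cst_continuous.
by apply: continuousMfun; [exact: cst_continuous|exact: continuous_fst].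
Qed.

Variable p : 'I_4 -> R * R.
Local Notation D := (interior_region p).

Definition perimeter : R := \sum_i enorm (side p i).

Lemma measurable_interior : measurable D.
Proof. by apply: open_measurable_plane; exact: open_interior_region. Qed.

(** The diagonal from [p i] cuts the region into two triangles. *)
Lemma convex_area_le (s : R) i : s = 1 \/ s = -1 ->
  (forall j, 0 < s * turn p j) ->
  (area D <= (s * (turn p i + turn p (ordS (ordS i))) / 2)%:E)%E.
Proof.
move=> s1 pos.
pose a := p (ordS (ordS i)) - p i.
pose H : set (R * R) := (fun x => s * det2 a (x - p i)) @^-1` `]-oo, 0].
have mD := measurable_interior.
have mH : measurable H.
  rewrite -[X in measurable X]setTI; apply: continuous_measurable_plane => //.
    by apply: continuousMfun; [exact: cst_continuous|exact: continuous_det2].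
have D1 : (area (D `&` H) <= (s * turn p i / 2)%:E)%E.
  have -> : s * turn p i = s * det2 (side p (ordS i)) (- side p i).
    by rewrite /turn /det2/=; ring.
  apply: (@area_le_triangle R s (p (ordS i))) => //; first 1 last.
  - exact: measurableI.
  - move=> x [/(convex_interior pos) hD]; rewrite /H/= in_itv/= => hx.
    have := hD i; have := hD (ordS i).
    split; [exact: ltW| |].
      by move: (hD i); rewrite /det2 /side/=; lra.
    by move: hx; rewrite /a /det2 /side/=; lra.
  - by move: (pos i); rewrite /turn /det2 /side/=; lra.
have D2 : (area (D `\` H) <= (s * turn p (ordS (ordS i)) / 2)%:E)%E.
  have -> : s * turn p (ordS (ordS i)) =
      s * det2 (side p (ordS (ordS (ordS i)))) (- side p (ordS (ordS i))).
    by rewrite /turn /det2/=; ring.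
  apply: (@area_le_triangle R s (p (ordS (ordS (ordS i))))) => //; first 1 last.
  - exact: measurableD.
  - move=> x [/(convex_interior pos) hD]; rewrite /H/= in_itv/= => /negP hx.
    rewrite -ltNge in hx.
    split; [exact: ltW| |].
      by move: (hD (ordS (ordS i))); rewrite /det2 /side/=; lra.
    by move: hx; rewrite /a /det2 /side ordS4/=; lra.
  - by move: (pos (ordS (ordS i))); rewrite /turn /det2 /side/=; lra.
have -> : area D = (area (D `\` H) + area (D `&` H))%E.
  by apply: measureDI.
apply: le_trans (leeD D2 D1) _; rewrite -EFinD lee_fin.
by rewrite -mulrDl -mulrDr addrC.
Qed.

(** Twice the area is at most the sum of two products of consecutive sides,
    over either pair of opposite vertices; averaging the two bounds gives a
    quarter of [(l0 + l2) * (l1 + l3)], at most the square of the perimeter over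
    sixteen, with a strict inequality as soon as one angle is not right. *)
Lemma isoperimetric_convex (s : R) : s = 1 \/ s = -1 ->
  (forall j, 0 < s * turn p j) ->
  (exists j, dot (side p j) (side p (ordS j)) != 0) ->
  exists2 B : R, (area D <= B%:E)%E & 16 * B < perimeter ^+ 2.
Proof.
move=> s1 pos [i di]; exists (s * (turn p i + turn p (ordS (ordS i))) / 2).
  exact: convex_area_le.
rewrite /perimeter (big_ord4 _ i)/=.
have := turn_alternate p i.
have := det2_lt s1 di; rewrite -/(turn p i).
have := @det2_le s (side p (ordS i)) (side p (ordS (ordS i))) s1.
have := @det2_le s (side p (ordS (ordS i))) (side p (ordS (ordS (ordS i)))) s1.
have := @det2_le s (side p (ordS (ordS (ordS i)))) (side p i) s1.
rewrite -{2}(ordS4 i) -!/(turn p _).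
set t0 := turn p i; set t1 := turn p (ordS i).
set t2 := turn p (ordS (ordS i)); set t3 := turn p (ordS (ordS (ordS i))).
set l0 := enorm (side p i); set l1 := enorm (side p (ordS i)).
set l2 := enorm (side p (ordS (ordS i))).
set l3 := enorm (side p (ordS (ordS (ordS i)))).
move=> h3 h2 h1 h0 alt.
have alt' : s * t0 + s * t2 = s * t1 + s * t3 by rewrite -!mulrDr alt.
have : 0 <= (l0 + l2 - (l1 + l3)) ^+ 2 by exact: sqr_ge0.
have -> : 16 * (s * (t0 + t2) / 2) = 4 * (s * t0 + s * t2 + (s * t1 + s * t3)).
  by rewrite -alt'; field.
have -> : (l0 + (l1 + (l2 + l3))) ^+ 2 =
    (l0 + l2 - (l1 + l3)) ^+ 2 + 4 * (l0 * l1 + l1 * l2 + l2 * l3 + l3 * l0) by ring.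
by lra.
Qed.

(** The region lies in a triangle whose perimeter is at most that of the
    quadrilateral, and the strict inequality holds for triangles: with sides
    [x <= y <= z] the area is at most [x * y / 2], while the perimeter is at
    least [x + 2 * y]. *)
Lemma isoperimetric_reflex (s : R) i : s = 1 \/ s = -1 ->
  [/\ 0 < s * turn p i, 0 < s * turn p (ordS i), 0 < s * turn p (ordS (ordS i)) &
      s * turn p (ordS (ordS (ordS i))) < 0] ->
  exists2 B : R, (area D <= B%:E)%E & 16 * B < perimeter ^+ 2.
Proof.
move=> s1 hp; have hD := reflex_interior hp; case: hp => h0 h1 h2 h3.
set v1 := side p (ordS i); set v2 := side p (ordS (ordS i)).
pose v3 := p (ordS i) - p (ordS (ordS (ordS i))).
exists (s * turn p (ordS i) / 2).
  have -> : s * turn p (ordS i) = s * det2 v2 (- v1).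
    by rewrite /turn /det2/=; ring.
  apply: (@area_le_triangle R s (p (ordS (ordS i)))) => //.
  - by move: h1; rewrite /turn /det2 /v1 /v2 /side/=; lra.
  - exact: measurable_interior.
  - move=> x /hD[d1 d2 d3]; split; first exact: ltW.
      by move: d1; rewrite /v1 /det2 /side/=; lra.
    by move: d3; rewrite /v1 /v2 /det2 /side/=; lra.
have t12 : turn p (ordS i) = det2 v1 v2 by [].
have t23 : turn p (ordS i) = det2 v2 v3.
  by rewrite t12 /v1 /v2 /v3 /det2 /side/=; ring.
have t31 : turn p (ordS i) = det2 v3 v1.
  by rewrite t12 /v1 /v2 /v3 /det2 /side/=; ring.
have e12 := @det2_le s v1 v2 s1; have e23 := @det2_le s v2 v3 s1.
have e31 := @det2_le s v3 v1 s1; rewrite -t12 in e12; rewrite -t23 in e23.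
rewrite -t31 in e31.
have ev3 : enorm v3 <= enorm (side p i) + enorm (side p (ordS (ordS (ordS i)))).
  have -> : v3 = side p i + side p (ordS (ordS (ordS i))).
    by rewrite /v3 /side ordS4 addrA subrK.
  exact: enormD.
have n1 : 0 < enorm v1 by apply: (@enorm_gt0 _ v2); rewrite -t12; apply: contraTneq h1 => ->; rewrite mulr0 ltxx.
have n2 : 0 < enorm v2 by apply: (@enorm_gt0 _ v3); rewrite -t23; apply: contraTneq h1 => ->; rewrite mulr0 ltxx.
have n3 : 0 < enorm v3 by apply: (@enorm_gt0 _ v1); rewrite -t31; apply: contraTneq h1 => ->; rewrite mulr0 ltxx.
have per : enorm v1 + enorm v2 + enorm v3 <= perimeter.
  by rewrite /perimeter (big_ord4 _ i)/= -/v1 -/v2; lra.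
apply: (@lt_le_trans _ _ ((enorm v1 + enorm v2 + enorm v3) ^+ 2)); last first.
  by rewrite ler_sqr ?nnegrE//; lra.
move: (enorm v1) (enorm v2) (enorm v3) n1 n2 n3 e12 e23 e31 => x y z x0 y0 z0.
move: (s * _) => t e12 e23 e31.
have key (a b c : R) : 0 < a -> 0 < b -> a <= b -> b <= c -> t <= a * b ->
    16 * (t / 2) < (a + b + c) ^+ 2.
  move=> a0 b0 ab bc tab.
  apply: (@lt_le_trans _ _ ((a + 2 * b) ^+ 2)).
    have : 0 < b * (b - a) + a ^+ 2 by rewrite ltr_wpDl// ?mulr_ge0// ?subr_ge0// ?exprn_gt0// ltW.
    by have := sqr_ge0 (a - b); nra.
  by rewrite ler_sqr ?nnegrE//; lra.
have e21 : t <= y * x by rewrite mulrC.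
have e32 : t <= z * y by rewrite mulrC.
have e13 : t <= x * z by rewrite mulrC.
have [xy|/ltW yx] := leP x y; have [yz|/ltW zy] := leP y z; have [xz|/ltW zx] := leP x z.
- exact: key.
- exact: key.
- by rewrite (_ : x + y + z = x + z + y); [apply: key|ring].
- by rewrite (_ : x + y + z = z + x + y); [apply: key|ring].
- by rewrite (_ : x + y + z = y + x + z); [apply: key|ring].
- by rewrite (_ : x + y + z = y + z + x); [apply: key|ring].
- by rewrite (_ : x + y + z = z + y + x); [apply: key|ring].
- by rewrite (_ : x + y + z = z + y + x); [apply: key|ring].
Qed.

End Isoperimetry.

(** * Parallelograms and right angles *)

Section FrameCoordinates.
Context {R : realType}.
Variables c v w : R * R.
Hypothesis vw : det2 v w != 0.

Definition frame_coord (x : R * R) : R * R :=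
  (- det2 w (x - c) / det2 v w, det2 v (x - c) / det2 v w).

Lemma frameK z : frame_coord (frame c v w z) = z.
Proof.
rewrite [RHS]surjective_pairing /frame_coord.
have -> : - det2 w (frame c v w z - c) = z.1 * det2 v w.
  by rewrite /det2 /frame/=; ring.
have -> : det2 v (frame c v w z - c) = z.2 * det2 v w.
  by rewrite /det2 /frame/=; ring.
by rewrite !mulfK.
Qed.

Lemma frame_coordK x : frame c v w (frame_coord x) = x.
Proof.
rewrite [RHS]surjective_pairing /frame /frame_coord /=.
by congr pair; move: vw; rewrite /det2/= => h; field.
Qed.

Lemma continuous_frame_coord1 : continuous (fun x => (frame_coord x).1).
Proof.
apply: continuousMfun; last exact: cst_continuous.
by move=> x; apply: cvgN; exact: continuous_det2.
Qed.

Lemma continuous_frame_coord2 : continuous (fun x => (frame_coord x).2).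
Proof. by apply: continuousMfun; [exact: continuous_det2|exact: cst_continuous]. Qed.

End FrameCoordinates.

Section Parallelogram.
Context {R : realType}.
Variable p : 'I_4 -> R * R.
Local Notation D := (interior_region p).
Local Notation L := (polygonal_line p).
Variable i : 'I_4.
Let c := p i.
Let v := side p i.
Let w := side p (ordS i).
Hypothesis vw : det2 v w != 0.
Hypothesis opp02 : side p (ordS (ordS i)) = - v.

Let p1 : p (ordS i) = frame c v w (1, 0).
Proof. by rewrite [LHS]surjective_pairing /frame /c /v /side/=; congr pair; ring. Qed.
Let p2 : p (ordS (ordS i)) = frame c v w (1, 1).
Proof. by rewrite [LHS]surjective_pairing /frame /c /v /w /side/=; congr pair; ring. Qed.
Let p3 : p (ordS (ordS (ordS i))) = frame c v w (0, 1).
Proof.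
have -> : p (ordS (ordS (ordS i))) = side p (ordS (ordS i)) + p (ordS (ordS i)).
  by rewrite /side subrK.
by rewrite opp02 p2 [LHS]surjective_pairing /frame /=; congr pair; ring.
Qed.

Lemma parallelogram_side_pt (s : R) : [/\ side_pt p i s = frame c v w (s, 0),
  side_pt p (ordS i) s = frame c v w (1, s),
  side_pt p (ordS (ordS i)) s = frame c v w (1 - s, 1) &
  side_pt p (ordS (ordS (ordS i))) s = frame c v w (0, 1 - s)].
Proof.
split; rewrite /side_pt.
- by rewrite /frame /c /v/=; congr pair; ring.
- by rewrite p1 -/w /frame /=; congr pair; ring.
- by rewrite opp02 p2 /frame /=; congr pair; ring.
- by rewrite /side ordS4 p3 -/c /frame /=; congr pair; ring.
Qed.

(** The open parallelogram is bounded and its frontier is the line, so that it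
    lies in the region; the converse inclusion comes from four half-planes. *)
Lemma interior_parallelogram :
  frame c v w @^-1` D = `]0, 1[ `*` `]0, 1[.
Proof.
pose d := det2 v w.
have [s0 s1 s2 s3] : [/\ (forall s, side_pt p i s = frame c v w (s, 0)),
  (forall s, side_pt p (ordS i) s = frame c v w (1, s)),
  (forall s, side_pt p (ordS (ordS i)) s = frame c v w (1 - s, 1)) &
  (forall s, side_pt p (ordS (ordS (ordS i))) s = frame c v w (0, 1 - s))].
  by split=> s; have [] := parallelogram_side_pt s.
apply/seteqP; split => z.
  rewrite /preimage/= => Dz.
  have pos s a z0 : s * a.1 != 0 \/ s * a.2 != 0 ->
      (forall y, y \in [:: (0, 0); (1, 0); (1, 1); (0, 1)] ->
         0 <= s * det2 a (frame c v w y - frame c v w z0)) ->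
      0 < s * det2 a (frame c v w z - frame c v w z0).
    move=> a0 ha; apply: interior_left_of Dz => // j.
    have pc : p i = frame c v w (0, 0).
      by rewrite /c /frame/= !mul0r !addr0 -surjective_pairing.
    by case: (ord4P i j) => ->; rewrite ?p1 ?p2 ?p3 ?pc; apply: ha; rewrite !inE eqxx ?orbT.
  have nz a s : s != 0 -> a = v \/ a = w -> s * a.1 != 0 \/ s * a.2 != 0.
    move=> s_neq0 avw; rewrite !mulf_eq0 (negbTE s_neq0)/=.
    have [a1|] := eqVneq a.1 0; last by left.
    have [a2|] := eqVneq a.2 0; last by right.
    by move: vw; rewrite /det2; case: avw => <-; rewrite a1 a2 ?(mul0r, mulr0) subrr eqxx.
  have d0 : d^-1 != 0 by rewrite invr_eq0.
  have E1 y1 y2 : d^-1 * det2 v (frame c v w y1 - frame c v w y2) = y1.2 - y2.2.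
    have -> : det2 v (frame c v w y1 - frame c v w y2) = d * (y1.2 - y2.2).
      by rewrite /d /det2 /frame/=; ring.
    by rewrite mulKf.
  have E2 y1 y2 : d^-1 * det2 w (frame c v w y1 - frame c v w y2) = - (y1.1 - y2.1).
    have -> : det2 w (frame c v w y1 - frame c v w y2) = d * - (y1.1 - y2.1).
      by rewrite /d /det2 /frame/=; ring.
    by rewrite mulKf.
  have := pos _ _ (0, 0) (nz v _ d0 (or_introl erefl)).
  have := pos _ _ (0, 0) (nz w (- d^-1) _ (or_intror erefl)); rewrite oppr_eq0 => /(_ d0).
  have := pos _ _ (1, 1) (nz v (- d^-1) _ (or_introl erefl)); rewrite oppr_eq0 => /(_ d0).
  have := pos _ _ (1, 1) (nz w _ d0 (or_intror erefl)).
  rewrite !mulNr !E1 !E2 /= => h1 h2 h3 h4.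
  split; rewrite /= in_itv/=; apply/andP; split.
  - have := h3 _; rewrite opprK subr0; apply => y.
    by rewrite !mulNr !inE => /or4P[] /eqP ->; rewrite E2/=; lra.
  - have := h1 _; rewrite opprB subr_gt0; apply => y.
    by rewrite !inE => /or4P[] /eqP ->; rewrite E2/=; lra.
  - have := h4 _; rewrite subr0; apply => y.
    by rewrite !inE => /or4P[] /eqP ->; rewrite E1/=; lra.
  - have := h2 _; rewrite opprB subr_gt0; apply => y.
    by rewrite !mulNr !inE => /or4P[] /eqP ->; rewrite E1/=; lra.
pose C := frame_coord c v w.
have CK y : C (frame c v w y) = y by exact: frameK.
pose O : set (R * R) := [set x | ((C x).1 \in `]0, 1[) && ((C x).2 \in `]0, 1[)].
move=> [z1 z2]; apply: (@sub_interior_region _ _ p O); last first.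
- by rewrite /O /mkset CK; apply/andP.
- have -> : O `|` L = (fun x => (C x).1) @^-1` `[0, 1] `&` (fun x => (C x).2) @^-1` `[0, 1].
    apply/seteqP; split => x.
      case=> [/andP[]|].
        by rewrite !in_itv/= => /andP[/ltW h1 /ltW h2] /andP[/ltW h3 /ltW h4]; split; rewrite /= in_itv/= ?h1 ?h2 ?h3 ?h4.
      case=> j [s [/andP[h1 h2] ->]].
      by case: (ord4P i j) => ->; rewrite ?s0 ?s1 ?s2 ?s3; split; rewrite /preimage /mkset CK/= in_itv/=; lra.
    suff H y1 y2 : 0 <= y1 <= 1 -> 0 <= y2 <= 1 -> (O `|` L) (frame c v w (y1, y2)).
      case; rewrite /preimage /mkset; move: (frame_coordK c vw x); rewrite -/C.
      by move: (C x) => [y1 y2] <- h1 h2; apply: H; rewrite in_itv/= in h1 h2.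
    move=> /andP[h1 h2] /andP[h3 h4].
    have [e1|n1] := eqVneq y1 0.
      right; exists (ordS (ordS (ordS i))), (1 - y2); split; first by lra.
      by rewrite s3 e1 subKr.
    have [e2|n2] := eqVneq y1 1.
      by right; exists (ordS i), y2; split; [lra|rewrite s1 e2].
    have [e3|n3] := eqVneq y2 0.
      by right; exists i, y1; split; [lra|rewrite s0 e3].
    have [e4|n4] := eqVneq y2 1.
      by right; exists (ordS (ordS i)), (1 - y1); split; [lra|rewrite s2 e4 subKr].
    by left; rewrite /O /mkset CK !in_itv/= !lt_neqAle h1 h2 h3 h4 ![0 == _]eq_sym n1 n2 n3 n4.
  apply: closedI; apply: preimage_closed.
  + by move=> x _; exact: continuous_frame_coord1.
  + exact: interval_closed.
  + by move=> x _; exact: continuous_frame_coord2.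
  + exact: interval_closed.
- apply/seteqP; split => x // [/andP[x1 x2] [j [s [s01 xE]]]].
  move: x1 x2; rewrite {}xE.
  by case: (ord4P i j) => ->; rewrite ?s0 ?s1 ?s2 ?s3 CK/= !in_itv/= ?ltxx ?andbF.
- exists (`|c.1| + `|v.1| + `|w.1| + (`|c.2| + `|v.2| + `|w.2|)); split; first exact: num_real.
  move=> M hM x; rewrite /O /mkset; move: (frame_coordK c vw x); rewrite -/C.
  move: (C x) => [y1 y2] <-; rewrite !in_itv/= => /andP[/andP[h1 h2] /andP[h3 h4]].
  have b (a1 a2 a3 : R) : `|a1 + y1 * a2 + y2 * a3| <= `|a1| + `|a2| + `|a3|.
    rewrite (le_trans (ler_normD _ _))// lerD//.
      rewrite (le_trans (ler_normD _ _))// lerD// normrM ler_piMl// ger0_norm//; exact: ltW.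
    by rewrite normrM ler_piMl// ger0_norm//; exact: ltW.
  rewrite [X in X <= _]/Num.norm/= ge_max /frame/=.
  have := b c.1 v.1 w.1; have := b c.2 v.2 w.2.
  have := normr_ge0 c.1; have := normr_ge0 v.1; have := normr_ge0 w.1.
  have := normr_ge0 c.2; have := normr_ge0 v.2; have := normr_ge0 w.2.
  by move=> *; apply/andP; split; lra.
- have -> : O = (fun x => (C x).1) @^-1` `]0, 1[ `&` (fun x => (C x).2) @^-1` `]0, 1[.
    by apply/seteqP; split => x; [move=> /andP[]|move=> [? ?]; apply/andP].
  apply: openI; apply: open_comp.
  + by move=> x _; exact: continuous_frame_coord1.
  + exact: interval_open.
  + by move=> x _; exact: continuous_frame_coord2.
  + exact: interval_open.
Qed.

Lemma area_parallelogram : area D = `|det2 v w|%:E.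
Proof.
rewrite (area_frame c vw); last first.
  by apply: open_measurable_plane; exact: open_interior_region.
by rewrite interior_parallelogram area_unit_square mule1.
Qed.

End Parallelogram.

Section RightAngles.
Context {R : realType}.
Variable p : 'I_4 -> R * R.

Let dot_sum i : \sum_j dot (side p j) (side p (ordS j)) =
  - dot (side p i + side p (ordS (ordS i))) (side p i + side p (ordS (ordS i))).
Proof. by rewrite (big_ord4 _ i)/= /dot /side !ordS4/=; ring. Qed.

(** The scalar products of consecutive sides add up to minus the squared norm
    of the sum of two opposite sides; they cannot all be nonnegative unless they
    all vanish, and then this sum vanishes too. *)
Lemma acute_or_right :
  (exists j, dot (side p j) (side p (ordS j)) < 0) \/
  (forall j, dot (side p j) (side p (ordS j)) = 0).
Proof.
have [[j hj]|no] := pselect (exists j, dot (side p j) (side p (ordS j)) < 0).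
  by left; exists j.
right => j; have ge0 k : 0 <= dot (side p k) (side p (ordS k)).
  by rewrite leNgt; apply/negP => hk; apply: no; exists k.
have := dot_sum ord0; rewrite (bigD1 j)//=.
have := dot_ge0 (side p ord0 + side p (ordS (ordS ord0))).
have : 0 <= \sum_(k < 4 | k != j) dot (side p k) (side p (ordS k)) by exact: sumr_ge0.
by have := ge0 j; lra.
Qed.

Lemma right_angles_opp : (forall j, dot (side p j) (side p (ordS j)) = 0) ->
  forall i, side p (ordS (ordS i)) = - side p i.
Proof.
move=> r i; have := dot_sum i; rewrite big1//.
move=> /eqP; rewrite eq_sym oppr_eq0 /dot -!expr2 paddr_eq0 ?sqr_ge0// !sqrf_eq0.
rewrite /= => /andP[/eqP h1 /eqP h2].
by rewrite [LHS]surjective_pairing [RHS]surjective_pairing/=; congr pair; lra.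
Qed.

End RightAngles.

(** * Continuously differentiable functions as elements of the Sobolev space *)

Section Partials.
Context {R : realType}.
Implicit Types (u f g : R * R -> R).

Definition unit_x : R * R := (1, 0).
Definition unit_y : R * R := (0, 1).

Lemma is_derive_ray_pt u (x d : R * R) (t l : R) :
  is_derive (ray_pt x d t) d u l <-> is_derive t 1 (fun s : R => u (ray_pt x d s)) l.
Proof.
have E : (fun h : R => h^-1 *: ((u \o shift (ray_pt x d t)) (h *: d) - u (ray_pt x d t))) =
  (fun h : R => h^-1 *: (((fun s => u (ray_pt x d s)) \o shift t) (h *: 1) - u (ray_pt x d t))).
  apply/funext => h; congr (_ *: (u _ - _)).
  rewrite [LHS]surjective_pairing /ray_pt /= /GRing.scale/= mulr1.
  by congr pair; ring.
split=> -[h1 h2]; (apply: DeriveDef; [move: h1; rewrite /derivable|rewrite -h2 /derive]);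
  by rewrite E.
Qed.

Lemma is_partial1 u x y d :
  is_derive (x, y) unit_x u d <-> is_derive x 1 (fun t : R => u (t, y)) d.
Proof.
have E (t : R) : (t, y) = ray_pt (0, y) unit_x t.
  by rewrite /ray_pt/= mulr1 mulr0 add0r addr0.
have -> : (fun t : R => u (t, y)) = fun t : R => u (ray_pt (0, y) unit_x t).
  by apply/funext => t; rewrite E.
by rewrite E; exact: is_derive_ray_pt.
Qed.

Lemma is_partial2 u x y d :
  is_derive (x, y) unit_y u d <-> is_derive y 1 (fun t : R => u (x, t)) d.
Proof.
have E (t : R) : (x, t) = ray_pt (x, 0) unit_y t.
  by rewrite /ray_pt/= mulr1 mulr0 add0r addr0.
have -> : (fun t : R => u (x, t)) = fun t : R => u (ray_pt (x, 0) unit_y t).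
  by apply/funext => t; rewrite E.
by rewrite E; exact: is_derive_ray_pt.
Qed.

Lemma classC1_partials u : classC 1 u ->
  (forall x y : R, is_derive x 1 (fun t : R => u (t, y)) (grad u (x, y)).1) /\
  (forall x y : R, is_derive y 1 (fun t : R => u (x, t)) (grad u (x, y)).2).
Proof.
move=> [_ du _ _]; split=> x y.
  by apply/is_partial1; have [h _] := du (x, y); exact: (@DeriveDef _ _ _ _ _ _ _ h erefl).
by apply/is_partial2; have [_ h] := du (x, y); exact: (@DeriveDef _ _ _ _ _ _ _ h erefl).
Qed.

Lemma classC1_grad u (g : R * R -> R * R) : continuous u ->
  continuous (fun x => (g x).1) -> continuous (fun x => (g x).2) ->
  (forall x y : R, is_derive x 1 (fun t : R => u (t, y)) (g (x, y)).1) ->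
  (forall x y : R, is_derive y 1 (fun t : R => u (x, t)) (g (x, y)).2) ->
  classC 1 u /\ grad u = g.
Proof.
move=> cu cg1 cg2 du1 du2.
have d1 x : is_derive x unit_x u (g x).1.
  by case: x => x y; apply/is_partial1; exact: du1.
have d2 x : is_derive x unit_y u (g x).2.
  by case: x => x y; apply/is_partial2; exact: du2.
have gE : grad u = g.
  apply/funext => x; rewrite [RHS]surjective_pairing /grad; congr pair.
    exact: (@derive_val _ _ _ _ _ _ _ (d1 x)).
  exact: (@derive_val _ _ _ _ _ _ _ (d2 x)).
split => //; split => //; rewrite ?gE// => x.
Qed.

Lemma mean_value (f df : R -> R) (a b : R) :
  (forall x : R, is_derive x 1 f (df x)) ->
  exists2 c, `|c - a| <= `|b - a| & f b - f a = df c * (b - a).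
Proof.
move=> dF; have cF := derive_continuous dF.
have [ab|/ltW ba] := leP a b.
  have [c] := MVT_segment ab (fun x _ => dF x) (continuous_subspaceT cF).
  rewrite in_itv/= => /andP[ac cb] E; exists c => //.
  by rewrite !ger0_norm ?subr_ge0// lerD2r.
have [c] := MVT_segment ba (fun x _ => dF x) (continuous_subspaceT cF).
rewrite in_itv/= => /andP[ac cb] E; exists c; last by rewrite -opprB E -mulrN opprB.
by rewrite !ler0_norm ?subr_le0// !opprB lerD2l lerN2.
Qed.

(** Chain rule along a line, from the mean value theorem in each variable and
    the continuity of the two partial derivatives. *)
Lemma is_derive_along u (x d : R * R) (t : R) : classC 1 u ->
  is_derive t 1 (fun s : R => u (ray_pt x d s)) (dot (grad u (ray_pt x d t)) d).
Proof.
move=> C1u; have [d1 d2] := classC1_partials C1u; case: C1u => _ _ c1 c2.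
apply/is_derive_ray_pt; move: (ray_pt x d t) => {x t} [a b].
set l := dot _ _.
suff H : (fun h : R => h^-1 *: ((u \o shift (a, b)) (h *: d) - u (a, b))) @ 0^' --> l.
  apply: DeriveDef; first by apply/cvg_ex; exists l.
  by apply/cvg_lim.
apply/cvgrPdist_le => e e0.
pose K := `|d.1| + `|d.2| + 1.
have K0 : 0 < K by rewrite /K ltr_wpDl// addr_ge0.
have eK : 0 < e / K by rewrite divr_gt0.
have /cvgrPdist_le/(_ _ eK)/nbhs_ballP[r1 /= r10 h1] := c1 (a, b).
have /cvgrPdist_le/(_ _ eK)/nbhs_ballP[r2 /= r20 h2] := c2 (a, b).
near=> h.
have hn0 : h != 0 by near: h; exact: nbhs_dnbhs_neq.
have hr1 : `|h| * K < r1.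
  by rewrite -ltr_pdivlMr//; near: h; apply: dnbhs0_lt; rewrite divr_gt0.
have hr2 : `|h| * K < r2.
  by rewrite -ltr_pdivlMr//; near: h; apply: dnbhs0_lt; rewrite divr_gt0.
have [p hp Ep] := mean_value a (a + h * d.1) (fun x => d1 x (b + h * d.2)).
have [q hq Eq] := mean_value b (b + h * d.2) (fun y => d2 a y).
have -> : (u \o shift (a, b)) (h *: d) - u (a, b) =
   h * ((grad u (p, b + h * d.2)).1 * d.1 + (grad u (a, q)).2 * d.2).
  rewrite mulrDr !(mulrCA h).
  rewrite -[h * d.1](addrK a) [h * d.1 + a]addrC -Ep.
  rewrite -[h * d.2](addrK b) [h * d.2 + b]addrC -Eq.
  rewrite ![_ + (_ - b)]addrC ?subrK addrA.
  have -> : (u \o shift (a, b)) (h *: d) = u (a + h * d.1, b + h * d.2).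
    by congr u; rewrite [LHS]surjective_pairing/= [_ + a]addrC [_ + b]addrC.
  by ring.
rewrite /GRing.scale/= mulKf// /l /dot.
have B1 : `|(grad u (a, b)).1 - (grad u (p, b + h * d.2)).1| <= e / K.
  apply: h1; split => /=; rewrite -ball_normE/= distrC.
    apply: le_lt_trans hp _; rewrite [a + _]addrC addrK normrM.
    apply: le_lt_trans hr1; rewrite ler_wpM2l// /K.
    by have := normr_ge0 d.2; lra.
  rewrite [b + _]addrC addrK normrM.
  apply: le_lt_trans hr1; rewrite ler_wpM2l// /K.
  by have := normr_ge0 d.1; lra.
have B2 : `|(grad u (a, b)).2 - (grad u (a, q)).2| <= e / K.
  apply: h2; split => /=; rewrite -ball_normE/= distrC.
    by rewrite subrr normr0.
  apply: le_lt_trans hq _; rewrite [b + _]addrC addrK normrM.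
  apply: le_lt_trans hr2; rewrite ler_wpM2l// /K.
  by have := normr_ge0 d.1; lra.
rewrite opprD addrACA -!mulrBl.
rewrite (le_trans (ler_normD _ _))// !normrM.
rewrite (@le_trans _ _ (e / K * `|d.1| + e / K * `|d.2|))//.
  by rewrite lerD// ler_wpM2r.
by rewrite -mulrDr mulrAC ler_pdivrMr// ler_wpM2l ?ltW//= /K ltrDl.
Unshelve. all: by end_near.
Qed.

End Partials.

Section BoundedDomain.
Context {R : realType}.
Local Notation mu := (@lebesgue_measure R).
Variables (D : set (R * R)) (M : R).
Hypothesis M0 : 0 < M.
Hypothesis mD : measurable D.
Hypothesis DM : forall x, D x -> `|x.1| < M /\ `|x.2| < M.

Let Box : set (R * R) := `[- M, M] `*` `[- M, M].

Let sub_box : D `<=` Box.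
Proof.
move=> x /DM[h1 h2]; split; rewrite /= in_itv/=.
  by move: h1; rewrite ltr_norml => /andP[/ltW -> /ltW ->].
by move: h2; rewrite ltr_norml => /andP[/ltW -> /ltW ->].
Qed.

Let mBox : measurable Box.
Proof. by apply: measurableX; exact: measurable_itv. Qed.

Let area_box : (area Box < +oo)%E.
Proof.
rewrite product_measure1E/=; try exact: measurable_itv.
by rewrite lebesgue_measure_itv/= lte_fin; case: ifP => _; rewrite -?EFinD -?EFinM ltry.
Qed.

Let integrable_box (f : R * R -> R) : continuous f ->
  area.-integrable Box (EFin \o f).
Proof.
move=> cf; apply: measurable_bounded_integrable => //.
  by apply: measurable_funTS; exact: continuous_measurable_plane.
have cB : compact Box by apply: compact_setX; exact: segment_compact.
have : compact (f @` Box) by apply: continuous_compact => //; exact: continuous_subspaceT.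
move=> /compact_bounded[K [Kr hK]]; exists K; split => // K' KK' x Bx.
by apply: (hK K' KK'); exists x.
Qed.

Lemma integrable_continuous (f : R * R -> R) : continuous f ->
  area.-integrable D (EFin \o f).
Proof. by move=> cf; apply: integrableS (integrable_box cf). Qed.

Lemma L2_continuous (f : R * R -> R) : continuous f -> L2 D f.
Proof.
move=> cf; split; first by apply: measurable_funTS; exact: continuous_measurable_plane.
by apply: integrable_continuous; exact: continuousXfun.
Qed.

Let integral_partial_box1 (psi f : R * R -> R) : continuous f ->
  (forall x y : R, is_derive x 1 (fun t : R => psi (t, y)) (f (x, y))) ->
  (forall y, psi (M, y) = 0) -> (forall y, psi (- M, y) = 0) ->
  (\int[area]_(z in Box) (f z)%:E = 0)%E.
Proof.
move=> cf df pM pN; rewrite integral_mkcond.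
have intf := (@integrable_mkcond _ _ R area Box (EFin \o f) mBox).1 (integrable_box cf).
have <- := @integral21_prod_meas1 _ _ _ _ R mu mu _ intf.
rewrite integral0_eq// => y _; rewrite /fubini_G.
have [yM|yM] := boolP (y \in `[- M, M]).
  transitivity (\int[mu]_(x in `[(- M)%R, M]) (f (x, y))%:E)%E.
    rewrite [RHS]integral_mkcond; apply: eq_integral => x _.
    rewrite /patch /=; congr (if _ then _ else _).
    by apply/idP/idP; rewrite !inE; [move=> -[]|move=> h; split].
  have cfy : continuous (fun x => f (x, y)).
    apply: continuous_composition cf; apply: continuous_pair; last exact: cst_continuous.
    by move=> ?; exact: cvg_id.
  have MM : - M <= M by rewrite (@le_trans _ _ 0)// ?oppr_le0 ltW.
  by rewrite (FTC2_everywhere MM (df ^~ y) cfy) pM pN subrr.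
rewrite integral0_eq// => x _; rewrite /patch ifF//; apply/negbTE.
by apply/negP; rewrite inE => -[_]; apply/negP.
Qed.

Let integral_partial_box2 (psi f : R * R -> R) : continuous f ->
  (forall x y : R, is_derive y 1 (fun t : R => psi (x, t)) (f (x, y))) ->
  (forall x, psi (x, M) = 0) -> (forall x, psi (x, - M) = 0) ->
  (\int[area]_(z in Box) (f z)%:E = 0)%E.
Proof.
move=> cf df pM pN; rewrite integral_mkcond.
have intf := (@integrable_mkcond _ _ R area Box (EFin \o f) mBox).1 (integrable_box cf).
have <- := @integral12_prod_meas1 _ _ _ _ R mu mu _ intf.
rewrite integral0_eq// => x _; rewrite /fubini_F.
have [xM|xM] := boolP (x \in `[- M, M]).
  transitivity (\int[mu]_(y in `[(- M)%R, M]) (f (x, y))%:E)%E.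
    rewrite [RHS]integral_mkcond; apply: eq_integral => y _.
    rewrite /patch /=; congr (if _ then _ else _).
    by apply/idP/idP; rewrite !inE; [move=> -[]|move=> h; split].
  have cfx : continuous (fun y => f (x, y)).
    apply: continuous_composition cf; apply: continuous_pair; first exact: cst_continuous.
    by move=> ?; exact: cvg_id.
  have MM : - M <= M by rewrite (@le_trans _ _ 0)// ?oppr_le0 ltW.
  by rewrite (FTC2_everywhere MM (df x) cfx) pM pN subrr.
rewrite integral0_eq// => y _; rewrite /patch ifF//; apply/negbTE.
by apply/negP; rewrite inE => -[+ _]; apply/negP.
Qed.

Lemma test_function_out (phi : R * R -> R) : test_function D phi ->
  forall x, ~ D x -> phi x = 0 /\ grad phi x = (0, 0).
Proof.
move=> [_ [_ sD]] x Dx.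
have ox : open (~` closure [set x | phi x != 0]) by exact/closed_openC/closed_closure.
have xs : ~ closure [set x | phi x != 0] x by move=> /sD.
have nx : \near x, phi x = cst 0 x.
  have := open_nbhs_nbhs (conj ox xs); apply: filterS => y ny /=.
  by apply/eqP; apply: contra_notT ny => py; exact: subset_closure.
split; first exact: (nbhs_singleton nx).
by rewrite /grad; congr pair; rewrite (near_eq_derive _ nx) derive_cst.
Qed.

(** Green's formula for a function that is continuously differentiable on the
    whole plane: its product with a test function vanishes near the frontier,
    and can therefore be integrated over a box that contains the domain. *)
Lemma weak_gradient_C1 (u : R * R -> R) : classC 1 u -> weak_gradient D u (grad u).
Proof.
move=> C1u phi tphi; have out := test_function_out tphi.
have C1p : classC 1 phi by case: tphi.
have [du1 du2] := classC1_partials C1u; have [dp1 dp2] := classC1_partials C1p.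
case: C1u => cu _ cu1 cu2; case: C1p => cp _ cp1 cp2.
have ibp (a b : R * R -> R) : continuous a -> continuous b ->
    (forall x, ~ D x -> a x + b x = 0) ->
    (\int[area]_(z in Box) (a z + b z)%:E = 0)%E ->
    \int[area]_(x in D) a x = - \int[area]_(x in D) b x.
  move=> ca cb ab0 int0; apply/eqP; rewrite -addr_eq0.
  rewrite -(@RintegralD _ _ R area D a b mD (integrable_continuous ca) (integrable_continuous cb)).
  rewrite /Rintegral.
  have -> : (\int[area]_(x in D) (a x + b x)%:E = 0)%E; last by [].
  rewrite -int0 integral_mkcond [RHS]integral_mkcond; apply: eq_integral => x _.
  rewrite /patch; case: ifPn => xD; case: ifPn => // xB.
    by move/negP: xB; case; move: xD; rewrite !inE; exact: sub_box.
  by rewrite ab0// => /mem_set; apply/negP.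
have pM y : phi (M, y) = 0.
  by case: (out (M, y)) => // /DM[/=]; rewrite gtr0_norm// ltxx.
have pN y : phi (- M, y) = 0.
  by case: (out (- M, y)) => // /DM[/=]; rewrite normrN gtr0_norm// ltxx.
have qM x : phi (x, M) = 0.
  by case: (out (x, M)) => // /DM[/= _]; rewrite gtr0_norm// ltxx.
have qN x : phi (x, - M) = 0.
  by case: (out (x, - M)) => // /DM[/= _]; rewrite normrN gtr0_norm// ltxx.
split; apply: ibp.
- exact: (continuousMfun cu cp1).
- exact: (continuousMfun cu1 cp).
- by move=> x /out[-> ->]/=; rewrite !mulr0 addr0.
- apply: (@integral_partial_box1 (fun x => u x * phi x)).
  + exact: (continuousDfun (continuousMfun cu cp1) (continuousMfun cu1 cp)).
  + move=> x y; have := du1 x y; have := dp1 x y => ? ?.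
    by apply: is_derive_eq; rewrite /GRing.scale/= [phi _ * _]mulrC.
  + by move=> y; rewrite pM mulr0.
  + by move=> y; rewrite pN mulr0.
- exact: (continuousMfun cu cp2).
- exact: (continuousMfun cu2 cp).
- by move=> x /out[-> ->]/=; rewrite !mulr0 addr0.
- apply: (@integral_partial_box2 (fun x => u x * phi x)).
  + exact: (continuousDfun (continuousMfun cu cp2) (continuousMfun cu2 cp)).
  + move=> x y; have := du2 x y; have := dp2 x y => ? ?.
    by apply: is_derive_eq; rewrite /GRing.scale/= [phi _ * _]mulrC.
  + by move=> x; rewrite qM mulr0.
  + by move=> x; rewrite qN mulr0.
Qed.

Lemma H1_C1 (u : R * R -> R) : classC 1 u -> H1 D u (grad u).
Proof.
move=> C1u; split; last exact: weak_gradient_C1.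
- by apply: L2_continuous; case: C1u.
- by apply: L2_continuous; case: C1u.
- by apply: L2_continuous; case: C1u.
Qed.

End BoundedDomain.

(** * Upper bounds by trial functions *)

Section TrialFunctions.
Context {R : realType}.
Local Notation mu := (@lebesgue_measure R).
Variable p : 'I_4 -> R * R.
Local Notation D := (interior_region p).

Let mD : measurable D.
Proof. by apply: open_measurable_plane; exact: open_interior_region. Qed.

Lemma continuous_side_pt (u : R * R -> R) i : continuous u ->
  continuous (fun s => u (side_pt p i s)).
Proof.
by move=> cu; apply: (continuous_composition _ cu); exact: continuous_ray_pt.
Qed.

Let integrable_side (f : R -> R) : continuous f -> mu.-integrable `[0, 1] (EFin \o f).
Proof.
move=> cf; apply: continuous_compact_integrable; first exact: segment_compact.
exact: continuous_subspaceT.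
Qed.

Lemma L2_boundary_continuous (u : R * R -> R) : continuous u -> L2_boundary p u.
Proof.
move=> cu i; split.
  apply: measurable_funTS; apply: continuous_measurable_fun.
  exact: continuous_side_pt.
by apply: integrable_side; apply: continuousXfun; exact: continuous_side_pt.
Qed.

Lemma boundary_integral_fin (f : R * R -> R) : continuous f ->
  boundary_integral p f \is a fin_num.
Proof.
move=> cf; rewrite /boundary_integral; apply/sum_fin_numP => i _ _.
apply: fin_numM => //; apply: integrable_fin_num => //.
by apply: integrable_side; exact: continuous_side_pt.
Qed.

Lemma trace_C1 (u : R * R -> R) : classC 1 u -> trace_of p u (grad u) u.
Proof.
move=> C1u; split; first by apply: L2_boundary_continuous; case: C1u.
exists (fun=> u); split => //.
- under eq_fun do under eq_integral do rewrite subrr expr0n.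
  by under eq_fun do rewrite integral0; exact: cvg_cst.
- under eq_fun do under eq_integral do rewrite subrr /dot/= mul0r addr0.
  by under eq_fun do rewrite integral0; exact: cvg_cst.
- rewrite (_ : (fun _ => _) = cst 0%E); first exact: cvg_cst.
  apply/funext => k; rewrite /boundary_integral big1// => i _.
  under eq_integral do rewrite subrr expr0n.
  by rewrite integral0 mule0.
Qed.

Lemma nonzero_not_ae0 (f : R * R -> R) : (0 < area D)%E ->
  (forall x, f x != 0) -> ~ {ae area, forall x, D x -> f x = 0}.
Proof.
move=> D0 f0 [N [mN N0 DN]]; move: D0; rewrite lt_neqAle => /andP[/eqP + _]; apply.
apply/esym/eqP; rewrite eq_le measure_ge0 andbT -N0; apply: le_measure; rewrite ?inE//.
by move=> x Dx; apply: DN => /(_ Dx)/eqP; apply/negP.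
Qed.

(** The function [u] is its own trace and its gradient is its weak gradient, so
    that it competes in the infimum that defines [lambda1]; positivity keeps it
    from vanishing almost everywhere. *)
Lemma lambda1_le_trial (u : R * R -> R) (beta kappa : R) :
  classC 1 u -> (forall x, 0 < u x) -> (0 < area D)%E -> 0 <= kappa ->
  (\int[area]_(x in D) (dot (grad u x) (grad u x) + kappa * u x ^+ 2)%:E <=
   beta%:E * boundary_integral p (fun x => (u x ^+ 2)%R))%E ->
  (lambda1 p (- beta) <= (- kappa)%:E)%E.
Proof.
move=> C1u u0 D0 k0 ineq.
have [M M0 DM] := interior_region_bounded p.
have [cu _ cu1 cu2] := C1u.
pose d x := dot (grad u x) (grad u x); pose q x := u x ^+ 2.
have cd : continuous d by exact: (continuousDfun (continuousMfun cu1 cu1) (continuousMfun cu2 cu2)).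
have cq : continuous q by exact: continuousXfun.
have id := integrable_continuous mD DM cd.
have iq := integrable_continuous mD DM cq.
apply: (@le_trans _ _ (rayleigh p (- beta) u (grad u) u)%:E).
  apply: ereal_inf_lbound; exists u, (grad u), u; split => //.
  - exact: (H1_C1 M0 mD DM).
  - exact: trace_C1.
  - by apply: nonzero_not_ae0 => // x; rewrite gt_eqF.
have fd : (\int[area]_(x in D) (d x)%:E)%E \is a fin_num.
  exact: (@integrable_fin_num _ _ R area D mD _ id).
have fq : (\int[area]_(x in D) (q x)%:E)%E \is a fin_num.
  exact: (@integrable_fin_num _ _ R area D mD _ iq).
have fb := boundary_integral_fin cq.
have q0 : (0 < \int[area]_(x in D) (q x)%:E)%E.
  rewrite lt_neqAle integral_ge0 ?andbT; last by move=> x _; rewrite lee_fin sqr_ge0.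
  apply/eqP => /esym int0; apply: (nonzero_not_ae0 (f := q) D0).
    by move=> x; rewrite /q sqrf_eq0 gt_eqF.
  have mq : measurable_fun D (EFin \o q).
    by apply/measurable_EFinP; apply: measurable_funTS; exact: continuous_measurable_plane.
  have [+ _] := @ae_eq_integral_abs _ _ R area D mD (EFin \o q) mq.
  have -> : (\int[area]_(x in D) `|(EFin \o q) x| = 0)%E.
    by rewrite -int0; apply: eq_integral => x _; rewrite gee0_abs// lee_fin sqr_ge0.
  move=> /(_ erefl); apply: filterS => x /= h Dx.
  by have [] := h Dx.
have sum_eq : (\int[area]_(x in D) (d x + kappa * q x)%:E =
    \int[area]_(x in D) (d x)%:E + kappa%:E * \int[area]_(x in D) (q x)%:E)%E.
  under eq_integral do rewrite EFinD.
  rewrite ge0_integralD//.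
  - congr (_ + _)%E; under eq_integral do rewrite EFinM.
    rewrite ge0_integralZl//.
    + by apply/measurable_EFinP; apply: measurable_funTS; exact: continuous_measurable_plane.
    + by move=> x _; rewrite lee_fin sqr_ge0.
  - by move=> x _; rewrite lee_fin dot_ge0.
  - by apply/measurable_EFinP; apply: measurable_funTS; exact: continuous_measurable_plane.
  - by move=> x _; rewrite lee_fin mulr_ge0// sqr_ge0.
  - apply/measurable_EFinP; apply: measurable_funTS; apply: continuous_measurable_plane.
    by apply: continuousMfun => //; exact: cst_continuous.
move: ineq; rewrite sum_eq -(fineK fd) -(fineK fq) -(fineK fb).
rewrite -!EFinM -!EFinD lee_fin /rayleigh /Rintegral => ineq.
have qf : 0 < fine (\int[area]_(x in D) (q x)%:E)%E.
  by rewrite fine_gt0// q0 ltey_eq fq.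
rewrite lee_fin ler_pdivrMr//.
by move: ineq; rewrite /d /q; lra.
Qed.

End TrialFunctions.

(** * Hyperbolic functions and the Robin inequality on a segment *)

Section HyperbolicFunctions.
Context {R : realType}.

Definition cosh (x : R) : R := (expR x + expR (- x)) / 2.
Definition sinh (x : R) : R := (expR x - expR (- x)) / 2.
Definition tanh (x : R) : R := sinh x / cosh x.

Lemma cosh_gt0 x : 0 < cosh x.
Proof. by rewrite divr_gt0// addr_gt0// expR_gt0. Qed.

Lemma coshN x : cosh (- x) = cosh x.
Proof. by rewrite /cosh opprK addrC. Qed.

Lemma sinhN x : sinh (- x) = - sinh x.
Proof. by rewrite /sinh opprK -mulNr opprB. Qed.

Lemma tanhN x : tanh (- x) = - tanh x.
Proof. by rewrite /tanh coshN sinhN mulNr. Qed.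

Lemma cosh2_sinh2 x : cosh x ^+ 2 - sinh x ^+ 2 = 1.
Proof.
have -> : cosh x ^+ 2 - sinh x ^+ 2 = expR x * expR (- x).
  by rewrite /cosh /sinh; field.
by rewrite expRxMexpNx_1.
Qed.

Lemma tanhE x : tanh x = (expR x - expR (- x)) / (expR x + expR (- x)).
Proof. by rewrite /tanh /sinh /cosh; field; rewrite gt_eqF// addr_gt0// expR_gt0. Qed.

Lemma tanh_gt0 x : 0 < x -> 0 < tanh x.
Proof.
by move=> x0; rewrite divr_gt0 ?cosh_gt0// divr_gt0// subr_gt0 ltr_expR; lra.
Qed.

Lemma is_derive_cosh (x : R) : is_derive x 1 cosh (sinh x).
Proof.
have dN : is_derive x 1 (fun y : R => expR (- y)) (- expR (- x)).
  apply: is_derive_eq; rewrite /GRing.scale/=; ring.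
by rewrite /cosh /sinh; apply: is_derive_eq; rewrite /GRing.scale/=; field.
Qed.

Lemma is_derive_sinh (x : R) : is_derive x 1 sinh (cosh x).
Proof.
have dN : is_derive x 1 (fun y : R => expR (- y)) (- expR (- x)).
  apply: is_derive_eq; rewrite /GRing.scale/=; ring.
by rewrite /cosh /sinh; apply: is_derive_eq; rewrite /GRing.scale/=; field.
Qed.

Lemma is_derive_tanh (x : R) : is_derive x 1 tanh (1 - tanh x ^+ 2).
Proof.
have c0 : cosh x != 0 by rewrite gt_eqF// cosh_gt0.
have dV := is_deriveV (f := cosh) (x := x) (v := 1) c0 (is_derive_cosh x).
apply: (is_derive_eq (is_deriveM (is_derive_sinh x) dV)).
by rewrite /tanh /GRing.scale/=; field.
Qed.

Lemma continuous_cosh : continuous cosh.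
Proof. exact: derive_continuous is_derive_cosh. Qed.

Lemma continuous_sinh : continuous sinh.
Proof. exact: derive_continuous is_derive_sinh. Qed.

Lemma continuous_tanh : continuous tanh.
Proof. exact: derive_continuous is_derive_tanh. Qed.

Lemma is_derive_comp_affine (f df : R -> R) (a b x : R) :
  (forall x : R, is_derive x 1 f (df x)) ->
  is_derive x 1 (fun s : R => f (a * s + b)) (a * df (a * x + b)).
Proof.
move=> dF; have h : is_derive x 1 (fun s : R => a * s + b) a.
  by apply: is_derive_eq; rewrite /GRing.scale/=; ring.
by rewrite mulrC; exact: (@is_derive1_comp R f (fun s : R => a * s + b) x _ _ (dF _) h).
Qed.

(** Sharp to first order at the origin, for weak coupling. *)
Lemma tanh_ge_frac (x : R) : 0 <= x -> x / (1 + x) <= tanh x.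
Proof.
move=> x0; have e2 : 1 + 2 * x <= expR x ^+ 2.
  by rewrite -expRM_natl; apply: expR_ge1Dx.
have eN : expR x * expR (- x) = 1 by exact: expRxMexpNx_1.
have ep := expR_gt0 x; have eNp := expR_gt0 (- x).
rewrite tanhE ler_pdivrMr ?ltr_pwDl// mulrAC ler_pdivlMr ?addr_gt0//.
rewrite -(ler_pM2l ep).
move: e2 eN; move: (expR x) (expR (- x)) => E F; rewrite expr2 => e2 eN; nra.
Qed.

(** Sharp at infinity, for strong coupling. *)
Lemma tanh_ge_exp (x : R) : 1 - 2 * expR (- (2 * x)) <= tanh x.
Proof.
have -> : - (2 * x) = - x + - x by ring.
have eN : expR x * expR (- x) = 1 by exact: expRxMexpNx_1.
have ep := expR_gt0 x; have eNp := expR_gt0 (- x).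
rewrite expRD tanhE ler_pdivlMr ?addr_gt0//.
move: eN ep eNp; move: (expR x) (expR (- x)) => E F eN ep eNp.
have -> : (1 - 2 * (F * F)) * (E + F) = E + F - 2 * F * (E * F) - 2 * F ^+ 3 by ring.
by rewrite eN; have := exprn_gt0 3 eNp; lra.
Qed.

End HyperbolicFunctions.

Section SegmentInequality.
Context {R : realType}.
Local Notation mu := (@lebesgue_measure R).

(** One-dimensional Robin inequality on a segment of unit length. The function
    [K * tanh (K * (s - 1/2))] is the logarithmic derivative of the ground
    state [cosh (K * (s - 1/2))]; differentiating its product with [f ^+ 2]
    and completing the square gives the bound. *)
Lemma segment_robin (f df : R -> R) (K : R) :
  (forall x : R, is_derive x 1 f (df x)) -> continuous df ->
  ((K * tanh (K / 2) * (f 0 ^+ 2 + f 1 ^+ 2))%:E <=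
   \int[mu]_(s in `[0%R, 1%R]) (df s ^+ 2 + K ^+ 2 * f s ^+ 2)%:E)%E.
Proof.
move=> dF cdf; have cf := derive_continuous dF.
pose th s := tanh (K * s + - (K / 2)).
have dth (s : R) : is_derive s 1 th (K * (1 - th s ^+ 2)).
  exact: is_derive_comp_affine is_derive_tanh.
have cth := derive_continuous dth.
pose G s := K * (th s * f s ^+ 2).
pose g s := K * (K * (1 - th s ^+ 2) * f s ^+ 2 + th s * (2 * f s * df s)).
have dG (s : R) : is_derive s 1 G (g s).
  have ? := dth s; have ? := dF s.
  apply: is_derive_eq; rewrite /g /GRing.scale/=; ring.
have cg : continuous g.
  apply: continuousMfun; first exact: cst_continuous.
  apply: continuousDfun; apply: continuousMfun => //.
  - apply: continuousMfun; first exact: cst_continuous.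
    apply: continuousDfun; first exact: cst_continuous.
    by apply: continuousNfun; exact: continuousXfun.
  - exact: continuousXfun.
  - apply: continuousMfun => //; apply: continuousMfun => //; exact: cst_continuous.
have -> : (K * tanh (K / 2) * (f 0 ^+ 2 + f 1 ^+ 2)) = G 1 - G 0.
  rewrite /G /th mulr0 add0r tanhN mulr1.
  have -> : K - K / 2 = K / 2 by field.
  by ring.
rewrite -(FTC2_everywhere ler01 dG cg).
have cI (h : R -> R) : continuous h -> mu.-integrable `[0, 1] (EFin \o h).
  move=> ch; apply: continuous_compact_integrable; first exact: segment_compact.
  exact: continuous_subspaceT.
apply: le_integral => //.
- exact: cI.
- apply: cI; apply: continuousDfun; first exact: continuousXfun.
  by apply: continuousMfun; [exact: cst_continuous|exact: continuousXfun].
- move=> s _; rewrite lee_fin /g -subr_ge0.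
  have -> : df s ^+ 2 + K ^+ 2 * f s ^+ 2 - K * (K * (1 - th s ^+ 2) * f s ^+ 2 +
    th s * (2 * f s * df s)) = (df s - K * th s * f s) ^+ 2 by ring.
  exact: sqr_ge0.
Qed.

End SegmentInequality.

(** * The Robin inequality on a square *)

Section ParallelogramIntegral.
Context {R : realType}.
Local Notation mu := (@lebesgue_measure R).

Lemma reflect_unit (f : R -> R) : continuous f ->
  (\int[mu]_(s in `[0%R, 1%R]) (f (1 - s))%:E = \int[mu]_(s in `[0%R, 1%R]) (f s)%:E)%E.
Proof.
move=> cf; rewrite [RHS]integration_by_substitution_onem ?ler01 ?lexx//; last first.
  exact: continuous_subspaceT.
by rewrite (_ : unstable.onem 1 = 0)// /unstable.onem subrr.
Qed.

Lemma measurable_inner2 (G : R * R -> R) : continuous G -> (forall x, 0 <= G x) ->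
  measurable_fun setT (fun y : R => \int[mu]_(x in `[0%R, 1%R]) (G (x, y))%:E)%E.
Proof.
move=> cG G0; pose strip : set (R * R) := `[0, 1] `*` setT.
have mS : measurable strip by apply: measurableX => //; exact: measurable_itv.
pose h := (fun z => (G z)%:E) \_ strip.
have mh : measurable_fun setT h.
  apply/(measurable_restrictT _ _).1 => //.
  by apply/measurable_EFinP; apply: measurable_funTS; exact: continuous_measurable_plane.
have h0 z : (0 <= h z)%E by rewrite /h /patch; case: ifP => // _; rewrite lee_fin.
have := measurable_integral2 mh h0; congr measurable_fun; apply/funext => y.
rewrite [RHS]integral_mkcond; apply: eq_integral => x _.
rewrite /h /patch; congr (if _ then _ else _).
by apply/idP/idP; rewrite !inE; [move=> -[]|move=> xI; split].
Qed.

Lemma measurable_inner1 (G : R * R -> R) : continuous G -> (forall x, 0 <= G x) ->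
  measurable_fun setT (fun x : R => \int[mu]_(y in `[0%R, 1%R]) (G (x, y))%:E)%E.
Proof.
move=> cG G0; apply: (@measurable_inner2 (fun z => G (z.2, z.1))) => //.
apply: (continuous_composition _ cG).
by apply: continuous_pair; [exact: continuous_snd|exact: continuous_fst].
Qed.

Let open_closed (f : R -> \bar R) : measurable_fun setT f ->
  (\int[mu]_(s in `]0%R, 1%R[) f s = \int[mu]_(s in `[0%R, 1%R]) f s)%E.
Proof.
by move=> mf; rewrite -(integral_itv_bndoo true false)//; exact: measurable_funTS.
Qed.

Lemma section_continuous2 (G : R * R -> R) y : continuous G -> continuous (fun x => G (x, y)).
Proof.
move=> cG; apply: (continuous_composition _ cG).
by apply: continuous_pair; [move=> ?; exact: cvg_id|exact: cst_continuous].
Qed.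

Lemma section_continuous1 (G : R * R -> R) x : continuous G -> continuous (fun y => G (x, y)).
Proof.
move=> cG; apply: (continuous_composition _ cG).
by apply: continuous_pair; [exact: cst_continuous|move=> ?; exact: cvg_id].
Qed.

Let integral_unit_square2 (G : R * R -> R) : continuous G -> (forall x, 0 <= G x) ->
  (\int[area]_(z in `]0%R, 1%R[ `*` `]0%R, 1%R[) (G z)%:E =
   \int[mu]_(y in `[0%R, 1%R]) \int[mu]_(x in `[0%R, 1%R]) (G (x, y))%:E)%E.
Proof.
move=> cG G0; rewrite integral_mkcond.
have mSq : measurable (`]0, 1[ `*` `]0, 1[ : set (R * R)).
  by apply: measurableX; exact: measurable_itv.
rewrite integral_area21; first last.
- by move=> z; rewrite /patch; case: ifP => // _; rewrite lee_fin.
- apply/(measurable_restrictT _ _).1 => //.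
  by apply/measurable_EFinP; apply: measurable_funTS; exact: continuous_measurable_plane.
rewrite -open_closed; last exact: measurable_inner2.
rewrite [RHS]integral_mkcond; apply: eq_integral => y _.
rewrite [RHS]/patch; case: ifPn => yI.
  rewrite -open_closed; last first.
    by apply/measurable_EFinP; apply: continuous_measurable_fun; exact: section_continuous2.
  rewrite [RHS]integral_mkcond; apply: eq_integral => x _.
  rewrite /patch; congr (if _ then _ else _).
  by apply/idP/idP; rewrite !inE; [move=> -[]|move=> h; split => //=; rewrite inE in yI].
rewrite integral0_eq// => x _; rewrite /patch ifF//; apply/negbTE.
by apply: contra yI; rewrite !inE => -[].
Qed.

Let integral_unit_square1 (G : R * R -> R) : continuous G -> (forall x, 0 <= G x) ->
  (\int[area]_(z in `]0%R, 1%R[ `*` `]0%R, 1%R[) (G z)%:E =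
   \int[mu]_(x in `[0%R, 1%R]) \int[mu]_(y in `[0%R, 1%R]) (G (x, y))%:E)%E.
Proof.
move=> cG G0; rewrite integral_mkcond.
have mSq : measurable (`]0, 1[ `*` `]0, 1[ : set (R * R)).
  by apply: measurableX; exact: measurable_itv.
rewrite integral_area12; first last.
- by move=> z; rewrite /patch; case: ifP => // _; rewrite lee_fin.
- apply/(measurable_restrictT _ _).1 => //.
  by apply/measurable_EFinP; apply: measurable_funTS; exact: continuous_measurable_plane.
rewrite -open_closed; last exact: measurable_inner1.
rewrite [RHS]integral_mkcond; apply: eq_integral => x _.
rewrite [RHS]/patch; case: ifPn => xI.
  rewrite -open_closed; last first.
    by apply/measurable_EFinP; apply: continuous_measurable_fun; exact: section_continuous1.
  rewrite [RHS]integral_mkcond; apply: eq_integral => y _.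
  rewrite /patch; congr (if _ then _ else _).
  by apply/idP/idP; rewrite !inE; [move=> -[]|move=> h; split => //=; rewrite inE in xI].
rewrite integral0_eq// => y _; rewrite /patch ifF//; apply/negbTE.
by apply: contra xI; rewrite !inE => -[].
Qed.

Variables (p : 'I_4 -> R * R) (i : 'I_4).
Local Notation D := (interior_region p).
Local Notation Phi := (frame (p i) (side p i) (side p (ordS i))).
Local Notation delta := (det2 (side p i) (side p (ordS i))).
Hypothesis vw : delta != 0.
Hypothesis opp02 : side p (ordS (ordS i)) = - side p i.

Lemma continuous_frame (c v w : R * R) : continuous (frame c v w).
Proof.
apply: continuous_pair; apply: continuousDfun.
- apply: continuousDfun; first exact: cst_continuous.
  by apply: continuousMfun; [exact: continuous_fst|exact: cst_continuous].
- by apply: continuousMfun; [exact: continuous_snd|exact: cst_continuous].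
- apply: continuousDfun; first exact: cst_continuous.
  by apply: continuousMfun; [exact: continuous_fst|exact: cst_continuous].
- by apply: continuousMfun; [exact: continuous_snd|exact: cst_continuous].
Qed.

Let integral_frame_square (F : R * R -> R) : continuous F -> (forall x, 0 <= F x) ->
  (\int[area]_(x in D) (F x)%:E =
   `|delta|%:E * \int[area]_(z in `]0%R, 1%R[ `*` `]0%R, 1%R[) (F (Phi z))%:E)%E.
Proof.
move=> cF F0; rewrite integral_mkcond (ge0_integral_frame (p i) vw).
- congr (_ * _)%E; rewrite [RHS]integral_mkcond; apply: eq_integral => z _.
  rewrite /patch; congr (if _ then _ else _).
  by rewrite -(interior_parallelogram vw opp02).
- apply/(measurable_restrictT _ _).1; first exact: measurable_interior.
  by apply/measurable_EFinP; apply: measurable_funTS; exact: continuous_measurable_plane.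
- by move=> z; rewrite /patch; case: ifP => // _; rewrite lee_fin.
Qed.

Lemma integral_parallelogram2 (F : R * R -> R) : continuous F -> (forall x, 0 <= F x) ->
  (\int[area]_(x in D) (F x)%:E = `|delta|%:E *
   \int[mu]_(r in `[0%R, 1%R]) \int[mu]_(s in `[0%R, 1%R]) (F (Phi (s, r)))%:E)%E.
Proof.
move=> cF F0; rewrite integral_frame_square// integral_unit_square2//.
exact: (continuous_composition (@continuous_frame _ _ _) cF).
Qed.

Lemma integral_parallelogram1 (F : R * R -> R) : continuous F -> (forall x, 0 <= F x) ->
  (\int[area]_(x in D) (F x)%:E = `|delta|%:E *
   \int[mu]_(s in `[0%R, 1%R]) \int[mu]_(r in `[0%R, 1%R]) (F (Phi (s, r)))%:E)%E.
Proof.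
move=> cF F0; rewrite integral_frame_square// integral_unit_square1//.
exact: (continuous_composition (@continuous_frame _ _ _) cF).
Qed.

Lemma boundary_parallelogram (f : R * R -> R) : continuous f ->
  (forall x, 0 <= f x) -> (boundary_integral p f =
   (enorm (side p i))%:E *
     (\int[mu]_(s in `[0%R, 1%R]) (f (Phi (s, 0%R)))%:E +
      \int[mu]_(s in `[0%R, 1%R]) (f (Phi (s, 1%R)))%:E) +
   (enorm (side p (ordS i)))%:E *
     (\int[mu]_(r in `[0%R, 1%R]) (f (Phi (0%R, r)))%:E +
      \int[mu]_(r in `[0%R, 1%R]) (f (Phi (1%R, r)))%:E))%E.
Proof.
move=> cf f0.
have cfP : continuous (fun z => f (Phi z)).
  exact: (continuous_composition (@continuous_frame _ _ _) cf).
have cx y : continuous (fun s : R => f (Phi (s, y))) := @section_continuous2 _ y cfP.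
have cy x : continuous (fun s : R => f (Phi (x, s))) := @section_continuous1 _ x cfP.
have S s := parallelogram_side_pt opp02 s.
have l2 : enorm (side p (ordS (ordS i))) = enorm (side p i) by rewrite opp02 enormN.
have l3 : enorm (side p (ordS (ordS (ordS i)))) = enorm (side p (ordS i)).
  rewrite -enormN; congr enorm; have := opp02; rewrite /side ordS4 => /eqP.
  rewrite -subr_eq0 => /eqP E; apply/eqP; rewrite -subr_eq0; apply/eqP.
  rewrite -[RHS]E; rewrite [LHS]surjective_pairing [RHS]surjective_pairing/=.
  by congr pair; ring.
rewrite /boundary_integral (big_ord4 _ i)/= l2 l3.
have int0 (h : R -> R) : (forall s, 0 <= h s) -> (0 <= \int[mu]_(s in `[0%R, 1%R]) (h s)%:E)%E.
  by move=> h0; apply: integral_ge0 => s _; rewrite lee_fin.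
have -> : (\int[mu]_(s in `[0%R, 1%R]) (f (side_pt p i s))%:E =
    \int[mu]_(s in `[0%R, 1%R]) (f (Phi (s, 0%R)))%:E)%E.
  by apply: eq_integral => s _; have [-> _ _ _] := S s.
have -> : (\int[mu]_(s in `[0%R, 1%R]) (f (side_pt p (ordS i) s))%:E =
    \int[mu]_(s in `[0%R, 1%R]) (f (Phi (1%R, s)))%:E)%E.
  by apply: eq_integral => s _; have [_ -> _ _] := S s.
have -> : (\int[mu]_(s in `[0%R, 1%R]) (f (side_pt p (ordS (ordS i)) s))%:E =
    \int[mu]_(s in `[0%R, 1%R]) (f (Phi (s, 1%R)))%:E)%E.
  rewrite -[RHS]reflect_unit//.
  by apply: eq_integral => s _; have [_ _ -> _] := S s.
have -> : (\int[mu]_(s in `[0%R, 1%R]) (f (side_pt p (ordS (ordS (ordS i))) s))%:E =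
    \int[mu]_(s in `[0%R, 1%R]) (f (Phi (0%R, s)))%:E)%E.
  rewrite -[RHS]reflect_unit//.
  by apply: eq_integral => s _; have [_ _ _ ->] := S s.
have n0 y := int0 (fun s => f (Phi (s, y))) (fun s => f0 _).
have n1 x := int0 (fun s => f (Phi (x, s))) (fun s => f0 _).
rewrite (ge0_muleDr _ (n0 0) (n0 1)) (ge0_muleDr _ (n1 0) (n1 1)).
by rewrite addeA addeACA; congr (_ + _)%E; exact: addeC.
Qed.

End ParallelogramIntegral.

Section OrthonormalFrame.
Context {R : realType}.

(** The matrix with rows [v] and [w] is a multiple of an orthogonal matrix, so
    that its columns are orthogonal with equal norms as well. *)
Lemma parseval (v w g : R * R) : 0 < enorm v -> enorm v = enorm w -> dot v w = 0 ->
  dot g v ^+ 2 + dot g w ^+ 2 = enorm v ^+ 2 * dot g g.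
Proof.
move=> v0 vw; have V := enorm_sqr v; have W := enorm_sqr w; rewrite -vw in W.
have N0 : enorm v ^+ 2 != 0 by rewrite expf_neq0 ?gt_eqF.
move: (enorm v ^+ 2) V W N0 => N; rewrite /dot.
move: v w g {v0 vw} => [v1 v2] [w1 w2] [g1 g2] /= V W N0 d0.
have e1 : v1 * v1 + w1 * w1 = N.
  apply: (mulfI N0); rewrite mulrDr {1}W V.
  have -> : (w1 * w1 + w2 * w2) * (v1 * v1) + (v1 * v1 + v2 * v2) * (w1 * w1) =
    (v1 * v1 + v2 * v2) * (w1 * w1 + w2 * w2) +
    (v1 * w1 + v2 * w2) * (v1 * w1 - v2 * w2) by ring.
  by rewrite d0 mul0r addr0 -V -W.
have e2 : v1 * v2 + w1 * w2 = 0.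
  apply: (mulfI N0); rewrite mulr0 mulrDr {1}W V.
  have -> : (w1 * w1 + w2 * w2) * (v1 * v2) + (v1 * v1 + v2 * v2) * (w1 * w2) =
    (v1 * w1 + v2 * w2) * (v2 * w1 + v1 * w2) by ring.
  by rewrite d0 mul0r.
have e3 : v2 * v2 + w2 * w2 = N by lra.
have -> : (g1 * v1 + g2 * v2) ^+ 2 + (g1 * w1 + g2 * w2) ^+ 2 =
  g1 * g1 * (v1 * v1 + w1 * w1) + g2 * g2 * (v2 * v2 + w2 * w2) +
  2 * g1 * g2 * (v1 * v2 + w1 * w2) by ring.
by rewrite e1 e2 e3; ring.
Qed.

End OrthonormalFrame.

Section SquareLowerBound.
Context {R : realType}.
Local Notation mu := (@lebesgue_measure R).
Variables (p : 'I_4 -> R * R) (i : 'I_4).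
Local Notation D := (interior_region p).
Local Notation v := (side p i).
Local Notation w := (side p (ordS i)).
Local Notation Phi := (frame (p i) v w).
Local Notation l := (enorm v).
Hypothesis opp02 : side p (ordS (ordS i)) = - v.
Hypothesis vw : det2 v w != 0.
Hypothesis ortho : dot v w = 0.
Hypothesis equal : l = enorm w.

Let l0 : 0 < l. Proof. exact: (enorm_gt0 vw). Qed.

Let absdet : `|det2 v w| = l ^+ 2.
Proof.
have := lagrange v w; rewrite ortho expr0n/= addr0 -equal -expr2 => E.
by rewrite -sqrtr_sqr E sqrtr_sqr ger0_norm// sqr_ge0.
Qed.

Let chord1 (s r : R) : ray_pt (frame (p i) v w (0, r)) v s = Phi (s, r).
Proof. by rewrite /ray_pt /frame/=; congr pair; ring. Qed.

Let chord2 (s r : R) : ray_pt (frame (p i) v w (s, 0)) w r = Phi (s, r).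
Proof. by rewrite /ray_pt /frame/=; congr pair; ring. Qed.

Variables (phi : R * R -> R) (k : R).
Hypothesis C1phi : classC 1 phi.

Let part (a : R * R) x := (dot (grad phi x) a / l) ^+ 2 + k ^+ 2 * phi x ^+ 2.

Let cphi : continuous phi. Proof. by case: C1phi. Qed.

Let cPhi : continuous Phi. Proof. exact: continuous_frame. Qed.

Let cdot a : continuous (fun x => dot (grad phi x) a).
Proof.
case: C1phi => _ _ c1 c2.
exact: (continuousDfun (continuousMfun c1 (@cst_continuous _ _ a.1))
  (continuousMfun c2 (@cst_continuous _ _ a.2))).
Qed.

Let cpart a : continuous (part a).
Proof.
apply: continuousDfun.
  apply: continuousXfun; apply: continuousMfun; [exact: cdot|exact: cst_continuous].
by apply: continuousMfun; [exact: cst_continuous|exact: continuousXfun].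
Qed.

Let part_ge0 a x : 0 <= part a x.
Proof. by apply: addr_ge0; [|apply: mulr_ge0]; exact: sqr_ge0. Qed.

Let K := k * l.
Let T := K * tanh (K / 2).

Let scaled a x : l ^+ 2 * part a x = dot (grad phi x) a ^+ 2 + K ^+ 2 * phi x ^+ 2.
Proof. by rewrite /part /K; field; rewrite gt_eqF. Qed.

Let edge_ge0 (h : R -> R) : (0 <= \int[mu]_(s in `[0%R, 1%R]) (h s ^+ 2)%:E)%E.
Proof. by apply: integral_ge0 => s _; rewrite lee_fin sqr_ge0. Qed.

Let T0 : 0 <= k -> 0 <= T.
Proof.
rewrite /T /K le_eqVlt => /orP[/eqP <-|k0]; first by rewrite !mul0r.
have K0 : 0 < k * l by rewrite mulr_gt0.
by rewrite mulr_ge0 ?ltW// tanh_gt0// divr_gt0.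
Qed.

Let measurable_edge (h : R -> R) : continuous h ->
  measurable_fun (`[0, 1] : set R) (fun s => (h s ^+ 2)%:E).
Proof.
move=> ch; apply/measurable_EFinP; apply: measurable_funTS.
by apply: continuous_measurable_fun; exact: continuousXfun.
Qed.

Let cx (r : R) : continuous (fun s => phi (Phi (s, r))).
Proof. by apply: (@section_continuous2 R (fun z => phi (Phi z))); exact: continuous_composition cPhi cphi. Qed.

Let cy (s : R) : continuous (fun r => phi (Phi (s, r))).
Proof. by apply: (@section_continuous1 R (fun z => phi (Phi z))); exact: continuous_composition cPhi cphi. Qed.

Let bound1 : 0 <= k ->
  (T%:E * (\int[mu]_(r in `[0%R, 1%R]) (phi (Phi (0%R, r)) ^+ 2)%:E +
           \int[mu]_(r in `[0%R, 1%R]) (phi (Phi (1%R, r)) ^+ 2)%:E) <=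
   \int[area]_(x in D) (part v x)%:E)%E.
Proof.
move=> k0; rewrite (integral_parallelogram2 vw opp02)// absdet.
have cG : continuous (fun z => part v (Phi z)) by exact: continuous_composition cPhi (@cpart v).
rewrite -ge0_integralD//; first last.
- exact: measurable_edge.
- by move=> r _; rewrite lee_fin sqr_ge0.
- exact: measurable_edge.
- by move=> r _; rewrite lee_fin sqr_ge0.
rewrite -ge0_integralZl//; last 3 first.
- by apply: emeasurable_funD; exact: measurable_edge.
- by move=> r _; rewrite adde_ge0// lee_fin sqr_ge0.
- by rewrite lee_fin T0.
rewrite -ge0_integralZl//; last 3 first.
- by apply: measurable_funTS; exact: (measurable_inner2 cG).
- by move=> r _; apply: integral_ge0 => s _; rewrite lee_fin.
- by rewrite lee_fin sqr_ge0.
apply: ge0_le_integral => //.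
- move=> r _; rewrite -EFinD -EFinM lee_fin.
  by apply: mulr_ge0; [exact: T0|apply: addr_ge0; exact: sqr_ge0].
- by apply: emeasurable_funM => //; apply: emeasurable_funD; exact: measurable_edge.
- by apply: emeasurable_funM => //; apply: measurable_funTS; exact: (measurable_inner2 cG).
move=> r _; rewrite -EFinD -EFinM.
rewrite -ge0_integralZl//; last 3 first.
- apply/measurable_EFinP; apply: measurable_funTS; apply: continuous_measurable_fun.
  exact: (@section_continuous2 _ _ _ cG).
- by move=> s _; rewrite lee_fin.
- by rewrite lee_fin sqr_ge0.
under [leRHS]eq_integral do rewrite -EFinM scaled.
apply: (segment_robin (f := fun s => phi (Phi (s, r))) (df := fun s => dot (grad phi (Phi (s, r))) v)).
- move=> s; have := is_derive_along (frame (p i) v w (0, r)) v s C1phi.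
  rewrite chord1; congr (is_derive _ _ _ _).
  by apply/funext => s'; rewrite chord1.
- by apply: (@section_continuous2 R (fun z => dot (grad phi (Phi z)) v)); exact: continuous_composition cPhi (@cdot v).
Qed.

Let bound2 : 0 <= k ->
  (T%:E * (\int[mu]_(s in `[0%R, 1%R]) (phi (Phi (s, 0%R)) ^+ 2)%:E +
           \int[mu]_(s in `[0%R, 1%R]) (phi (Phi (s, 1%R)) ^+ 2)%:E) <=
   \int[area]_(x in D) (part w x)%:E)%E.
Proof.
move=> k0; rewrite (integral_parallelogram1 vw opp02)// absdet.
have cG : continuous (fun z => part w (Phi z)) by exact: continuous_composition cPhi (@cpart w).
rewrite -ge0_integralD//; first last.
- exact: measurable_edge.
- by move=> r _; rewrite lee_fin sqr_ge0.
- exact: measurable_edge.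
- by move=> r _; rewrite lee_fin sqr_ge0.
rewrite -ge0_integralZl//; last 3 first.
- by apply: emeasurable_funD; exact: measurable_edge.
- by move=> r _; rewrite adde_ge0// lee_fin sqr_ge0.
- by rewrite lee_fin T0.
rewrite -ge0_integralZl//; last 3 first.
- by apply: measurable_funTS; exact: (measurable_inner1 cG).
- by move=> r _; apply: integral_ge0 => s _; rewrite lee_fin.
- by rewrite lee_fin sqr_ge0.
apply: ge0_le_integral => //.
- move=> r _; rewrite -EFinD -EFinM lee_fin.
  by apply: mulr_ge0; [exact: T0|apply: addr_ge0; exact: sqr_ge0].
- by apply: emeasurable_funM => //; apply: emeasurable_funD; exact: measurable_edge.
- by apply: emeasurable_funM => //; apply: measurable_funTS; exact: (measurable_inner1 cG).
move=> s _; rewrite -EFinD -EFinM.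
rewrite -ge0_integralZl//; last 3 first.
- apply/measurable_EFinP; apply: measurable_funTS; apply: continuous_measurable_fun.
  exact: (@section_continuous1 _ _ _ cG).
- by move=> r _; rewrite lee_fin.
- by rewrite lee_fin sqr_ge0.
under [leRHS]eq_integral do rewrite -EFinM scaled.
apply: (segment_robin (f := fun r => phi (Phi (s, r))) (df := fun r => dot (grad phi (Phi (s, r))) w)).
- move=> r; have := is_derive_along (frame (p i) v w (s, 0)) w r C1phi.
  rewrite chord2; congr (is_derive _ _ _ _).
  by apply/funext => s'; rewrite chord2.
- by apply: (@section_continuous1 R (fun z => dot (grad phi (Phi z)) w)); exact: continuous_composition cPhi (@cdot w).
Qed.

(** The segment inequality, integrated over the chords parallel to the sides. *)
Lemma square_robin (beta : R) : 0 <= k -> 0 <= beta -> beta <= k * tanh (k * l / 2) ->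
  (beta%:E * boundary_integral p (fun x => (phi x ^+ 2)%R) <=
   \int[area]_(x in D) (dot (grad phi x) (grad phi x) + 2 * k ^+ 2 * phi x ^+ 2)%:E)%E.
Proof.
move=> k0 b0 bk.
have mpart a : measurable_fun D (fun x => (part a x)%:E).
  by apply/measurable_EFinP; apply: measurable_funTS; exact: continuous_measurable_plane.
have -> : (\int[area]_(x in D) (dot (grad phi x) (grad phi x) + 2 * k ^+ 2 * phi x ^+ 2)%:E =
    \int[area]_(x in D) (part v x)%:E + \int[area]_(x in D) (part w x)%:E)%E.
  rewrite -ge0_integralD; [|exact: measurable_interior|by move=> x _; rewrite lee_fin|
    exact: mpart|by move=> x _; rewrite lee_fin|exact: mpart].
  apply: eq_integral => x _; rewrite -EFinD; congr EFin.
  have P := parseval (grad phi x) l0 equal ortho.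
  have -> : dot (grad phi x) (grad phi x) = (dot (grad phi x) v ^+ 2 + dot (grad phi x) w ^+ 2) / l ^+ 2.
    by rewrite P mulrC mulKf// expf_neq0// gt_eqF.
  by rewrite /part; field; rewrite gt_eqF.
have cq : continuous (fun x => phi x ^+ 2) by exact: continuousXfun.
rewrite (boundary_parallelogram opp02 cq) => [|x]; last exact: sqr_ge0.
rewrite -equal.
have bT : beta * l <= T by rewrite /T /K mulrAC ler_wpM2r// ltW.
have S1 : (0 <= \int[mu]_(s in `[0%R, 1%R]) (phi (Phi (s, 0%R)) ^+ 2)%:E +
   \int[mu]_(s in `[0%R, 1%R]) (phi (Phi (s, 1%R)) ^+ 2)%:E)%E by exact: adde_ge0.
have S2 : (0 <= \int[mu]_(s in `[0%R, 1%R]) (phi (Phi (0%R, s)) ^+ 2)%:E +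
   \int[mu]_(s in `[0%R, 1%R]) (phi (Phi (1%R, s)) ^+ 2)%:E)%E by exact: adde_ge0.
rewrite ge0_muleDr; last 2 first.
- by rewrite mule_ge0// lee_fin ltW.
- by rewrite mule_ge0// lee_fin ltW.
rewrite !muleA -!EFinM [leLHS]addeC; apply: leeD.
  by apply: (le_trans _ (bound1 k0)); apply: lee_wpmul2r; rewrite ?lee_fin.
by apply: (le_trans _ (bound2 k0)); apply: lee_wpmul2r; rewrite ?lee_fin.
Qed.

End SquareLowerBound.

Section IntegralCombination.
Context {R : realType}.
Local Notation mu := (@lebesgue_measure R).

Lemma ge0_integral_comb d (T : measurableType d) (m : {measure set T -> \bar R})
    (A : set T) (f g h : T -> R) (a b : R) : measurable A ->
  measurable_fun A f -> measurable_fun A g -> measurable_fun A h ->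
  0 <= a -> 0 <= b ->
  (forall x, A x -> 0 <= f x) -> (forall x, 0 <= g x) -> (forall x, 0 <= h x) ->
  (forall x, A x -> f x <= a * g x + b * h x) ->
  (\int[m]_(x in A) (f x)%:E <=
   a%:E * \int[m]_(x in A) (g x)%:E + b%:E * \int[m]_(x in A) (h x)%:E)%E.
Proof.
move=> mA mf mg mh a0 b0 f0 g0 h0 fgh.
have mag : measurable_fun A (fun x => (a * g x)%:E).
  by apply/measurable_EFinP; exact: measurable_funM.
have mbh : measurable_fun A (fun x => (b * h x)%:E).
  by apply/measurable_EFinP; exact: measurable_funM.
have scale (c : R) (q : T -> R) : 0 <= c -> measurable_fun A q -> (forall x, 0 <= q x) ->
    (c%:E * \int[m]_(x in A) (q x)%:E = \int[m]_(x in A) (c * q x)%:E)%E.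
  move=> c0 mq q0; under [RHS]eq_integral do rewrite EFinM.
  rewrite ge0_integralZl//; first exact/measurable_EFinP.
  by move=> x _; rewrite lee_fin.
rewrite !scale// -ge0_integralD//; last 2 first.
- by move=> x _; rewrite lee_fin mulr_ge0.
- by move=> x _; rewrite lee_fin mulr_ge0.
apply: ge0_le_integral => //.
- exact/measurable_EFinP.
- exact: emeasurable_funD.
Qed.

Lemma young_sqr (e x y : R) : 0 < e ->
  x ^+ 2 <= (1 + e) * y ^+ 2 + (1 + e^-1) * (y - x) ^+ 2.
Proof.
move=> e0; rewrite -subr_ge0.
have -> : (1 + e) * y ^+ 2 + (1 + e^-1) * (y - x) ^+ 2 - x ^+ 2 =
  (e * y + (y - x)) ^+ 2 / e by field; rewrite gt_eqF.
by rewrite divr_ge0 ?sqr_ge0// ltW.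
Qed.

Lemma young_sqrB (x y e : R) : 0 < e ->
  x ^+ 2 <= (1 + e) * y ^+ 2 + (1 + e^-1) * (x - y) ^+ 2.
Proof. by move=> e0; rewrite -[(x - y) ^+ 2]sqrrN opprB young_sqr. Qed.

Lemma young_dot (a b : R * R) (e : R) : 0 < e ->
  dot a a <= (1 + e) * dot b b + (1 + e^-1) * dot (a - b) (a - b).
Proof.
move=> e0; have := young_sqrB a.1 b.1 e0; have := young_sqrB a.2 b.2 e0.
by rewrite /dot -!expr2 /=; move: (e^-1) => E; lra.
Qed.

Lemma ereal_cvg0_small (a : nat -> \bar R) (eta : R) : 0 < eta ->
  a @ \oo --> 0%E -> \forall n \near \oo, (a n < eta%:E)%E.
Proof.
move=> eta0 a0; apply: (a0 [set y | (y < eta%:E)%E]).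
by apply: open_nbhs_nbhs; split; [exact: open_ereal_lt_ereal|rewrite /= lte_fin].
Qed.

End IntegralCombination.

Section SquareEigenvalue.
Context {R : realType}.
Local Notation mu := (@lebesgue_measure R).
Variables (p : 'I_4 -> R * R).
Local Notation D := (interior_region p).

Let mD : measurable D. Proof. exact: measurable_interior. Qed.

Lemma boundary_integral_comb (f g h : R * R -> R) (a b : R) :
  (forall j, measurable_fun (`[0, 1] : set R) (f \o side_pt p j)) ->
  (forall j, measurable_fun (`[0, 1] : set R) (g \o side_pt p j)) ->
  (forall j, measurable_fun (`[0, 1] : set R) (h \o side_pt p j)) ->
  0 <= a -> 0 <= b ->
  (forall x, 0 <= f x) -> (forall x, 0 <= g x) -> (forall x, 0 <= h x) ->
  (forall x, f x <= a * g x + b * h x) ->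
  (boundary_integral p f <=
   a%:E * boundary_integral p g + b%:E * boundary_integral p h)%E.
Proof.
move=> mf mg mh a0 b0 f0 g0 h0 fgh; rewrite /boundary_integral.
have i0 (q : R * R -> R) j : (forall x, 0 <= q x) ->
    (0 <= \int[mu]_(s in `[0%R, 1%R]) (q (side_pt p j s))%:E)%E.
  by move=> q0; apply: integral_ge0 => s _; rewrite lee_fin.
have si0 (q : R * R -> R) j : (forall x, 0 <= q x) ->
    (0 <= (enorm (side p j))%:E * \int[mu]_(s in `[0%R, 1%R]) (q (side_pt p j s))%:E)%E.
  by move=> q0; apply: mule_ge0; [rewrite lee_fin enorm_ge0|exact: i0].
rewrite !ge0_sume_distrr; [|by move=> j _; exact: si0..].
rewrite -big_split/=; apply: lee_sum => j _.
rewrite !(muleCA _ (enorm _)%:E) -ge0_muleDr; last 2 first.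
- by apply: mule_ge0; [rewrite lee_fin|exact: i0].
- by apply: mule_ge0; [rewrite lee_fin|exact: i0].
apply: lee_wpmul2l; first by rewrite lee_fin enorm_ge0.
have H := @ge0_integral_comb _ _ _ mu `[0%R, 1%R]%classic (f \o side_pt p j)
  (g \o side_pt p j) (h \o side_pt p j) a b (measurable_itv _) (mf j) (mg j) (mh j) a0 b0.
exact: (H (fun s _ => f0 _) (fun s => g0 _) (fun s => h0 _) (fun s _ => fgh _)).
Qed.

Let measurable_fun_sqr (f : R * R -> R) : measurable_fun D f ->
  measurable_fun D (fun x => f x ^+ 2).
Proof. by move=> mf; exact: (measurable_funX 2 mf). Qed.

Variable i : 'I_4.
Local Notation v := (side p i).
Local Notation w := (side p (ordS i)).
Hypothesis opp02 : side p (ordS (ordS i)) = - v.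
Hypothesis vw : det2 v w != 0.
Hypothesis ortho : dot v w = 0.
Hypothesis equal : enorm v = enorm w.

(** [square_robin] passes to the limit along the approximations that define the
    trace: by Young's inequality the three error integrals enter with a factor
    that does not depend on the approximation. *)
Lemma square_robin_H1 (k beta : R) u g t : 0 <= k -> 0 <= beta ->
  beta <= k * tanh (k * enorm v / 2) ->
  H1 D u g -> trace_of p u g t ->
  beta * fine (boundary_integral p (fun x => t x ^+ 2)) <=
  fine (\int[area]_(x in D) (dot (g x) (g x))%:E) +
  2 * k ^+ 2 * fine (\int[area]_(x in D) (u x ^+ 2)%:E).
Proof.
move=> k0 b0 bk [[mu1 iu] [mg1 ig1] [mg2 ig2] _] [Lt [phi [C1 ca cb cc]]].
have kk0 : 0 <= 2 * k ^+ 2 by rewrite mulr_ge0// sqr_ge0.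
have fU : (\int[area]_(x in D) (u x ^+ 2)%:E)%E \is a fin_num.
  exact: (@integrable_fin_num _ _ R area D mD _ iu).
have mg : measurable_fun D (fun x => dot (g x) (g x)).
  by apply: measurable_funD; exact: measurable_funM.
have fG : (\int[area]_(x in D) (dot (g x) (g x))%:E)%E \is a fin_num.
  have := @integrable_fin_num _ _ R area D mD _ (@integrableD _ _ R area D mD _ _ ig1 ig2).
  by congr (_ \is a fin_num); apply: eq_integral => x _; rewrite /dot !expr2 EFinD.
have fS : boundary_integral p (fun x => t x ^+ 2) \is a fin_num.
  apply/sum_fin_numP => j _ _; apply: fin_numM => //.
  by have [_ it] := Lt j; exact: (integrable_fin_num _ it).
set U := (\int[area]_(x in D) (u x ^+ 2)%:E)%E in fU *.
set G := (\int[area]_(x in D) (dot (g x) (g x))%:E)%E in fG *.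
set S := boundary_integral p (fun x => t x ^+ 2) in fS *.
have U0 : (0 <= U)%E by apply: integral_ge0 => x _; rewrite lee_fin sqr_ge0.
have G0 : (0 <= G)%E by apply: integral_ge0 => x _; rewrite lee_fin dot_ge0.
have key (e eta : R) : 0 < e -> 0 < eta ->
    beta * fine S <= (1 + e) ^+ 2 * (fine G + 2 * k ^+ 2 * fine U) +
      eta * (beta * (1 + e^-1) + (1 + e) * (1 + e^-1) * (1 + 2 * k ^+ 2)).
  move=> e0 eta0.
  have e1 : 0 <= 1 + e by rewrite addr_ge0// ltW.
  have ei : 0 <= 1 + e^-1 by rewrite addr_ge0// invr_ge0 ltW.
  have na := ereal_cvg0_small eta0 ca; have nb := ereal_cvg0_small eta0 cb.
  have nc := ereal_cvg0_small eta0 cc.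
  have [n [[an bn] cn]] := filter_ex (filterI (filterI na nb) nc).
  have [cphi _ cp1 cp2] := C1 n.
  have mphi : measurable_fun D (phi n).
    by apply: measurable_funTS; exact: continuous_measurable_plane.
  have mp1 : measurable_fun D (fun x => (grad (phi n) x).1).
    exact: (measurable_funTS (continuous_measurable_plane cp1)).
  have mp2 : measurable_fun D (fun x => (grad (phi n) x).2).
    exact: (measurable_funTS (continuous_measurable_plane cp2)).
  pose d x := grad (phi n) x - g x.
  have md : measurable_fun D (fun x => dot (d x) (d x)).
    have md1 := measurable_funB mp1 mg1; have md2 := measurable_funB mp2 mg2.
    exact: (measurable_funD (measurable_funM md1 md1) (measurable_funM md2 md2)).
  have ma : measurable_fun D (fun x => (phi n x - u x) ^+ 2).
    by apply: measurable_fun_sqr; exact: measurable_funB.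
  have mbd j : measurable_fun (`[0, 1] : set R) (phi n \o side_pt p j).
    apply: measurable_funTS; apply: continuous_measurable_fun.
    exact: continuous_side_pt.
  have bS : (S <= (1 + e)%:E * boundary_integral p (fun x => (phi n x ^+ 2)%R) +
      (1 + e^-1)%:E * boundary_integral p (fun x => ((phi n x - t x) ^+ 2)%R))%E.
    apply: boundary_integral_comb => //.
    - by move=> j; have [mt _] := Lt j; exact: (measurable_funX 2 mt).
    - by move=> j; exact: (measurable_funX 2 (mbd j)).
    - move=> j; have [mt _] := Lt j.
      exact: (measurable_funX 2 (measurable_funB (mbd j) mt)).
    - by move=> x; exact: sqr_ge0.
    - by move=> x; exact: sqr_ge0.
    - by move=> x; exact: sqr_ge0.
    - by move=> x; exact: young_sqr.
  have bN := square_robin opp02 vw ortho equal (C1 n) k0 b0 bk.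
  have bN2 : (\int[area]_(x in D) (dot (grad (phi n) x) (grad (phi n) x) +
      2 * k ^+ 2 * phi n x ^+ 2)%:E <=
      (1 + e)%:E * \int[area]_(x in D) (dot (g x) (g x) + 2 * k ^+ 2 * u x ^+ 2)%:E +
      (1 + e^-1)%:E * \int[area]_(x in D) (dot (d x) (d x) +
         2 * k ^+ 2 * (phi n x - u x) ^+ 2)%:E)%E.
    apply: (@ge0_integral_comb R _ _ area D) => //.
    - apply: measurable_funD.
        exact: (measurable_funD (measurable_funM mp1 mp1) (measurable_funM mp2 mp2)).
      by apply: measurable_funM => //; exact: measurable_fun_sqr.
    - apply: measurable_funD => //; apply: measurable_funM => //.
      exact: measurable_fun_sqr.
    - by apply: measurable_funD => //; exact: measurable_funM.
    - by move=> x _; rewrite addr_ge0 ?dot_ge0// mulr_ge0// sqr_ge0.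
    - by move=> x; rewrite addr_ge0 ?dot_ge0// mulr_ge0// sqr_ge0.
    - by move=> x; rewrite addr_ge0 ?dot_ge0// mulr_ge0// sqr_ge0.
    - move=> x _; have h1 := young_dot (grad (phi n) x) (g x) e0.
      have := ler_wpM2l kk0 (young_sqrB (phi n x) (u x) e0).
      by move: h1; rewrite -/(d x); move: (e^-1) (dot (d x) (d x)) => E dd; lra.
  have bG : (\int[area]_(x in D) (dot (g x) (g x) + 2 * k ^+ 2 * u x ^+ 2)%:E <=
      1%:E * G + (2 * k ^+ 2)%:E * U)%E.
    apply: (@ge0_integral_comb R _ _ area D) => //.
    - apply: measurable_funD => //; apply: measurable_funM => //.
      exact: measurable_fun_sqr.
    - exact: measurable_fun_sqr.
    - by move=> x _; rewrite addr_ge0 ?dot_ge0// mulr_ge0// sqr_ge0.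
    - by move=> x; exact: dot_ge0.
    - by move=> x; exact: sqr_ge0.
    - by move=> x _; rewrite mul1r.
  have bd : (\int[area]_(x in D) (dot (d x) (d x) +
         2 * k ^+ 2 * (phi n x - u x) ^+ 2)%:E <= 1%:E * eta%:E + (2 * k ^+ 2)%:E * eta%:E)%E.
    apply: (@le_trans _ _ (1%:E * \int[area]_(x in D) (dot (d x) (d x))%:E +
      (2 * k ^+ 2)%:E * \int[area]_(x in D) ((phi n x - u x) ^+ 2)%:E)%E).
      apply: (@ge0_integral_comb R _ _ area D) => //.
      - by apply: measurable_funD => //; exact: measurable_funM.
      - by move=> x _; rewrite addr_ge0 ?dot_ge0// mulr_ge0// sqr_ge0.
      - by move=> x; exact: dot_ge0.
      - by move=> x; exact: sqr_ge0.
      - by move=> x _; rewrite mul1r.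
    by apply: leeD; apply: lee_wpmul2l; rewrite ?lee_fin// ltW.
  have H1 : (beta%:E * S <= beta%:E * ((1 + e)%:E * boundary_integral p (fun x => (phi n x ^+ 2)%R)
      + (1 + e^-1)%:E * eta%:E))%E.
    apply: lee_wpmul2l; rewrite ?lee_fin//; apply: le_trans bS _.
    by apply: leeD => //; apply: lee_wpmul2l; rewrite ?lee_fin// ltW.
  have fB : boundary_integral p (fun x => phi n x ^+ 2) \is a fin_num.
    by apply: boundary_integral_fin; exact: continuousXfun.
  set B := fine (boundary_integral p (fun x => phi n x ^+ 2)).
  have H3 : beta * fine S <= beta * ((1 + e) * B + (1 + e^-1) * eta).
    by rewrite -lee_fin EFinM (fineK fS) EFinM EFinD !EFinM (fineK fB).
  have H2 : ((beta * B)%:E <= (1 + e)%:E * (1%:E * (fine G)%:E + (2 * k ^+ 2)%:E * (fine U)%:E)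
      + (1 + e^-1)%:E * (1%:E * eta%:E + (2 * k ^+ 2)%:E * eta%:E))%E.
    rewrite EFinM (fineK fB); apply: le_trans bN _; apply: le_trans bN2 _.
    rewrite (fineK fG) (fineK fU).
    by apply: leeD; apply: lee_wpmul2l; rewrite ?lee_fin.
  have H4 : beta * B <= (1 + e) * (1 * fine G + 2 * k ^+ 2 * fine U) +
      (1 + e^-1) * (1 * eta + 2 * k ^+ 2 * eta) by rewrite -lee_fin; exact: H2.
  apply: le_trans H3 _.
  have := ler_wpM2l e1 H4; clearbody B.
  rewrite !mul1r; set Q := fine G + _; set E := 1 + e^-1 in ei *; set k2 := 2 * k ^+ 2.
  by lra.
have Q0 : 0 <= fine G + 2 * k ^+ 2 * fine U.
  by rewrite addr_ge0 ?fine_ge0// mulr_ge0// fine_ge0.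
move: key; set Q := fine G + 2 * k ^+ 2 * fine U in Q0 *; set X := beta * fine S => key.
have key2 e : 0 < e -> X <= (1 + e) ^+ 2 * Q.
  move=> e0; apply/ler_addgt0Pr => eta eta0.
  set C := beta * (1 + e^-1) + (1 + e) * (1 + e^-1) * (1 + 2 * k ^+ 2) in key *.
  have C0 : 0 < C.
    rewrite /C ltr_wpDl//; first by rewrite mulr_ge0// addr_ge0// invr_ge0 ltW.
    by rewrite !mulr_gt0// ?ltr_pwDl// ?invr_ge0 ltW.
  have := key e (eta / C) e0 (divr_gt0 eta0 C0).
  by rewrite -/C divfK// gt_eqF.
apply/ler_addgt0Pr => eta eta0.
(* For [e <= 1], [(1 + e) ^+ 2 - 1 <= 3 * e]. *)
pose e := Num.min 1 (eta / (3 * (Q + 1))).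
have Q1 : 0 < 3 * (Q + 1) by rewrite mulr_gt0// ltr_wpDl.
have e0 : 0 < e by rewrite lt_min ltr01 divr_gt0.
have e1 : e <= 1 by rewrite ge_min lexx.
have eQ : e * (3 * (Q + 1)) <= eta.
  by rewrite -ler_pdivlMr// ge_min lexx orbT.
apply: le_trans (key2 e e0) _.
have : 0 <= e * (1 - e) by rewrite mulr_ge0 ?subr_ge0// ltW.
have := mulr_ge0 (ltW e0) Q0; clearbody e Q; nra.
Qed.

(** Each of the two directions contributes [k ^+ 2], as in the one-dimensional
    problem on a side. *)
Lemma lambda1_square_ge (k beta : R) : 0 <= k -> 0 <= beta ->
  beta <= k * tanh (k * enorm v / 2) ->
  ((- (2 * k ^+ 2))%:E <= lambda1 p (- beta))%E.
Proof.
move=> k0 b0 bk; apply: le_ereal_inf_tmp => _ [u [g [t [Hu Tt _ ->]]]].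
have := square_robin_H1 k0 b0 bk Hu Tt; rewrite lee_fin /rayleigh /Rintegral.
set U := fine (\int[area]_(x in D) (u x ^+ 2)%:E)%E.
set G := fine _; set S := fine _ => key.
have U0 : 0 <= U by apply: fine_ge0; apply: integral_ge0 => x _; rewrite lee_fin sqr_ge0.
move: U0; rewrite le_eqVlt => /orP[/eqP <-|U0].
  by rewrite invr0 mulr0 oppr_le0 mulr_ge0// sqr_ge0.
by rewrite ler_pdivlMr//; clearbody U G S; lra.
Qed.

End SquareEigenvalue.

(** * Exponential trial functions at a corner *)

Section ExponentialTrial.
Context {R : realType}.
Local Notation mu := (@lebesgue_measure R).

Lemma integral_exp_ray (c : R) : 0 < c ->
  (\int[mu]_(s in `[0%R, +oo[) (expR (- (c * s)))%:E = (c^-1)%:E)%E.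
Proof.
move=> c0.
have dF (x : R) : is_derive x 1 (fun s => - c^-1 * expR (- (c * s))) (expR (- (c * x))).
  apply: is_derive_eq; rewrite /GRing.scale/=; field; exact: lt0r_neq0.
have cE : continuous (fun s : R => expR (- (c * s))).
  apply: (continuous_composition (f := fun s : R => - (c * s)) _ (@continuous_expR R)).
  by apply: continuousNfun; apply: continuousMfun; [exact: cst_continuous|move=> ?; exact: cvg_id].
have cF := derive_continuous dF.
rewrite (@ge0_continuous_FTC2y R _ (fun s => - c^-1 * expR (- (c * s))) 0 0).
- by rewrite mulr0 oppr0 expR0 mulr1 -EFinB sub0r opprK.
- by move=> x _; exact: expR_ge0.
- exact: continuous_subspaceT.
- rewrite -[X in _ --> X](mulr0 (- c^-1)); apply: cvgM; first exact: cvg_cst.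
  apply: (@cvg_comp _ _ _ (fun s : R => c * s) (fun y : R => expR (- y)) _ _ _ _ (@cvgr_expR R)).
  exact: gt0_cvgMry.
- by move=> x _; case: (dF x).
- exact/cvg_at_right_filter/cF.
- by move=> x _; rewrite derive1E; apply: derive_val.
Qed.

Lemma integral_exp_unit (c : R) : c != 0 ->
  (\int[mu]_(s in `[0%R, 1%R]) (expR (- (c * s)))%:E = ((1 - expR (- c)) / c)%:E)%E.
Proof.
move=> c0.
have dF (x : R) : is_derive x 1 (fun s => - c^-1 * expR (- (c * s))) (expR (- (c * x))).
  apply: is_derive_eq; rewrite /GRing.scale/=; field; exact: c0.
have cE : continuous (fun s : R => expR (- (c * s))).
  apply: (continuous_composition (f := fun s : R => - (c * s)) _ (@continuous_expR R)).
  by apply: continuousNfun; apply: continuousMfun; [exact: cst_continuous|move=> ?; exact: cvg_id].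
rewrite (FTC2_everywhere ler01 dF cE) mulr0 oppr0 expR0 !mulr1; congr EFin.
by field; exact: c0.
Qed.

Variables (p : 'I_4 -> R * R) (i : 'I_4) (W : R * R).
Local Notation D := (interior_region p).

Definition exp_trial (x : R * R) : R := expR (- dot W (x - p i)).

Lemma exp_trial_C1 : classC 1 exp_trial /\
  grad exp_trial = fun x => (- W.1 * exp_trial x, - W.2 * exp_trial x).
Proof.
have cd : continuous (fun x : R * R => - dot W (x - p i)).
  apply: continuousNfun; apply: continuousDfun; apply: continuousMfun; try exact: cst_continuous.
    by apply: continuousDfun; [exact: continuous_fst|exact: cst_continuous].
  by apply: continuousDfun; [exact: continuous_snd|exact: cst_continuous].
have cu : continuous exp_trial by exact: (continuous_composition cd (@continuous_expR R)).
apply: classC1_grad => //=.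
- by apply: continuousMfun => //; exact: cst_continuous.
- by apply: continuousMfun => //; exact: cst_continuous.
- move=> x y; rewrite /exp_trial /dot/=.
  by apply: is_derive_eq; rewrite /GRing.scale/=; ring.
- move=> x y; rewrite /exp_trial /dot/=.
  by apply: is_derive_eq; rewrite /GRing.scale/=; ring.
Qed.

Lemma exp_trial_sqr x : exp_trial x ^+ 2 = expR (- (2 * dot W (x - p i))).
Proof. by rewrite /exp_trial expr2 -expRD; congr expR; ring. Qed.

(** In the coordinates of the cone the trial function is a product, so that the
    integral over the whole cone is explicit. *)
Lemma integral_exp_cone (a b : R * R) : det2 a b != 0 ->
  0 < dot W a -> 0 < dot W b ->
  (forall z, D (frame (p i) a b z) -> 0 <= z.1 /\ 0 <= z.2) ->
  (\int[area]_(x in D) (exp_trial x ^+ 2)%:E <=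
   (`|det2 a b| / (4 * dot W a * dot W b))%:E)%E.
Proof.
move=> ab Wa Wb cone; have [[cu _ _ _] _] := exp_trial_C1.
have mD := measurable_interior p.
have mq : measurable_fun setT (fun x => (exp_trial x ^+ 2)%:E).
  apply/measurable_EFinP; apply: continuous_measurable_plane; exact: continuousXfun.
rewrite integral_mkcond (ge0_integral_frame (p i) ab); first last.
- by move=> z; rewrite /patch; case: ifP => // _; rewrite lee_fin sqr_ge0.
- by apply/(measurable_restrictT _ _).1 => //; exact: measurable_funTS.
rewrite EFinM; apply: lee_wpmul2l => //.
pose E (c : R) := (fun s => (expR (- (2 * c * s)))%:E) \_ `[0%R, +oo[.
have mE c : measurable_fun setT (E c).
  apply/(measurable_restrictT _ _).1; first exact: measurable_itv.
  apply/measurable_EFinP; apply: measurable_funTS; apply: continuous_measurable_fun.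
  apply: (continuous_composition (f := fun s : R => - (2 * c * s)) _ (@continuous_expR R)).
  by apply: continuousNfun; apply: continuousMfun; [exact: cst_continuous|move=> ?; exact: cvg_id].
have E0 c s : (0 <= E c s)%E.
  by rewrite /E /patch; case: ifP => // _; rewrite lee_fin expR_ge0.
have EE c s : 0 <= s -> E c s = (expR (- (2 * c * s)))%:E.
  by move=> s0; rewrite /E /patch mem_set//= in_itv/= s0.
have intE c : 0 < c -> (\int[mu]_s E c s = ((2 * c)^-1)%:E)%E.
  by move=> c0; rewrite -integral_mkcond integral_exp_ray// mulr_gt0.
pose F (z : R * R) : \bar R := (E (dot W a) z.1 * E (dot W b) z.2)%E.
have mF : measurable_fun setT F.
  by apply: emeasurable_funM; [exact: (measurableT_comp (mE _))|exact: (measurableT_comp (mE _))].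
have F0 z : (0 <= F z)%E by exact: mule_ge0.
apply: (@le_trans _ _ (\int[area]_z F z)%E).
  apply: ge0_le_integral => //.
  - by move=> z _; rewrite /patch; case: ifP => // _; rewrite lee_fin sqr_ge0.
  - apply: (measurable_comp_frame (p i) a b).
    by apply/(measurable_restrictT _ _).1 => //; exact: measurable_funTS.
  - move=> z _; rewrite [leLHS]/patch; case: ifPn => [/set_mem/cone[z1 z2]|_]; last exact: F0.
    rewrite exp_trial_sqr /F !EE// -EFinM -expRD lee_fin.
    by rewrite le_eqVlt; apply/orP; left; apply/eqP; congr expR; rewrite /dot/frame/=; ring.
rewrite integral_area21//.
have -> : (\int[mu]_y \int[mu]_x F (x, y) =
    \int[mu]_y (((2 * dot W a)^-1)%:E * E (dot W b) y))%E.
  apply: eq_integral => y _; rewrite /F/=.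
  rewrite -(intE _ Wa) muleC.
  rewrite -ge0_integralZl; [|exact: measurableT|exact: mE|by move=> ? _; exact: E0|exact: E0].
  by apply: eq_integral => x _; rewrite muleC.
rewrite ge0_integralZl; [|exact: measurableT|exact: mE|by move=> ? _; exact: E0|
  by rewrite lee_fin invr_ge0 ltW// mulr_gt0].
have -> : (\int[mu]_y E (dot W b) y = ((2 * dot W b)^-1)%:E)%E by exact: intE.
rewrite -EFinM lee_fin -invfM.
by rewrite le_eqVlt; apply/orP; left; apply/eqP; congr (_^-1); ring.
Qed.

(** Keeping only the two sides at [p i] gives a lower bound; the trial function
    decays away from this vertex. *)
Lemma boundary_exp_trial : let V := side p i in let V' := - side p (ordS (ordS (ordS i))) in
  0 < dot W V -> 0 < dot W V' ->
  ((enorm V * ((1 - expR (- (2 * dot W V))) / (2 * dot W V)) +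
    enorm V' * ((1 - expR (- (2 * dot W V'))) / (2 * dot W V')))%:E <=
   boundary_integral p (fun x => (exp_trial x ^+ 2)%R))%E.
Proof.
move=> V V' f1 f2; have [[cu _ _ _] _] := exp_trial_C1.
have s0 j : (0 <= (enorm (side p j))%:E *
    \int[mu]_(s in `[0%R, 1%R]) (exp_trial (side_pt p j s) ^+ 2)%:E)%E.
  apply: mule_ge0; first by rewrite lee_fin enorm_ge0.
  by apply: integral_ge0 => s _; rewrite lee_fin sqr_ge0.
rewrite /boundary_integral (big_ord4 _ i)/=.
have -> : (\int[mu]_(s in `[0%R, 1%R]) (exp_trial (side_pt p i s) ^+ 2)%:E =
    ((1 - expR (- (2 * dot W V))) / (2 * dot W V))%:E)%E.
  rewrite -integral_exp_unit ?gt_eqF ?mulr_gt0//; apply: eq_integral => s _.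
  by rewrite exp_trial_sqr; congr (expR _)%:E; rewrite /dot /V /side_pt/=; ring.
have -> : (\int[mu]_(s in `[0%R, 1%R]) (exp_trial (side_pt p (ordS (ordS (ordS i))) s) ^+ 2)%:E =
    ((1 - expR (- (2 * dot W V'))) / (2 * dot W V'))%:E)%E.
  rewrite -reflect_unit; last first.
    by apply: continuousXfun; exact: continuous_side_pt.
  rewrite -integral_exp_unit ?gt_eqF ?mulr_gt0//; apply: eq_integral => s _.
  rewrite exp_trial_sqr; congr (expR _)%:E; rewrite /dot /V' /side_pt /side ordS4/=; ring.
rewrite EFinD; apply: leeD; first by rewrite EFinM.
rewrite -[leLHS]add0e; apply: leeD; first exact: s0.
by rewrite -[leLHS]add0e; apply: leeD; [exact: s0|rewrite /V' enormN EFinM].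
Qed.

Lemma lambda1_le_exp (a b : R * R) (beta kappa : R) :
  let V := side p i in let V' := - side p (ordS (ordS (ordS i))) in
  det2 a b != 0 -> 0 < dot W a -> 0 < dot W b ->
  (forall z, D (frame (p i) a b z) -> 0 <= z.1 /\ 0 <= z.2) ->
  0 < dot W V -> 0 < dot W V' -> (0 < area D)%E -> 0 <= kappa -> 0 <= beta ->
  (dot W W + kappa) * (`|det2 a b| / (4 * dot W a * dot W b)) <=
    beta * (enorm V * ((1 - expR (- (2 * dot W V))) / (2 * dot W V)) +
    enorm V' * ((1 - expR (- (2 * dot W V'))) / (2 * dot W V'))) ->
  (lambda1 p (- beta) <= (- kappa)%:E)%E.
Proof.
move=> V V' ab Wa Wb cone f1 f2 D0 k0 b0 ineq.
have [C1u gE] := exp_trial_C1; have [cu _ _ _] := C1u.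
have N0 : 0 <= dot W W + kappa by rewrite addr_ge0// dot_ge0.
apply: (lambda1_le_trial C1u) => //; first by move=> x; exact: expR_gt0.
have -> : (\int[area]_(x in D) (dot (grad exp_trial x) (grad exp_trial x) + kappa * exp_trial x ^+ 2)%:E
   = (dot W W + kappa)%:E * \int[area]_(x in D) (exp_trial x ^+ 2)%:E)%E.
  rewrite -ge0_integralZl//.
  - apply: eq_integral => x _; rewrite -EFinM gE; congr EFin; rewrite /dot/=; ring.
  - exact: measurable_interior.
  - apply/measurable_EFinP; apply: measurable_funTS; apply: continuous_measurable_plane.
    exact: continuousXfun.
  - by move=> x _; rewrite lee_fin sqr_ge0.
apply: (@le_trans _ _ ((dot W W + kappa)%:E * (`|det2 a b| / (4 * dot W a * dot W b))%:E)%E).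
  by apply: lee_wpmul2l; [rewrite lee_fin|exact: integral_exp_cone].
apply: (@le_trans _ _ (beta%:E * (enorm V * ((1 - expR (- (2 * dot W V))) / (2 * dot W V)) +
    enorm V' * ((1 - expR (- (2 * dot W V'))) / (2 * dot W V')))%:E)%E).
  by rewrite -!EFinM lee_fin.
by apply: lee_wpmul2l; [rewrite lee_fin|exact: boundary_exp_trial].
Qed.

End ExponentialTrial.

Section SharpCorner.
Context {R : realType}.

(** On the sector of angle [omega] spanned by the unit vectors [e1] and [e2],
    the function [expR (- dot w x)] is the ground state of the problem of
    coupling 1 when [w] points along the bisector with norm
    [1 / sin (omega / 2)]; the eigenvalue is [- dot w w]. *)
Lemma sector_exponent (e1 e2 : R * R) : dot e1 e1 = 1 -> dot e2 e2 = 1 ->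
  det2 e1 e2 != 0 -> exists w c, [/\ dot w e1 = c /\ dot w e2 = c, 0 < c,
    c ^+ 2 = dot w w - 1, `|det2 e1 e2| * dot w w = 2 * c &
    dot w w * (1 - dot e1 e2) = 2].
Proof.
move=> n1 n2 d0; set C := dot e1 e2; set d := `|det2 e1 e2|.
have dp : 0 < d by rewrite normr_gt0.
have dn : d != 0 by rewrite gt_eqF.
have dC : d ^+ 2 = (1 - C) * (1 + C).
  have := lagrange e1 e2; rewrite exprMn !enorm_sqr n1 n2 mul1r -/C => E.
  by rewrite real_normK ?num_real//; lra.
have C1 : 0 < (1 - C) * (1 + C) by rewrite -dC exprn_gt0.
have Cp : 0 < 1 + C by nra.
have Cm : 0 < 1 - C by nra.
exists ((e1.1 + e2.1) / d, (e1.2 + e2.2) / d), ((1 + C) / d).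
have ww : dot ((e1.1 + e2.1) / d, (e1.2 + e2.2) / d)
    ((e1.1 + e2.1) / d, (e1.2 + e2.2) / d) = 2 * (1 + C) / d ^+ 2.
  have -> : 2 * (1 + C) = dot e1 e1 + dot e2 e2 + 2 * C by rewrite n1 n2; ring.
  by rewrite /C /dot/=; field.
have ww' : 2 * (1 + C) / d ^+ 2 = 2 / (1 - C).
  by rewrite dC; field; rewrite !gt_eqF.
split; rewrite ?ww.
- split; [rewrite -[X in X + C]n1|rewrite -[X in X + C]n2]; rewrite /C /dot/=; field; exact: dn.
- by rewrite divr_gt0.
- rewrite ww' expr_div_n dC; field; rewrite !gt_eqF//.
- by field.
- by rewrite ww'; field; rewrite gt_eqF.
Qed.

Variable p : 'I_4 -> R * R.
Local Notation D := (interior_region p).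

(** At strong coupling the first eigenvalue is below that of every square, where
    the quotient by [- beta ^+ 2] tends to 2. *)
Definition steep := exists eta B : R, [/\ 0 < eta, 0 < B &
  forall beta, B <= beta -> (lambda1 p (- beta) <= (- ((2 + eta) * beta ^+ 2))%:E)%E].

Lemma expRN_small (f theta : R) : 0 < f -> 0 < theta ->
  forall beta, (2 * f * theta)^-1 <= beta -> expR (- (2 * (beta * f))) <= theta.
Proof.
move=> f0 t0 beta hb.
have b0 : 0 < beta by apply: lt_le_trans hb; rewrite invr_gt0 !mulr_gt0.
have x0 : 0 < 2 * (beta * f) by rewrite !mulr_gt0.
rewrite expRN; apply: (@le_trans _ _ (2 * (beta * f))^-1).
  rewrite lef_pV2 ?posrE ?expR_gt0//.
  by have := expR_ge1Dx (2 * (beta * f)); lra.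
rewrite -[theta]invrK lef_pV2 ?posrE ?invr_gt0//.
have ft0 : 0 < 2 * f * theta by rewrite !mulr_gt0.
by have := ler_wpM2l (ltW ft0) hb; rewrite mulfV ?gt_eqF// => h;
  rewrite -(ler_pM2r t0) mulVf ?gt_eqF//; lra.
Qed.

(** The trial function is [expR (- beta * dot w x)] with the origin at [p i]. Up
    to exponentially small terms its square has integral [enorm V / (2 * beta *
    dot w V)] over the side [V], hence at least [1 / (2 * beta * M)]; the gap
    hypothesis says that at the level [2 * beta ^+ 2] this beats the integral
    over the sector. *)
Lemma steep_corner i (e1 e2 w : R * R) (c M : R) :
  let V := side p i in let V' := - side p (ordS (ordS (ordS i))) in
  dot w e1 = c -> dot w e2 = c -> 0 < c -> det2 e1 e2 != 0 ->
  (forall z, D (frame (p i) e1 e2 z) -> 0 <= z.1 /\ 0 <= z.2) ->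
  0 < M -> 0 < dot w V <= M * enorm V -> 0 < dot w V' <= M * enorm V' ->
  (dot w w + 2) * `|det2 e1 e2| / (4 * c ^+ 2) < M^-1 ->
  (0 < area D)%E -> steep.
Proof.
move=> V V' we1 we2 c0 d0 cone M0 /andP[f1 f1M] /andP[f2 f2M] gap D0.
set d := `|det2 e1 e2| in gap *.
have dp : 0 < d by rewrite normr_gt0.
set g := M^-1 - (dot w w + 2) * d / (4 * c ^+ 2).
have g0 : 0 < g by rewrite subr_gt0.
(* Half of the gap [g] pays for the excess [eta], the other half for the
   exponentially small terms. *)
pose eta := 2 * g * c ^+ 2 / d; pose theta := g * M / 2.
have theta1 : theta <= 1.
  have gM : g <= M^-1.
    rewrite gerBl; apply: divr_ge0; last by rewrite mulr_ge0// sqr_ge0.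
    by apply: mulr_ge0; [rewrite addr_ge0// dot_ge0|exact: ltW].
  have := ler_wpM2r (ltW M0) gM; rewrite mulVf ?gt_eqF// /theta; lra.
have c20 : 0 < c ^+ 2 by rewrite exprn_gt0.
have eta0 : 0 < eta by rewrite divr_gt0// !mulr_gt0.
have theta0 : 0 < theta by rewrite divr_gt0// mulr_gt0.
pose B1 := (2 * dot w V * theta)^-1; pose B2 := (2 * dot w V' * theta)^-1.
have B10 : 0 < B1 by rewrite invr_gt0 !mulr_gt0.
have B20 : 0 < B2 by rewrite invr_gt0 !mulr_gt0.
exists eta, (B1 + B2); split => //; first exact: addr_gt0.
move=> beta hb.
have b0 : 0 < beta by apply: lt_le_trans hb; exact: addr_gt0.
have x1 := expRN_small f1 theta0 (le_trans (_ : B1 <= B1 + B2) hb).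
have x2 := expRN_small f2 theta0 (le_trans (_ : B2 <= B1 + B2) hb).
rewrite lerDl ltW// in x1; rewrite lerDr ltW// in x2.
move: (x1 isT) (x2 isT) => {}x1 {}x2.
pose W : R * R := (beta * w.1, beta * w.2).
have WE a : dot W a = beta * dot w a by rewrite /W /dot/=; ring.
apply: (@lambda1_le_exp R p i W e1 e2) => //; rewrite -/V -/V' ?WE ?we1 ?we2 ?mulr_gt0//.
- by rewrite mulr_ge0 ?sqr_ge0// addr_ge0// ltW.
- exact: ltW.
have WW : dot w W = beta * dot w w by rewrite /W /dot/=; ring.
have edge (U : R * R) : 0 < dot w U -> dot w U <= M * enorm U ->
    expR (- (2 * (beta * dot w U))) <= theta ->
    (1 - theta) / (2 * M) <= beta * (enorm U * ((1 - expR (- (2 * (beta * dot w U)))) /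
      (2 * (beta * dot w U)))).
  move=> u0 uM ut.
  have -> : beta * (enorm U * ((1 - expR (- (2 * (beta * dot w U)))) / (2 * (beta * dot w U)))) =
      (1 - expR (- (2 * (beta * dot w U)))) * (enorm U / (2 * dot w U)).
    by field; rewrite !gt_eqF.
  apply: ler_pM.
  - by rewrite subr_ge0.
  - by rewrite invr_ge0 mulr_ge0// ltW.
  - by rewrite lerB.
  - rewrite -[leLHS]mul1r ler_pdivrMr ?mulr_gt0// mulrAC ler_pdivlMr ?mulr_gt0//.
    by lra.
have E1 := edge _ f1 f1M x1; have E2 := edge _ f2 f2M x2.
rewrite -/d.
have -> : (beta * dot w W + (2 + eta) * beta ^+ 2) * (d / (4 * (beta * c) * (beta * c))) =
    M^-1 - g / 2.
  have -> : g / 2 = eta * d / (4 * c ^+ 2) by rewrite /eta; field; rewrite !gt_eqF.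
  have -> : M^-1 = (dot w w + 2) * d / (4 * c ^+ 2) + eta * d / (2 * c ^+ 2).
    have -> : eta * d / (2 * c ^+ 2) = g by rewrite /eta; field; rewrite !gt_eqF.
    by rewrite /g subrKC.
  by rewrite WW; field; rewrite !gt_eqF.
rewrite mulrDr; apply: le_trans (lerD E1 E2).
have -> : (1 - theta) / (2 * M) + (1 - theta) / (2 * M) = M^-1 - g / 2.
  by rewrite /theta; field; rewrite gt_eqF.
by [].
Qed.

End SharpCorner.

Section SteepQuadrilaterals.
Context {R : realType}.
Implicit Types a b V : R * R.

Definition unit_vec a : R * R := (a.1 / enorm a, a.2 / enorm a).

Lemma dot_unit a b : dot (unit_vec a) (unit_vec b) = dot a b / (enorm a * enorm b).
Proof. by rewrite /dot /unit_vec/= invfM; ring. Qed.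

Lemma det2_unit a b : det2 (unit_vec a) (unit_vec b) = det2 a b / (enorm a * enorm b).
Proof. by rewrite /det2 /unit_vec/= invfM; ring. Qed.

Lemma unit_vec_unit a : 0 < enorm a -> dot (unit_vec a) (unit_vec a) = 1.
Proof. by move=> a0; rewrite dot_unit -enorm_sqr expr2 mulfV// mulf_neq0// gt_eqF. Qed.

(** Law of cosines: the angle that faces the shortest side of a triangle is at
    most 60 degrees. *)
Lemma small_angle a b : enorm (a - b) <= enorm a -> enorm (a - b) <= enorm b ->
  enorm a * enorm b <= 2 * dot a b.
Proof.
move=> ha hb; have := enorm_ge0 (a - b); have := enorm_ge0 a; have := enorm_ge0 b.
have : enorm (a - b) ^+ 2 = enorm a ^+ 2 + enorm b ^+ 2 - 2 * dot a b.
  by rewrite !enorm_sqr /dot/=; ring.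
have [|/ltW] := leP (enorm a) (enorm b); nra.
Qed.

Variable p : 'I_4 -> R * R.
Local Notation D := (interior_region p).

Section Sector.
Variables (s : R) (k : 'I_4) (a b : R * R).
Hypothesis ab : 0 < s * det2 a b.
Hypothesis sector : forall x, D x ->
  0 < s * det2 a (x - p k) /\ 0 < s * det2 (x - p k) b.
Hypothesis D0 : (0 < area D)%E.
Local Notation V := (side p k).
Local Notation V' := (- side p (ordS (ordS (ordS k)))).
Let e1 := unit_vec a.
Let e2 := unit_vec b.

Let ab0 : det2 a b != 0.
Proof. by apply: contraTneq ab => ->; rewrite mulr0 ltxx. Qed.

Let a0 : 0 < enorm a. Proof. exact: enorm_gt0 ab0. Qed.

Let b0 : 0 < enorm b.
Proof. by apply: (@enorm_gt0 _ _ a); rewrite det2C oppr_eq0. Qed.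

Let e12 : 0 < s * det2 e1 e2.
Proof. by rewrite det2_unit mulrA divr_gt0// mulr_gt0. Qed.

Let e120 : det2 e1 e2 != 0.
Proof. by apply: contraTneq e12 => ->; rewrite mulr0 ltxx. Qed.

Let cone z : D (frame (p k) e1 e2 z) -> 0 <= z.1 /\ 0 <= z.2.
Proof.
move=> /sector[h1 h2]; split; apply/ltW.
  move: h2; have -> : s * det2 (frame (p k) e1 e2 z - p k) b = z.1 * (s * det2 e1 e2 * enorm b).
    rewrite /e1 /e2 det2_unit /det2 /frame /unit_vec /=; field; rewrite !gt_eqF//.
  by rewrite pmulr_lgt0// mulr_gt0.
move: h1; have -> : s * det2 a (frame (p k) e1 e2 z - p k) = z.2 * (s * det2 e1 e2 * enorm a).
  rewrite /e1 /e2 det2_unit /det2 /frame /unit_vec /=; field; rewrite !gt_eqF//.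
by rewrite pmulr_lgt0// mulr_gt0.
Qed.

(** When the two sides at the vertex bound the sector itself, the boundary
    integral is that of the ground state of the sector up to exponentially small
    terms, and its eigenvalue [- dot w w] is below [- 2] as soon as the angle is
    acute. *)
Lemma steep_sharp : V = a -> V' = b -> 0 < dot a b -> steep p.
Proof.
move=> Va Vb dab.
have [w [c [[we1 we2] c0 cN dN NC]]] := sector_exponent (unit_vec_unit a0) (unit_vec_unit b0) e120.
have C0 : 0 < dot e1 e2 by rewrite dot_unit divr_gt0// mulr_gt0.
have wa : dot w a = c * enorm a.
  by rewrite -we1 /dot /unit_vec/=; field; rewrite gt_eqF.
have wb : dot w b = c * enorm b.
  by rewrite -we2 /dot /unit_vec/=; field; rewrite gt_eqF.
have N2 : 2 < dot w w.
  have : 0 < dot w w by rewrite -(subrK 1 (dot w w)) -cN ltr_wpDl ?sqr_ge0.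
  by rewrite -/e1 -/e2 in NC; nra.
apply: (steep_corner we1 we2 c0 e120 cone c0) => //.
- by rewrite Va wa lexx andbT mulr_gt0.
- by rewrite Vb wb lexx andbT mulr_gt0.
have -> : (dot w w + 2) * `|det2 e1 e2| / (4 * c ^+ 2) = (dot w w + 2) / (2 * dot w w) / c.
  have -> : `|det2 e1 e2| = 2 * c / dot w w by rewrite -dN mulfK// gt_eqF// (lt_trans _ N2).
  by field; rewrite !gt_eqF// (lt_trans _ N2).
rewrite -[ltRHS]mul1r ltr_pM2r ?invr_gt0// ltr_pdivrMr ?mulr_gt0// ?(lt_trans _ N2)//.
by rewrite mul1r; lra.
Qed.

(** When the sides at the vertex run inside the sector, the decay along them is
    only known to be at most [enorm w]; an angle of at most 60 degrees makes
    [dot w w >= 4], which compensates for this loss. *)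
Lemma steep_narrow :
  0 <= s * det2 a V -> 0 <= s * det2 V b -> 0 < s * det2 a V + s * det2 V b ->
  0 <= s * det2 a V' -> 0 <= s * det2 V' b -> 0 < s * det2 a V' + s * det2 V' b ->
  enorm a * enorm b <= 2 * dot a b -> steep p.
Proof.
move=> V1 V2 V3 V1' V2' V3' dab.
have [w [c [[we1 we2] c0 cN dN NC]]] := sector_exponent (unit_vec_unit a0) (unit_vec_unit b0) e120.
have C0 : 1 / 2 <= dot e1 e2.
  by rewrite dot_unit ler_pdivlMr ?mulr_gt0//; lra.
have N4 : 4 <= dot w w.
  have : 0 < dot w w by rewrite -(subrK 1 (dot w w)) -cN ltr_wpDl ?sqr_ge0.
  by rewrite -/e1 -/e2 in NC; nra.
have NE := enorm_sqr w.
have N0 : 0 < enorm w.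
  by rewrite lt_neqAle enorm_ge0 andbT eq_sym; apply: contraTneq N4 => w0; rewrite -NE w0 expr0n/= -ltNge.
have in_sector U : 0 <= s * det2 a U -> 0 <= s * det2 U b ->
    0 < s * det2 a U + s * det2 U b -> 0 < dot w U <= enorm w * enorm U.
  move=> U1 U2 U3; rewrite dot_le andbT.
  have E : (s * det2 e1 e2) * dot w U =
      c * ((s * det2 a U) / enorm a + (s * det2 U b) / enorm b).
    have -> : s * det2 a U / enorm a = s * det2 e1 U by rewrite /det2 /unit_vec/=; ring.
    have -> : s * det2 U b / enorm b = s * det2 U e2 by rewrite /det2 /unit_vec/=; ring.
    have -> : s * det2 e1 e2 * dot w U =
        dot w e2 * (s * det2 e1 U) + dot w e1 * (s * det2 U e2) by rewrite /det2 /dot; ring.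
    by rewrite /e1 /e2 we1 we2 -mulrDr.
  rewrite -(pmulr_rgt0 _ e12) E mulr_gt0//.
  have q1 : 0 <= s * det2 a U / enorm a by rewrite divr_ge0// ltW.
  have q2 : 0 <= s * det2 U b / enorm b by rewrite divr_ge0// ltW.
  rewrite lt_neqAle addr_ge0// andbT eq_sym paddr_eq0// !mulf_eq0 !invr_eq0.
  rewrite !(gt_eqF a0) !(gt_eqF b0) !orbF -!mulf_eq0; apply: contraTN U3 => /andP[/eqP -> /eqP ->].
  by rewrite addr0 ltxx.
apply: (steep_corner we1 we2 c0 e120 cone N0) => //; try exact: in_sector.
have -> : (dot w w + 2) * `|det2 e1 e2| / (4 * c ^+ 2) = (dot w w + 2) / (2 * dot w w * c).
  have -> : `|det2 e1 e2| = 2 * c / dot w w by rewrite -dN mulfK// gt_eqF// (lt_le_trans _ N4).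
  by field; rewrite !gt_eqF// (lt_le_trans _ N4).
have ww0 : 0 < dot w w by rewrite (lt_le_trans _ N4).
rewrite ltr_pdivrMr ?mulr_gt0// mulrC ltr_pdivlMr//.
have lhs0 : 0 <= (dot w w + 2) * enorm w.
  by apply: mulr_ge0; [rewrite addr_ge0// ltW|exact: enorm_ge0].
have rhs0 : 0 <= 2 * dot w w * c by apply/ltW; rewrite !mulr_gt0.
rewrite -ltr_sqr ?nnegrE// [X in X < _]exprMn NE [X in _ < X]exprMn cN.
set N := dot w w in N4 ww0 *; clearbody N.
have : 0 <= (N - 4) * N by rewrite mulr_ge0 ?subr_ge0// ltW.
by nra.
Qed.

End Sector.

(** A convex region lies in the sector of each of its angles. *)
Lemma steep_convex (s : R) : (forall j, 0 < s * turn p j) ->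
  (exists j, dot (side p j) (side p (ordS j)) < 0) -> (0 < area D)%E -> steep p.
Proof.
move=> pos [j dj] D0.
have E3 : ordS (ordS (ordS (ordS j))) = j by exact: ordS4.
apply: (@steep_sharp s (ordS j) (side p (ordS j)) (- side p j)) => //.
- by have := pos j; rewrite /turn /det2/=; lra.
- move=> x Dx; have h1 := convex_interior pos Dx (ordS j); have h2 := convex_interior pos Dx j.
  split => //; move: h2; rewrite /det2 /side/=; lra.
- by rewrite E3.
- by move: dj; rewrite /dot/=; lra.
Qed.

(** The region lies in a triangle of three vertices. At the vertex where this
    triangle has its smallest angle, both sides of the quadrilateral run in the
    closed sector of the triangle. *)
Lemma steep_reflex (s : R) i :
  [/\ 0 < s * turn p i, 0 < s * turn p (ordS i), 0 < s * turn p (ordS (ordS i)) &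
      s * turn p (ordS (ordS (ordS i))) < 0] -> (0 < area D)%E -> steep p.
Proof.
move=> hp D0; have hD := reflex_interior hp.
case: hp; rewrite /turn ordS4 => h0 h1 h2 h3.
set v1 := side p (ordS i) in h0 h1 h2 h3 hD *.
set v2 := side p (ordS (ordS i)) in h0 h1 h2 h3 hD *.
pose v3 := p (ordS i) - p (ordS (ordS (ordS i))).
have v123 : v1 + v2 + v3 = 0.
  by rewrite /v1 /v2 /v3 /side; rewrite [LHS]surjective_pairing/=; congr pair; ring.
have v3E : v3 = - (v1 + v2) by apply/eqP; rewrite -addr_eq0 addrC v123.
have [d13 d21 d32] : [/\ v1 - - v3 = - v2, v2 - - v1 = - v3 & v3 - - v2 = - v1].
  by split; rewrite [LHS]surjective_pairing [RHS]surjective_pairing /v3 /v2 /v1 /side /=;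
    congr pair; ring.
have [A|B|C] : [\/ enorm v2 <= enorm v1 /\ enorm v2 <= enorm v3,
    enorm v3 <= enorm v1 /\ enorm v3 <= enorm v2 |
    enorm v1 <= enorm v2 /\ enorm v1 <= enorm v3].
  move: (enorm v1) (enorm v2) (enorm v3) => x y z.
  case/orP: (le_total x y) => xy; case/orP: (le_total y z) => yz;
    case/orP: (le_total x z) => xz;
    by [apply: Or31; split; lra|apply: Or32; split; lra|apply: Or33; split; lra].
- have E3 : ordS (ordS (ordS (ordS i))) = i by exact: ordS4.
  apply: (@steep_narrow s (ordS i) v1 (- v3)) => //; rewrite ?E3.
  + by move: h1; rewrite v3E /det2/=; lra.
  + move=> x /hD[d1 d2 d3]; split => //; move: d3; rewrite -/v3 /det2/=; lra.
  + by rewrite /det2; lra.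
  + by move: h1; rewrite v3E -/v1 /det2/=; lra.
  + by move: h1; rewrite v3E -/v1 /det2/=; lra.
  + by move: h0; rewrite /det2/=; lra.
  + by move: h3; rewrite /v3 /det2 /side ordS4/=; lra.
  + by move: h0 h3; rewrite /v3 /v1 /det2 /side ordS4/=; lra.
  + by case: A => A1 A2; apply: small_angle; rewrite d13 !enormN.
- apply: (@steep_narrow s (ordS (ordS i)) v2 (- v1)) => //; rewrite ?ordS4.
  + by move: h1; rewrite /det2/=; lra.
  + move=> x /hD[d1 d2 d3]; split => //; move: d1; rewrite /v1 /det2 /side/=; lra.
  + by rewrite /det2; lra.
  + by move: h1; rewrite -/v2 /det2/=; lra.
  + by move: h1; rewrite -/v2 /det2/=; lra.
  + by move: h1; rewrite -/v1 /det2/=; lra.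
  + by rewrite -/v1 /det2/=; lra.
  + by move: h1; rewrite -/v1 /det2/=; lra.
  + by case: B => B1 B2; apply: small_angle; rewrite d21 !enormN.
- apply: (@steep_narrow s (ordS (ordS (ordS i))) v3 (- v2)) => //; rewrite ?ordS4.
  + by move: h1; rewrite v3E /det2/=; lra.
  + move=> x /hD[d1 d2 d3]; split.
      by move: d3; rewrite /v3 /det2/=; lra.
    by move: d2; rewrite /v2 /det2 /side/=; lra.
  + by move: h3; rewrite /v3 /det2 /side ordS4/=; lra.
  + by move: h2; rewrite /det2/=; lra.
  + by move: h2 h3; rewrite /v3 /v2 /det2 /side ordS4/=; lra.
  + by move: h1; rewrite -/v2 v3E /det2/=; lra.
  + by rewrite -/v2 /det2/=; lra.
  + by move: h1; rewrite -/v2 v3E /det2/=; lra.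
  + by case: C => C1 C2; apply: small_angle; rewrite d32 !enormN.
Qed.

End SteepQuadrilaterals.

(** * Products of hyperbolic cosines on a rectangle *)

Section HyperbolicCosine.
Context {R : realType}.
Local Notation mu := (@lebesgue_measure R).

(** The integral over the unit segment of [sinh ^+ 2 + cosh ^+ 2], along the
    profile [K * (s - 1/2)]. *)
Definition cosh_edge (K : R) : R := 2 * cosh (K / 2) * sinh (K / 2) / K.

(** The integral of [cosh ^+ 2] alone, along the same profile. *)
Definition cosh_mass (K : R) : R := (1 + cosh_edge K) / 2.

Variable K : R.
Hypothesis K0 : K != 0.
Let C s := cosh (K * s + - (K / 2)).
Let S s := sinh (K * s + - (K / 2)).

Let dC (s : R) : is_derive s 1 C (K * S s).
Proof. exact: is_derive_comp_affine is_derive_cosh. Qed.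

Let dS (s : R) : is_derive s 1 S (K * C s).
Proof. exact: is_derive_comp_affine is_derive_sinh. Qed.

Let cC : continuous C. Proof. exact: derive_continuous dC. Qed.
Let cS : continuous S. Proof. exact: derive_continuous dS. Qed.

Let E1 : K * 1 + - (K / 2) = K / 2. Proof. by field. Qed.
Let E0 : K * 0 + - (K / 2) = - (K / 2). Proof. by rewrite mulr0 add0r. Qed.

Lemma integral_cosh_edge :
  (\int[mu]_(s in `[0%R, 1%R]) (S s ^+ 2 + C s ^+ 2)%:E = (cosh_edge K)%:E)%E.
Proof.
have dF (s : R) : is_derive s 1 (fun s => K^-1 * (S s * C s)) (S s ^+ 2 + C s ^+ 2).
  apply: (is_derive_eq (is_deriveM (is_derive_cst K^-1 s 1) (is_deriveM (dS s) (dC s)))).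
  by rewrite /GRing.scale/=; field.
have cf : continuous (fun s => S s ^+ 2 + C s ^+ 2).
  by apply: continuousDfun; exact: continuousXfun.
rewrite (FTC2_everywhere ler01 dF cf); congr EFin.
by rewrite /S /C E1 E0 coshN sinhN /cosh_edge; field.
Qed.

Lemma integral_cosh_mass :
  (\int[mu]_(s in `[0%R, 1%R]) (C s ^+ 2)%:E = (cosh_mass K)%:E)%E.
Proof.
have dF (s : R) : is_derive s 1 (fun s => (s + K^-1 * (S s * C s)) / 2) (C s ^+ 2).
  pose P r := S r * C r.
  have dP : is_derive s 1 P (K * (S s ^+ 2 + C s ^+ 2)).
    by apply: (is_derive_eq (is_deriveM (dS s) (dC s))); rewrite /GRing.scale/=; ring.
  rewrite -[fun _ => _]/(fun r => (r + K^-1 * P r) / 2).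
  clearbody P; apply: is_derive_eq; rewrite /GRing.scale/=.
  transitivity ((1 + (S s ^+ 2 + C s ^+ 2)) / 2); first by field.
  have : C s ^+ 2 - S s ^+ 2 = 1 := cosh2_sinh2 _.
  set c := C s; set d := S s; clearbody c d; lra.
have cf : continuous (fun s => C s ^+ 2) by exact: continuousXfun.
rewrite (FTC2_everywhere ler01 dF cf); congr EFin.
by rewrite /S /C E1 E0 coshN sinhN /cosh_mass /cosh_edge; field.
Qed.

Lemma integral_cosh_mass_scaled (c : R) : 0 <= c ->
  (\int[mu]_(s in `[0%R, 1%R]) (c * C s ^+ 2)%:E = (c * cosh_mass K)%:E)%E.
Proof.
move=> c0; rewrite EFinM -integral_cosh_mass.
have mC : measurable_fun (`[0, 1] : set R) (fun s => (C s ^+ 2)%:E).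
  by apply/measurable_EFinP; apply: measurable_funTS; apply: continuous_measurable_fun; exact: continuousXfun.
under eq_integral do rewrite EFinM.
by rewrite ge0_integralZl// => s _; rewrite lee_fin sqr_ge0.
Qed.

End HyperbolicCosine.

Section RectangleTrial.
Context {R : realType}.
Local Notation mu := (@lebesgue_measure R).

Let integral_comb2 (a b g1 g2 : R) (G1 G2 : R -> R) : 0 <= a -> 0 <= b ->
  continuous G1 -> continuous G2 -> (forall s, 0 <= G1 s) -> (forall s, 0 <= G2 s) ->
  (\int[mu]_(s in `[0%R, 1%R]) (G1 s)%:E = g1%:E)%E ->
  (\int[mu]_(s in `[0%R, 1%R]) (G2 s)%:E = g2%:E)%E ->
  (\int[mu]_(s in `[0%R, 1%R]) (a * G1 s + b * G2 s)%:E = (a * g1 + b * g2)%:E)%E.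
Proof.
move=> a0 b0 c1 c2 p1 p2 i1 i2.
have m (G : R -> R) : continuous G -> measurable_fun (`[0, 1] : set R) (fun s => (G s)%:E).
  by move=> cG; apply/measurable_EFinP; apply: measurable_funTS; exact: continuous_measurable_fun.
rewrite EFinD !EFinM -i1 -i2.
rewrite -ge0_integralZl//; [|exact: m|by move=> s _; rewrite lee_fin].
rewrite -ge0_integralZl//; [|exact: m|by move=> s _; rewrite lee_fin].
rewrite -ge0_integralD//.
- by move=> s _; rewrite mule_ge0// lee_fin.
- by apply: emeasurable_funM => //; exact: m.
- by move=> s _; rewrite mule_ge0// lee_fin.
- by apply: emeasurable_funM => //; exact: m.
Qed.

Variables (p : 'I_4 -> R * R) (i : 'I_4).
Local Notation D := (interior_region p).
Local Notation v := (side p i).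
Local Notation w := (side p (ordS i)).
Local Notation Phi := (frame (p i) v w).
Local Notation l1 := (enorm v).
Local Notation l2 := (enorm w).
Hypothesis opp02 : side p (ordS (ordS i)) = - v.
Hypothesis vw : det2 v w != 0.
Hypothesis ortho : dot v w = 0.
Variable k : R.
Hypothesis k0 : 0 < k.

Let l10 : 0 < l1. Proof. exact: (enorm_gt0 vw). Qed.

Let l20 : 0 < l2.
Proof. by apply: (@enorm_gt0 _ _ v); rewrite det2C oppr_eq0. Qed.

Let absdet : `|det2 v w| = l1 * l2.
Proof.
have := lagrange v w; rewrite ortho expr0n/= addr0 => E.
by rewrite -sqrtr_sqr E sqrtr_sqr ger0_norm// mulr_ge0// ltW.
Qed.

Let A x := k * dot (x - p i) (unit_vec v) + - (k * l1 / 2).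
Let B x := k * dot (x - p i) (unit_vec w) + - (k * l2 / 2).

Definition cosh_trial x := cosh (A x) * cosh (B x).

Let e1 := unit_vec v.
Let e2 := unit_vec w.

Let grad_trial (x : R * R) : R * R :=
  (k * sinh (A x) * cosh (B x) * e1.1 + k * cosh (A x) * sinh (B x) * e2.1,
   k * sinh (A x) * cosh (B x) * e1.2 + k * cosh (A x) * sinh (B x) * e2.2).

Let cdot (e : R * R) (c : R) : continuous (fun x : R * R => k * dot (x - p i) e + c).
Proof.
apply: continuousDfun; last exact: cst_continuous.
apply: continuousMfun; first exact: cst_continuous.
apply: continuousDfun; apply: continuousMfun; try exact: cst_continuous;
  (apply: continuousDfun; last exact: cst_continuous).
  exact: continuous_fst.
exact: continuous_snd.
Qed.

Let cchA : continuous (fun x => cosh (A x)).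
Proof. exact: continuous_composition (@cdot _ _) (@continuous_cosh R). Qed.
Let cchB : continuous (fun x => cosh (B x)).
Proof. exact: continuous_composition (@cdot _ _) (@continuous_cosh R). Qed.
Let cshA : continuous (fun x => sinh (A x)).
Proof. exact: continuous_composition (@cdot _ _) (@continuous_sinh R). Qed.
Let cshB : continuous (fun x => sinh (B x)).
Proof. exact: continuous_composition (@cdot _ _) (@continuous_sinh R). Qed.

Let cosh_trial_C1 : classC 1 cosh_trial /\ grad cosh_trial = grad_trial.
Proof.
have cprod (f g : R * R -> R) (c : R) : continuous f -> continuous g ->
    continuous (fun x => k * f x * g x * c).
  by move=> cf cg; apply: continuousMfun; [apply: continuousMfun => //; apply: continuousMfun => //|]; exact: cst_continuous.
apply: classC1_grad.
- exact: (continuousMfun cchA cchB).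
- exact: (continuousDfun (cprod _ _ _ cshA cchB) (cprod _ _ _ cchA cshB)).
- exact: (continuousDfun (cprod _ _ _ cshA cchB) (cprod _ _ _ cchA cshB)).
- move=> x y.
  have dA : is_derive x 1 (fun t : R => A (t, y)) (k * e1.1).
    by rewrite /A /dot/=; apply: is_derive_eq; rewrite /GRing.scale/= /e1; ring.
  have dB : is_derive x 1 (fun t : R => B (t, y)) (k * e2.1).
    by rewrite /B /dot/=; apply: is_derive_eq; rewrite /GRing.scale/= /e2; ring.
  have dcA := @is_derive1_comp R cosh (fun t : R => A (t, y)) x _ _ (is_derive_cosh _) dA.
  have dcB := @is_derive1_comp R cosh (fun t : R => B (t, y)) x _ _ (is_derive_cosh _) dB.
  apply: (is_derive_eq (is_deriveM dcA dcB)); rewrite /GRing.scale/=; ring.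
- move=> x y.
  have dA : is_derive y 1 (fun t : R => A (x, t)) (k * e1.2).
    by rewrite /A /dot/=; apply: is_derive_eq; rewrite /GRing.scale/= /e1; ring.
  have dB : is_derive y 1 (fun t : R => B (x, t)) (k * e2.2).
    by rewrite /B /dot/=; apply: is_derive_eq; rewrite /GRing.scale/= /e2; ring.
  have dcA := @is_derive1_comp R cosh (fun t : R => A (x, t)) y _ _ (is_derive_cosh _) dA.
  have dcB := @is_derive1_comp R cosh (fun t : R => B (x, t)) y _ _ (is_derive_cosh _) dB.
  apply: (is_derive_eq (is_deriveM dcA dcB)); rewrite /GRing.scale/=; ring.
Qed.

Let K1 := k * l1.
Let K2 := k * l2.

Let AE (s r : R) : A (Phi (s, r)) = K1 * s + - (K1 / 2).
Proof.
rewrite /A; have -> : dot (Phi (s, r) - p i) (unit_vec v) = s * (dot v v / l1) + r * (dot v w / l1).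
  by rewrite /dot /unit_vec /frame/=; ring.
by rewrite ortho -enorm_sqr /K1; field; rewrite gt_eqF.
Qed.

Let BE (s r : R) : B (Phi (s, r)) = K2 * r + - (K2 / 2).
Proof.
rewrite /B; have -> : dot (Phi (s, r) - p i) (unit_vec w) = s * (dot v w / l2) + r * (dot w w / l2).
  by rewrite /dot /unit_vec /frame/=; ring.
by rewrite ortho -enorm_sqr /K2; field; rewrite gt_eqF.
Qed.

Let gradE x : dot (grad cosh_trial x) (grad cosh_trial x) =
  k ^+ 2 * (sinh (A x) ^+ 2 * cosh (B x) ^+ 2 + cosh (A x) ^+ 2 * sinh (B x) ^+ 2).
Proof.
have [_ ->] := cosh_trial_C1.
have n1 : dot e1 e1 = 1 by exact: unit_vec_unit.
have n2 : dot e2 e2 = 1 by exact: unit_vec_unit.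
have n12 : dot e1 e2 = 0 by rewrite dot_unit ortho mul0r.
pose a := k * sinh (A x) * cosh (B x); pose b := k * cosh (A x) * sinh (B x).
transitivity (a ^+ 2 * dot e1 e1 + b ^+ 2 * dot e2 e2 + 2 * a * b * dot e1 e2).
  by rewrite /grad_trial -/a -/b /dot/=; ring.
by rewrite n1 n2 n12 /a /b; ring.
Qed.

(** The trial function solves [laplacian u = 2 * k ^+ 2 * u] and its energy is
    explicit. The parameter [e] is what can be gained on [2 * k ^+ 2] when [beta]
    is larger than the coupling for which the trial function is an eigenfunction. *)
Lemma lambda1_le_cosh (beta e : R) : 0 <= e -> 0 <= beta -> (0 < area D)%E ->
  let J1 := cosh_mass K1 in let J2 := cosh_mass K2 in
  l1 * l2 * ((k ^+ 2 * cosh_edge K1 + e * J1) * J2 + k ^+ 2 * J1 * cosh_edge K2) <=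
    beta * (l1 * (2 * cosh (K2 / 2) ^+ 2 * J1) + l2 * (2 * cosh (K1 / 2) ^+ 2 * J2)) ->
  (lambda1 p (- beta) <= (- (2 * k ^+ 2 + e))%:E)%E.
Proof.
move=> ege0 b0 D0 J1 J2 ineq.
have [C1u _] := cosh_trial_C1; have [cu _ cg1 cg2] := C1u.
have kk0 : 0 <= 2 * k ^+ 2 + e by rewrite addr_ge0// mulr_ge0// sqr_ge0.
have K10 : K1 != 0 by rewrite gt_eqF// mulr_gt0.
have K20 : K2 != 0 by rewrite gt_eqF// mulr_gt0.
have aff (K : R) : continuous (fun s : R => K * s + - (K / 2)) by exact: continuous_affine.
have cC (K : R) : continuous (fun s : R => cosh (K * s + - (K / 2)) ^+ 2).
  apply: continuousXfun.
  exact: (continuous_composition (@aff K) (@continuous_cosh R)).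
have cS (K : R) : continuous (fun s : R => sinh (K * s + - (K / 2)) ^+ 2 + cosh (K * s + - (K / 2)) ^+ 2).
  apply: continuousDfun => //; apply: continuousXfun.
  exact: (continuous_composition (@aff K) (@continuous_sinh R)).
have S0 (x y : R) : 0 <= x ^+ 2 + y ^+ 2 by apply: addr_ge0; exact: sqr_ge0.
apply: (lambda1_le_trial C1u) => //; first by move=> x; rewrite mulr_gt0// cosh_gt0.
have FE x : dot (grad cosh_trial x) (grad cosh_trial x) + (2 * k ^+ 2 + e) * cosh_trial x ^+ 2 =
    k ^+ 2 * cosh (B x) ^+ 2 * (sinh (A x) ^+ 2 + cosh (A x) ^+ 2) +
    (k ^+ 2 * (sinh (B x) ^+ 2 + cosh (B x) ^+ 2) + e * cosh (B x) ^+ 2) * cosh (A x) ^+ 2.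
  by rewrite gradE /cosh_trial; ring.
rewrite (integral_parallelogram2 vw opp02); first last.
- by move=> x; rewrite addr_ge0 ?dot_ge0// mulr_ge0// sqr_ge0.
- apply: continuousDfun.
    exact: (continuousDfun (continuousMfun cg1 cg1) (continuousMfun cg2 cg2)).
  by apply: continuousMfun; [exact: cst_continuous|exact: continuousXfun].
have -> : (\int[mu]_(r in `[0%R, 1%R]) \int[mu]_(s in `[0%R, 1%R])
    (dot (grad cosh_trial (Phi (s, r))) (grad cosh_trial (Phi (s, r))) +
     (2 * k ^+ 2 + e) * cosh_trial (Phi (s, r)) ^+ 2)%:E =
    ((k ^+ 2 * cosh_edge K1 + e * J1) * J2 + k ^+ 2 * J1 * cosh_edge K2)%:E)%E.
  transitivity (\int[mu]_(r in `[0%R, 1%R])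
     ((k ^+ 2 * cosh_edge K1 + e * J1) * cosh (K2 * r + - (K2 / 2)) ^+ 2 +
      k ^+ 2 * J1 * (sinh (K2 * r + - (K2 / 2)) ^+ 2 + cosh (K2 * r + - (K2 / 2)) ^+ 2))%:E)%E.
    apply: eq_integral => r _; under eq_integral do rewrite FE AE BE.
    rewrite (integral_comb2 _ _ _ _ _ _ (integral_cosh_edge K10) (integral_cosh_mass K10)) //.
    - by congr EFin; rewrite -/J1; ring.
    - by rewrite mulr_ge0// sqr_ge0.
    - by rewrite addr_ge0// mulr_ge0// sqr_ge0.
    - by move=> s; exact: sqr_ge0.
  have edge0 (K : R) : K != 0 -> 0 <= cosh_edge K.
    move=> K0'; rewrite -lee_fin -integral_cosh_edge//; apply: integral_ge0 => s _.
    by rewrite lee_fin.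
  have mass0 (K : R) : K != 0 -> 0 <= cosh_mass K.
    move=> K0'; rewrite -lee_fin -integral_cosh_mass//; apply: integral_ge0 => s _.
    by rewrite lee_fin sqr_ge0.
  rewrite (integral_comb2 _ _ _ _ _ _ (integral_cosh_mass K20) (integral_cosh_edge K20)) //.
  - by apply: addr_ge0; apply: mulr_ge0; rewrite ?sqr_ge0 ?edge0 ?mass0.
  - by apply: mulr_ge0; rewrite ?sqr_ge0 ?mass0.
  - by move=> s; exact: sqr_ge0.
rewrite absdet -EFinM (boundary_parallelogram opp02); [|exact: continuousXfun|by move=> x; exact: sqr_ge0].
have I1 (r : R) : (\int[mu]_(s in `[0%R, 1%R]) (cosh_trial (Phi (s, r)) ^+ 2)%:E =
    (cosh (K2 * r + - (K2 / 2)) ^+ 2 * J1)%:E)%E.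
  transitivity (\int[mu]_(s in `[0%R, 1%R])
    (cosh (K2 * r + - (K2 / 2)) ^+ 2 * cosh (K1 * s + - (K1 / 2)) ^+ 2)%:E)%E; last first.
    exact: (integral_cosh_mass_scaled K10 (sqr_ge0 _)).
  by apply: eq_integral => s _; rewrite /cosh_trial AE BE exprMn mulrC.
have I2 (s : R) : (\int[mu]_(r in `[0%R, 1%R]) (cosh_trial (Phi (s, r)) ^+ 2)%:E =
    (cosh (K1 * s + - (K1 / 2)) ^+ 2 * J2)%:E)%E.
  transitivity (\int[mu]_(r in `[0%R, 1%R])
    (cosh (K1 * s + - (K1 / 2)) ^+ 2 * cosh (K2 * r + - (K2 / 2)) ^+ 2)%:E)%E; last first.
    exact: (integral_cosh_mass_scaled K20 (sqr_ge0 _)).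
  by apply: eq_integral => r _; rewrite /cosh_trial AE BE exprMn.
have h1 (K : R) : K * 1 + - (K / 2) = K / 2 by field.
have h0 (K : R) : K * 0 + - (K / 2) = - (K / 2) by rewrite mulr0 add0r.
have I10 := I1 0; have I11 := I1 1; have I20 := I2 0; have I21 := I2 1.
rewrite h0 coshN in I10; rewrite h1 in I11; rewrite h0 coshN in I20; rewrite h1 in I21.
rewrite I10 I11 I20 I21 {I10 I11 I20 I21 I1 I2}; move: ineq.
move: J1 J2 (cosh_edge K1) (cosh_edge K2) (cosh (K1 / 2)) (cosh (K2 / 2)) => j1 j2 q1 q2 c1 c2 ineq.
rewrite -!EFinD -!EFinM lee_fin.
by apply: le_trans ineq _; rewrite le_eqVlt; apply/orP; left; apply/eqP; ring.
Qed.

End RectangleTrial.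

(** * Comparison with the square of equal area *)

Section Comparison.
Context {R : realType}.

Lemma pos_sqr_inj (x y : R) : 0 < x -> 0 < y -> x ^+ 2 = y ^+ 2 -> x = y.
Proof. by move=> x0 y0 xy; apply/eqP; rewrite -(@eqrXn2 _ 2) ?ltW// xy. Qed.

Variable p : 'I_4 -> R * R.
Local Notation D := (interior_region p).

(** By [lambda1_square_ge] a common [k] yields the comparison with every square
    of side [l]; this form keeps the square out of the estimates on [p]. *)
Definition dominates (l beta : R) := exists k, [/\ 0 <= k,
  beta <= k * tanh (k * l / 2) & (lambda1 p (- beta) <= (- (2 * k ^+ 2))%:E)%E].

Lemma lambda1_le_const (A beta : R) : area D = A%:E -> 0 < A -> 0 <= beta ->
  (lambda1 p (- beta) <= (- (beta * perimeter p / A))%:E)%E.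
Proof.
move=> AE A0 b0.
have P0 : 0 <= perimeter p by apply: sumr_ge0 => i _; exact: enorm_ge0.
have [C1u gE] : classC 1 (fun _ : R * R => 1 : R) /\
    grad (fun _ : R * R => 1 : R) = fun _ => (0, 0).
  by apply: classC1_grad => //=; try exact: cst_continuous; move=> x y; exact: is_derive_cst.
apply: (lambda1_le_trial C1u) => //; first by rewrite AE lte_fin.
  by rewrite divr_ge0 ?mulr_ge0// ltW.
under eq_integral do rewrite gE /dot/= mulr0 addr0 add0r expr1n mulr1.
rewrite integral_cst; last exact: measurable_interior.
have -> : boundary_integral p (fun=> 1 ^+ 2) = (perimeter p)%:E.
  rewrite /boundary_integral /perimeter -sumEFin; apply: eq_bigr => j _.
  rewrite integral_cst//= lebesgue_measure_itv/= lte_fin ltr01 -EFinB subr0.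
  by rewrite expr1n !mule1.
rewrite [X in (_ * X <= _)%E](_ : _ = A%:E); last exact: AE.
by rewrite -!EFinM lee_fin divfK// gt_eqF.
Qed.

(** The constant function gives [- beta * perimeter p / l ^+ 2]. To first order
    in [beta] the square of side [l] gives [- 4 * beta / l]: the longer perimeter
    wins. *)
Lemma dominates_small (l : R) : 0 < l -> area D = (l ^+ 2)%:E ->
  4 * l < perimeter p ->
  exists2 b : R, 0 < b & forall beta, 0 < beta -> beta <= b -> dominates l beta.
Proof.
move=> l0 AE lP; set P := perimeter p in lP *.
have P0 : 0 < P by apply: lt_trans lP; rewrite mulr_gt0.
pose d := P / (4 * l) - 1.
have d0 : 0 < d by rewrite subr_gt0 ltr_pdivlMr ?mulr_gt0// mul1r.
exists (8 * d ^+ 2 / P); first by rewrite divr_gt0// mulr_gt0// exprn_gt0.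
move=> beta b0; rewrite ler_pdivlMr// => bP.
have q0 : 0 <= beta * P / l ^+ 2 / 2 by rewrite !divr_ge0 ?exprn_ge0 ?mulr_ge0 ?ltW.
(* The [k] for which [2 * k ^+ 2] is the value given by the constant function;
   [d] is the margin left by the perimeter for the denominator in
   [tanh_ge_frac]. *)
exists (Num.sqrt (beta * P / l ^+ 2 / 2)).
set k := Num.sqrt _; have k2 : k ^+ 2 = beta * P / l ^+ 2 / 2 by exact: sqr_sqrtr.
have k0 : 0 <= k by exact: sqrtr_ge0.
split => //; last first.
  rewrite k2 [2 * _]mulrC divfK//; apply: lambda1_le_const => //; last exact: ltW.
  by rewrite exprn_gt0.
have kl0 : 0 <= k * l / 2 by rewrite divr_ge0// mulr_ge0// ltW.
have kl : k * l / 2 <= d.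
  rewrite -(@ler_pXn2r _ 2)// ?nnegrE ?(ltW d0)//.
  have -> : (k * l / 2) ^+ 2 = k ^+ 2 * l ^+ 2 / 4 by field.
  have -> : k ^+ 2 * l ^+ 2 / 4 = beta * P / 8 by rewrite k2; field; rewrite gt_eqF.
  by lra.
have t := tanh_ge_frac kl0.
apply: le_trans (ler_wpM2l k0 t).
have d1 : 0 < 1 + k * l / 2 by rewrite ltr_pwDl.
rewrite mulrA ler_pdivlMr//.
have -> : k * (k * l / 2) = beta * (1 + d).
  have -> : k * (k * l / 2) = k ^+ 2 * l / 2 by ring.
  by rewrite k2 /d; field; rewrite gt_eqF.
by rewrite ler_pM2l// lerD2l.
Qed.

(** For the square of side [l] the excess over [2 * beta ^+ 2] is exponentially
    small: by [tanh_ge_exp] the value [k = beta * (1 + 4 * z)] is admissible, with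
    [z = expR (- (beta * l))]. *)
Lemma dominates_exp (l beta : R) : 0 < l -> 0 < beta ->
  expR (- (beta * l)) <= 4^-1 ->
  (lambda1 p (- beta) <= (- ((2 + 24 * expR (- (beta * l))) * beta ^+ 2))%:E)%E ->
  dominates l beta.
Proof.
move=> l0 b0; set z := expR _ => z4 up; have z0 : 0 < z by exact: expR_gt0.
exists (beta * (1 + 4 * z)); split.
- by rewrite mulr_ge0 ?ltW// addr_gt0// mulr_gt0.
- have t := tanh_ge_exp (beta * (1 + 4 * z) * l / 2).
  have zz : expR (- (2 * (beta * (1 + 4 * z) * l / 2))) <= z.
    rewrite ler_expR lerN2.
    have -> : 2 * (beta * (1 + 4 * z) * l / 2) = beta * l + 4 * z * (beta * l) by field.
    by rewrite lerDl !mulr_ge0// ltW.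
  move: t zz; set T := tanh _; set E := expR _ => t zz.
  rewrite -mulrA ler_peMr ?(ltW b0)//; clearbody z T E.
  have : 0 <= z * (1 - 4 * z) by rewrite mulr_ge0 ?(ltW z0)// subr_ge0; lra.
  have : 0 <= (1 + 4 * z) * (T - 1 + 2 * z) by rewrite mulr_ge0//; lra.
  by nra.
- apply: le_trans up _; rewrite lee_fin lerN2 exprMn mulrCA [leRHS]mulrC ler_wpM2l ?sqr_ge0//.
  have : 0 <= z * (1 - 4 * z) by rewrite mulr_ge0 ?(ltW z0)// subr_ge0; lra.
  by clearbody z; nra.
Qed.

(** The excess [24 * z] of the square in [dominates_exp] tends to 0 and falls
    below [eta]. *)
Lemma dominates_steep (l : R) : 0 < l -> steep p ->
  exists2 b : R, 0 < b & forall beta, b <= beta -> dominates l beta.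
Proof.
move=> l0 [eta [B [eta0 B0 up]]].
pose m := 4 / l + 24 / (l * eta).
have m0 : 0 < m by rewrite addr_gt0// divr_gt0// mulr_gt0.
exists (B + m); first by rewrite addr_gt0.
move=> beta bB; have b0 : 0 < beta by lra.
have bm : m <= beta by lra.
have z1 : expR (- (beta * l)) * (beta * l) <= 1.
  have e := expR_ge1Dx (beta * l); have ep := expR_gt0 (- (beta * l)).
  have eN := expRxMexpNx_1 (beta * l).
  move: e ep eN; move: (expR _) (expR _) => E F e ep eN; nra.
have z0 := expR_gt0 (- (beta * l)).
have bl : 4 + 24 / eta <= beta * l.
  have -> : 4 + 24 / eta = m * l by rewrite /m; field; rewrite !gt_eqF.
  by rewrite ler_pM2r.
have e24 : 0 < 24 / eta by rewrite divr_gt0.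
move: z1 z0; set z := expR _; move=> z1 z0.
apply: dominates_exp => //.
  by rewrite -/z; move: bl z1; move: (beta * l) (24 / eta) e24 => x y y0 xy zx; nra.
apply: le_trans (up beta _) _; first by lra.
rewrite -/z lee_fin lerN2 ler_wpM2r ?sqr_ge0// lerD2l.
have : 24 / eta * z <= 1 by move: bl z1; move: (beta * l) (24 / eta) e24 => x y y0 xy zx; nra.
by rewrite mulrAC ler_pdivrMr// mul1r.
Qed.

Section Rectangle.
Hypothesis right : forall j, dot (side p j) (side p (ordS j)) = 0.
Hypothesis nz : forall j, det2 (side p j) (side p (ordS j)) != 0.

Lemma area_rectangle i :
  area D = (enorm (side p i) * enorm (side p (ordS i)))%:E.
Proof.
rewrite (area_parallelogram (nz i) (right_angles_opp right i)); congr EFin.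
have := lagrange (side p i) (side p (ordS i)); rewrite right expr0n/= addr0 => E.
by rewrite -sqrtr_sqr E sqrtr_sqr ger0_norm// mulr_ge0// enorm_ge0.
Qed.

Lemma perimeter_rectangle i :
  perimeter p = 2 * (enorm (side p i) + enorm (side p (ordS i))).
Proof.
rewrite /perimeter (big_ord4 _ i)/= !(right_angles_opp right) !enormN; ring.
Qed.

(** A rectangle gains [beta / l1 * expR (- (beta * l1))] over [2 * beta ^+ 2],
    where [l1] is its shorter side; since [l1 < l] this dominates the excess
    [24 * beta ^+ 2 * expR (- (beta * l))] of the square. *)
Lemma dominates_rectangle (l : R) i : area D = (l ^+ 2)%:E ->
  enorm (side p i) < l ->
  exists2 b : R, 0 < b & forall beta, b <= beta -> dominates l beta.
Proof.
move=> AE; have opp := right_angles_opp right i.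
have D0 : (0 < area D)%E.
  by rewrite (area_parallelogram (nz i) opp) lte_fin normr_gt0.
have l10 : 0 < enorm (side p i) := enorm_gt0 (nz i).
have l20 : 0 < enorm (side p (ordS i)) := enorm_gt0 (nz (ordS i)).
have cosh_le := @lambda1_le_cosh R p i opp (nz i) (right i).
move: cosh_le l10 l20; set l1 := enorm (side p i); set l2 := enorm (side p (ordS i)).
move=> cosh_le l10 l20 l1l; have l0 : 0 < l by exact: lt_trans l1l.
(* The three terms ensure in turn [1 <= beta * l1], then [beta * l >= 3] and the
   domination of the exponentials, by their quadratic lower bound. *)
pose m := l1^-1 + 3 / l + 48 * l1 / (l - l1) ^+ 2.
have d0 : 0 < l - l1 by rewrite subr_gt0.
have m1 : 0 < l1^-1 by rewrite invr_gt0.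
have m2 : 0 < 3 / l by rewrite divr_gt0.
have m3 : 0 < 48 * l1 / (l - l1) ^+ 2 by rewrite divr_gt0 ?mulr_gt0// exprn_gt0.
exists m; first by rewrite !addr_gt0.
move=> beta mb; have b0 : 0 < beta by move: mb; rewrite /m; lra.
have b1 : 1 <= beta * l1 by rewrite -ler_pdivrMr// div1r; move: mb; rewrite /m; lra.
have b2 : 3 <= beta * l by rewrite -ler_pdivrMr//; move: mb; rewrite /m; lra.
have b3 : 48 * l1 <= beta * (l - l1) ^+ 2.
  by rewrite -ler_pdivrMr ?exprn_gt0//; move: mb; rewrite /m; lra.
pose e := beta * expR (- (beta * l1)) / l1.
have e0 : 0 < e by rewrite divr_gt0// mulr_gt0// expR_gt0.
apply: dominates_exp => //.
  have E := expR_ge1Dx (beta * l); have ep := expR_gt0 (- (beta * l)).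
  have eN := expRxMexpNx_1 (beta * l).
  move: E ep eN; move: (expR _) (expR _) => E F h ep eN; nra.
apply: le_trans (cosh_le beta b0 beta e (ltW e0) (ltW b0) D0 _) _; last first.
  rewrite lee_fin lerN2 mulrDl lerD2l.
  have -> : 24 * expR (- (beta * l)) * beta ^+ 2 =
      e * (24 * beta * l1 * expR (- (beta * (l - l1)))).
    rewrite /e.
    have -> : - (beta * l) = - (beta * l1) + - (beta * (l - l1)) by ring.
    by rewrite expRD; field; rewrite gt_eqF.
  rewrite ler_piMr ?(ltW e0)//.
  have x0 : 0 <= beta * (l - l1) by rewrite mulr_ge0// ltW.
  have := expR_ge1Dxn 1 x0.
  have := expRxMexpNx_1 (beta * (l - l1)); have := expR_gt0 (- (beta * (l - l1))).
  have : 48 * (beta * l1) <= (beta * (l - l1)) ^+ 2.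
    by have := ler_wpM2l (ltW b0) b3; rewrite exprMn; lra.
  rewrite -[2`!]/2%N.
  set F := expR (- _); set E := expR _ => E2 F0 FE h.
  have -> : 24 * beta * l1 * F = (24 * (beta * l1)) * F by ring.
  rewrite -[leRHS]FE ler_wpM2r ?(ltW F0)//.
  by move: ((beta * (l - l1)) ^+ 2) E2 h => x; clearbody E; lra.
rewrite -/l1 -/l2.
have K10 : 0 < beta * l1 by rewrite mulr_gt0.
have K20 : 0 < beta * l2 by rewrite mulr_gt0.
have edgeE (K : R) : 0 < K -> cosh_edge K * K = 2 * cosh (K / 2) * sinh (K / 2).
  by move=> K0; rewrite /cosh_edge divfK// gt_eqF.
have sinh_ge0 (x : R) : 0 <= x -> 0 <= sinh x.
  by move=> x0; rewrite divr_ge0// subr_ge0 ler_expR; lra.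
have mass_ge0 (K : R) : 0 < K -> 0 <= cosh_mass K.
  move=> K0; rewrite divr_ge0// addr_ge0// /cosh_edge divr_ge0 ?(ltW K0)//.
  apply: mulr_ge0; last by apply: sinh_ge0; rewrite divr_ge0// ltW.
  by rewrite mulr_ge0// ltW// cosh_gt0.
(* At [k = beta] the normal derivative of the trial function, proportional to
   [sinh], falls short of the boundary condition by [cosh - sinh]. *)
have gain (x : R) : 1 <= 2 * (cosh x * (cosh x - sinh x)).
  have -> : 2 * (cosh x * (cosh x - sinh x)) = expR x * expR (- x) + expR (- x) ^+ 2.
    by rewrite /cosh /sinh; field.
  by rewrite expRxMexpNx_1 lerDl sqr_ge0.
have J1e : e * l1 * cosh_mass (beta * l1) <= beta.
  have -> : e * l1 = beta * expR (- (beta * l1)) by rewrite /e divfK// gt_eqF.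
  rewrite -mulrA ler_piMr ?(ltW b0)//.
  have -> : cosh_mass (beta * l1) = (1 + (expR (beta * l1) - expR (- (beta * l1))) / 2 / (beta * l1)) / 2.
    rewrite /cosh_mass /cosh_edge /cosh /sinh.
    have -> : expR (beta * l1) = expR (beta * l1 / 2) * expR (beta * l1 / 2).
      by rewrite -expRD; congr expR; field.
    have -> : expR (- (beta * l1)) = expR (- (beta * l1 / 2)) * expR (- (beta * l1 / 2)).
      by rewrite -expRD; congr expR; field.
    by field; rewrite gt_eqF//= gt_eqF.
  have eN := expRxMexpNx_1 (beta * l1); have ep := expR_gt0 (- (beta * l1)).
  have h : expR (- (beta * l1)) <= 1 by rewrite -expR0 ler_expR oppr_le0 ltW.
  set E := expR (beta * l1) in eN *; set F := expR (- _) in eN ep h *.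
  have : (E - F) / 2 / (beta * l1) <= E.
    rewrite ler_pdivrMr//.
    by move: b1; move: (beta * l1) => y y1; clearbody E F; nra.
  move: (_ / _ / _) => g gE; clearbody E F; nra.
have g1 := gain (beta * l1 / 2); have g2 := gain (beta * l2 / 2).
have ed1 := edgeE _ K10; have ed2 := edgeE _ K20.
have M1 := mass_ge0 _ K10; have M2 := mass_ge0 _ K20.
move: g1 g2 ed1 ed2 M1 M2 J1e.
move: (cosh_mass (beta * l1)) (cosh_mass (beta * l2)) (cosh_edge (beta * l1))
  (cosh_edge (beta * l2)) (cosh (beta * l1 / 2)) (cosh (beta * l2 / 2))
  (sinh (beta * l1 / 2)) (sinh (beta * l2 / 2)) => J1 J2 E1 E2 c1 c2 s1 s2.
move=> g1 g2 ed1 ed2 M1 M2 J1e.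
have -> : l1 * l2 * ((beta ^+ 2 * E1 + e * J1) * J2 + beta ^+ 2 * J1 * E2) =
    beta * l2 * J2 * (E1 * (beta * l1)) + beta * l1 * J1 * (E2 * (beta * l2)) +
    (e * l1 * J1) * (l2 * J2) by ring.
rewrite ed1 ed2 -subr_ge0.
have -> : beta * (l1 * (2 * c2 ^+ 2 * J1) + l2 * (2 * c1 ^+ 2 * J2)) -
   (beta * l2 * J2 * (2 * c1 * s1) + beta * l1 * J1 * (2 * c2 * s2) + e * l1 * J1 * (l2 * J2)) =
   beta * l1 * J1 * (2 * (c2 * (c2 - s2))) + l2 * J2 * (beta * (2 * (c1 * (c1 - s1)) - 1)) +
   l2 * J2 * (beta - e * l1 * J1) by ring.
have lJ : 0 <= l2 * J2 by rewrite mulr_ge0// ltW.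
apply: addr_ge0; last by rewrite mulr_ge0// subr_ge0.
apply: addr_ge0; last by rewrite mulr_ge0// mulr_ge0 ?subr_ge0// ltW.
apply: mulr_ge0; first by rewrite mulr_ge0// ltW.
exact: le_trans g2.
Qed.

(** On a square the product of hyperbolic cosines is the ground state: both
    bounds meet at the solution [k] of [k * tanh (k * l / 2) = beta]. *)
Lemma dominates_square (i : 'I_4) (beta : R) :
  enorm (side p i) = enorm (side p (ordS i)) -> 0 < beta ->
  dominates (enorm (side p i)) beta.
Proof.
move=> eq12 b0; have opp := right_angles_opp right i.
have D0 : (0 < area D)%E.
  by rewrite (area_parallelogram (nz i) opp) lte_fin normr_gt0.
have l0 : 0 < enorm (side p i) := enorm_gt0 (nz i).
have cosh_le := @lambda1_le_cosh R p i opp (nz i) (right i).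
move: cosh_le l0; rewrite -eq12; set l := enorm (side p i) => cosh_le l0.
pose f k := k * tanh (k * l / 2).
have cf : continuous f.
  have ct : continuous (fun k : R => tanh (k * l / 2)).
    have ca : continuous (fun k : R => k * l / 2).
      have -> : (fun k : R => k * l / 2) = (fun k : R => (l / 2) * k + 0).
        by apply/funext => k; field.
      exact: continuous_affine.
    exact: (continuous_composition ca (@continuous_tanh R)).
  have ci : continuous (fun k : R => k) by move=> x; exact: cvg_id.
  exact: (continuousMfun ci ct).
pose K := 2 * beta + 4 / l.
have K0 : 0 < K by rewrite addr_gt0 ?divr_gt0 ?mulr_gt0//.
have fK : beta <= f K.
  have t := tanh_ge_exp (K * l / 2).
  have E := expR_ge1Dx (2 * (K * l / 2)); have ep := expR_gt0 (- (2 * (K * l / 2))).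
  have eN := expRxMexpNx_1 (2 * (K * l / 2)).
  have K4 : 4 <= 2 * (K * l / 2).
    have -> : 2 * (K * l / 2) = 2 * (beta * l) + 4 by rewrite /K; field; rewrite gt_eqF.
    by rewrite lerDr mulr_ge0// mulr_ge0// ltW.
  have t2 : 2^-1 <= tanh (K * l / 2).
    apply: le_trans t; move: E ep eN K4; move: (2 * (K * l / 2)) (expR _) (expR _) => x F G; nra.
  apply: le_trans (ler_wpM2l (ltW K0) t2).
  by have : 0 < 4 / l by [rewrite divr_gt0]; rewrite /K; lra.
have f0 : f 0 = 0 by rewrite /f mul0r.
have [k kK fk] : exists2 k, k \in `[0, K] & f k = beta.
  apply: IVT; [exact: ltW|exact: continuous_subspaceT|].
  by rewrite f0 ge_min le_max (ltW b0) fK orbT.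
have k0 : 0 < k.
  rewrite lt_neqAle; move: kK; rewrite in_itv/= => /andP[-> _]; rewrite andbT.
  by apply/eqP => k0; move: b0; rewrite -fk -k0 f0 ltxx.
exists k; split; [exact: ltW|by rewrite -/(f k) fk|].
rewrite -[2 * k ^+ 2]addr0; apply: cosh_le => //; first exact: ltW.
rewrite -/l !mul0r !addr0; set J := cosh_mass _.
have h : cosh_edge (k * l) * (k * l) = 2 * cosh (k * l / 2) * sinh (k * l / 2).
  by rewrite /cosh_edge divfK// gt_eqF// mulr_gt0.
have hb : beta * cosh (k * l / 2) = k * sinh (k * l / 2).
  by rewrite -fk /f /tanh mulrA mulfVK// gt_eqF// cosh_gt0.
move: h hb; move: J (cosh_edge _) (cosh _) (sinh _) => J E c s h hb.
have -> : l * l * (k ^+ 2 * E * J + k ^+ 2 * J * E) = 2 * k * l * J * (E * (k * l)) by ring.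
rewrite h.
have -> : 2 * k * l * J * (2 * c * s) = 4 * l * J * c * (k * s) by ring.
by rewrite -hb le_eqVlt; apply/orP; left; apply/eqP; ring.
Qed.

End Rectangle.

(** A square of side [l] attains the bound of [dominates] for every coupling;
    any other quadrilateral has a longer perimeter, and either an acute corner or
    a side shorter than [l]. *)
Lemma dominates_extremes (l : R) : quadrilateral p -> 0 < l -> area D = (l ^+ 2)%:E ->
  exists b1 b2 : R, [/\ 0 < b1, b1 <= b2 &
    forall beta, 0 < beta -> beta <= b1 \/ b2 <= beta -> dominates l beta].
Proof.
move=> quad l0 AE.
have D0 : (0 < area D)%E by rewrite AE lte_fin exprn_gt0.
have combine : 4 * l < perimeter p ->
    (exists2 b : R, 0 < b & forall beta, b <= beta -> dominates l beta) ->
    exists b1 b2 : R, [/\ 0 < b1, b1 <= b2 &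
      forall beta, 0 < beta -> beta <= b1 \/ b2 <= beta -> dominates l beta].
  move=> lP [b b0 hb]; have [c c0 hc] := dominates_small l0 AE lP.
  exists c, (c + b); split => //; first by rewrite lerDl ltW.
  move=> beta beta0 [h|h]; first exact: hc.
  by apply: hb; apply: le_trans h; rewrite lerDr ltW.
have iso : (exists2 B : R, (area D <= B%:E)%E & 16 * B < perimeter p ^+ 2) ->
    4 * l < perimeter p.
  move=> [B]; rewrite AE lee_fin => lB BP.
  have P0 : 0 <= perimeter p by apply: sumr_ge0 => i _; exact: enorm_ge0.
  rewrite -(@ltr_pXn2r _ 2)// ?nnegrE ?mulr_ge0 ?ltW//.
  by apply: le_lt_trans BP; rewrite exprMn; lra.
have [_ nz] := quad.
case: (turns_sign quad) => [[s s1 pos]|[s s1 [i refl]]]; last first.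
  apply: combine; first by apply: iso; exact: isoperimetric_reflex s1 refl.
  by apply: dominates_steep => //; exact: steep_reflex refl D0.
case: (acute_or_right p) => [[j acute]|right].
  apply: combine.
    by apply: iso; apply: (isoperimetric_convex s1 pos); exists j; rewrite lt_eqF.
  by apply: dominates_steep => //; apply: (steep_convex pos) => //; exists j.
pose i : 'I_4 := ord0.
have l12 : l ^+ 2 = enorm (side p i) * enorm (side p (ordS i)).
  by apply: EFin_inj; rewrite -AE (area_rectangle right nz i).
have l10 : 0 < enorm (side p i) := enorm_gt0 (nz i).
have l20 : 0 < enorm (side p (ordS i)) := enorm_gt0 (nz (ordS i)).
have [eq12|neq12] := eqVneq (enorm (side p i)) (enorm (side p (ordS i))).
  exists 1, 1; split => // beta beta0 _.
  have -> : l = enorm (side p i).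
    by apply: pos_sqr_inj => //; rewrite l12 -eq12 expr2.
  exact: (dominates_square right nz eq12).
apply: combine.
  rewrite (perimeter_rectangle right i) -(@ltr_pXn2r _ 2)// ?nnegrE ?mulr_ge0 ?addr_ge0 ?ltW//.
  rewrite exprMn l12 -subr_gt0.
  set x := enorm _ in neq12 *; set y := enorm _ in neq12 *.
  have -> : (2 * (x + y)) ^+ 2 - 4 ^+ 2 * (x * y) = 4 * (x - y) ^+ 2 by ring.
  by rewrite mulr_gt0// exprn_even_gt0//= subr_eq0.
have [short|long] := ltP (enorm (side p i)) (enorm (side p (ordS i))).
  apply: (dominates_rectangle right nz AE (i := i)).
  by rewrite -(@ltr_pXn2r _ 2)// ?nnegrE ?ltW// l12 expr2 ltr_pM2l.
apply: (dominates_rectangle right nz AE (i := ordS i)).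
rewrite -(@ltr_pXn2r _ 2)// ?nnegrE ?ltW// l12 expr2 ltr_pM2r//.
by rewrite lt_neqAle eq_sym neq12.
Qed.

Lemma square_area_lambda1 : square p -> exists l : R, [/\ 0 < l, area D = (l ^+ 2)%:E &
  forall k beta, 0 <= k -> 0 <= beta -> beta <= k * tanh (k * l / 2) ->
    ((- (2 * k ^+ 2))%:E <= lambda1 p (- beta))%E].
Proof.
move=> [[_ nz] sq]; have right j : dot (side p j) (side p (ordS j)) = 0 by have [] := sq j.
pose i : 'I_4 := ord0; have [eq12 _] := sq i.
exists (enorm (side p i)); split.
- exact: enorm_gt0 (nz i).
- by rewrite (area_rectangle right nz i) -eq12 -expr2.
- move=> k beta; apply: lambda1_square_ge => //; exact: right_angles_opp.
Qed.

End Comparison.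

Theorem theorem2 (R : realType) (p : 'I_4 -> R * R) (hp : quadrilateral p) :
  exists alpha2 alpha1 : R,
    [/\ alpha2 <= alpha1, alpha1 < 0 &
        forall q : 'I_4 -> R * R, square q ->
          area (interior_region q) = area (interior_region p) ->
          forall alpha : R,
            (`]-oo, alpha2] `|` `[alpha1, 0[) alpha ->
            (lambda1 p alpha <= lambda1 q alpha)%E].
Proof.
have [[q0 [sq0 A0]]|no] := pselect (exists q0 : 'I_4 -> R * R,
    square q0 /\ area (interior_region q0) = area (interior_region p)); last first.
  exists (-1), (-1); split; [exact: lexx|exact: ltrN10|].
  by move=> q sq Aq; case: no; exists q; exact: conj sq Aq.
have [l [l0 AE _]] := square_area_lambda1 sq0.
have Ap : area (interior_region p) = (l ^+ 2)%:E := etrans (esym A0) AE.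
have [b1 [b2 [b10 b12 dom]]] := dominates_extremes hp l0 Ap.
exists (- b2), (- b1); split; [by rewrite lerN2|by rewrite oppr_lt0|].
move=> q sq Aq alpha; rewrite /= !in_itv/= => range.
have [l' [l'0 AE' low]] := square_area_lambda1 sq.
have ll : l' = l.
  have sqE : l' ^+ 2 = l ^+ 2 by apply: EFin_inj; exact: etrans (esym AE') (etrans Aq Ap).
  exact: pos_sqr_inj l'0 l0 sqE.
have a0 : alpha < 0.
  by case: range => [h|/andP[]]; [apply: le_lt_trans h _; rewrite oppr_lt0; exact: lt_le_trans b12|].
have [k [k0 kt up]] : dominates p l (- alpha).
  apply: dom; first by rewrite oppr_gt0.
  by case: range => [h|/andP[h _]]; [right; rewrite lerNr|left; rewrite lerNl].
rewrite opprK in up; apply: le_trans up _.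
rewrite -[X in lambda1 q X]opprK; apply: low k0 _ _; first by rewrite oppr_ge0 ltW.
by rewrite ll.
Qed.
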